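(* Let $M$ be a $2n$-dimensional symplectic manifold, let $\Omega\subset\mathbb{R}^{2n}$ be an open set (not necessarily connected) and let $\iota:\Omega\to M$ be a symplectic embedding such that $M\setminus\iota(\Omega)$ has measure zero. Identify $g\in\mathrm{Symp}(M)$ with the almost everywhere defined transformation $q=\iota^{-1}g\iota$ of $\Omega$, and put $$C(q_1,q_2)=\int_\Omega c\bigl(q_1'(q_2(m)),\,q_2'(m)\bigr)\,dm ,$$ where $q'(x)$ is the Jacobi matrix of $q$ at $x$ and $c$ is the Berezin cocycle on $\mathrm{Sp}(2n,\mathbb{R})$. Then: (a) $C$ defines an element of the second cohomology group $H^2(\mathrm{Symp}(M),\mathbb{R})$; in other words, the set $\mathrm{Symp}(M)\times\mathbb{R}$ with the product $$(q_1,x_1)\cdot(q_2,x_2)=\bigl(q_1\circ q_2,\;x_1+x_2+C(q_1,q_2)\bigr)$$ is a group. (b) The resulting central extension of $\mathrm{Symp}(M)$ by $\mathbb{R}$ does not depend on the choice of $\Omega$ and $\iota$ (i.e. the cocycles on $\mathrm{Symp}(M)$ obtained from two such choices differ by a coboundary).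
   Context: $\mathrm{Symp}(M)$ is the group of all $C^\infty$-smooth compactly supported symplectomorphisms of $M$ (all symplectomorphisms if $M$ is compact). $\mathbb{R}^{2n}$ carries the standard symplectic structure; $dm$ is Lebesgue measure. Berezin cocycle: $\mathrm{Sp}(2n,\mathbb{R})$ is the group of real $2n\times 2n$ matrices $g$ with $g^tKg=K$, $K=\begin{pmatrix}0&1\\-1&0\end{pmatrix}$ (blocks $n\times n$). Let $J=\frac1{\sqrt2}\begin{pmatrix}1&i\\i&1\end{pmatrix}$. For $g\in \mathrm{Sp}(2n,\mathbb{R})$ one has $J^{-1}gJ=\begin{pmatrix}\Phi&\Psi\\ \overline\Psi&\overline\Phi\end{pmatrix}$, where the bar is element-wise conjugation; write $\Phi=\Phi(g)$. Then $$c(g_1,g_2)=\mathrm{Im}\,\mathrm{tr}\ln\bigl[\Phi(g_1)^{-1}\Phi(g_1g_2)\Phi(g_2)^{-1}\bigr],$$ where the matrix in brackets has the form $1+Z$ with operator norm $\|Z\|<1$ and $\ln(1+Z)=\sum_{k\ge1}(-1)^{k+1}Z^k/k$. A 2-cocycle on a group $G$ with values in an abelian group $A$ is a function $c:G\times G\to A$ with $c(e,g)=c(g,e)=0$ and $c(g_1,g_2)+c(g_1g_2,g_3)=c(g_1,g_2g_3)+c(g_2,g_3)$; it is a coboundary (trivial) if $c(g_1,g_2)=\gamma(g_1)+\gamma(g_2)-\gamma(g_1g_2)$ for some $\gamma:G\to A$. $H^2(G,A)$ is the quotient of cocycles by coboundaries. *)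

(* Defs.v *)
From HB Require Import structures.
From mathcomp Require Import all_boot all_order all_algebra.
From mathcomp Require Import all_classical all_reals all_analysis.
From mathcomp Require Import measurable_realfun complex.
Set Implicit Arguments.
Unset Strict Implicit.
Unset Printing Implicit Defensive.
Import Order.TTheory GRing.Theory Num.Theory.
Import numFieldNormedType.Exports.
Local Open Scope classical_set_scope.
Local Open Scope ring_scope.

(* R^n is 'rV[R]_n; this is a copy of it carrying the Borel sigma-algebra. *)
Notation borelRn R n := (g_sigma_algebraType (@open 'rV[R%type]_n)).

Definition rVcons (R : realType) n (p : measurableTypeR R * borelRn R n) :
  borelRn R n.+1 := row_mx (const_mx p.1 : 'rV_1) (p.2 : 'rV[R]_n).

Lemma rVconsEl (R : realType) n x (v : borelRn R n) i :
  (rVcons (x, v) : 'rV[R]_n.+1) i (lshift n (ord0 : 'I_1)) = x.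
Proof. by rewrite /rVcons (row_mxEl (_ : 'rV_1)) mxE. Qed.

Lemma rVconsEr (R : realType) n x (v : borelRn R n) i (j : 'I_n) :
  (rVcons (x, v) : 'rV[R]_n.+1) i (rshift 1 j) = (v : 'rV[R]_n) i j.
Proof. by rewrite /rVcons (row_mxEr (_ : 'rV_1)). Qed.

(* Lebesgue measure on the Borel sets of R^n, as the n-fold product of the
   one-dimensional Lebesgue measure. *)
Fixpoint lebesgueRn (R : realType) (n : nat) : set (borelRn R n) -> \bar R :=
  match n with
  | 0%N => dirac (0 : borelRn R 0)
  | m.+1 => pushforward (lebesgue_measure \x @lebesgueRn R m)%E (@rVcons R m)
  end.

Section lebesgueRn_measure.
Variable R : realType.

Lemma borel_open n (U : set 'rV[R]_n) :
  open U -> measurable (U : set (borelRn R n)).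
Proof. by move=> oU; apply: sub_sigma_algebra. Qed.

Lemma rat_near (x e : R) : 0 < e -> exists q : rat, `|x - ratr q| < e.
Proof.
move=> e0; have : x - e < x + e by rewrite ltrBlDr -addrA ltrDl addr_gt0.
move=> /rat_in_itvoo[q]; rewrite in_itv/= => /andP[h1 h2]; exists q.
by rewrite distrC ltr_distl h1 h2.
Qed.

Lemma open_prod_measurable n (W : set (R * 'rV[R]_n)) :
  open W -> measurable (W : set (measurableTypeR R * borelRn R n)%type).
Proof.
move=> oW.
pose B (i : (rat * 'rV[rat]_n * nat)) : set (measurableTypeR R * borelRn R n) :=
  (ball (ratr i.1.1 : R) (i.2.+1%:R^-1) : set (measurableTypeR R)) `*`
  (ball (map_mx ratr i.1.2 : 'rV[R]_n) (i.2.+1%:R^-1) : set (borelRn R n)).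
have -> : W = \bigcup_i (if `[< B i `<=` W >] then B i else set0).
  apply/seteqP; split => [[x v] Wx|x [i _]]; last first.
    by case: asboolP => // + Bx; apply.
  have : nbhs (x, v) W by apply: open_nbhs_nbhs.
  move=> /nbhs_ballP[e /= e0 eW].
  have [k ke] : exists k : nat, k.+1%:R^-1 < e / 2.
    have [k _ /(_ k (leqnn k)) ?] :=
      near_infty_natSinv_lt (PosNum (divr_gt0 e0 (ltr0n R 2))).
    by exists k.
  have k0 : 0 < k.+1%:R^-1 :> R by rewrite invr_gt0 ltr0n.
  have [q xq] := rat_near x k0.
  have /choice[f fP] : forall j, exists q : rat, `|v ord0 j - ratr q| < k.+1%:R^-1.
    by move=> j; exact: rat_near.
  pose w := \row_j f j.
  have bv : ball (map_mx ratr w : 'rV[R]_n) (k.+1%:R^-1) v.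
    by split=> // i j; rewrite !ord1 !mxE /ball/= distrC; exact: fP.
  have bx : ball (ratr q : R) (k.+1%:R^-1) x by rewrite /ball/= distrC.
  exists (q, w, k) => //; case: asboolP => [_|[]]; first by split.
  move=> [y u] [/= yB uB]; apply: eW; split => /=.
    apply: (@ball_splitr _ _ (ratr q : R)).
      by apply: le_ball bx; exact: ltW.
    by apply: le_ball yB; exact: ltW.
  apply: (@ball_splitr _ _ (map_mx ratr w : 'rV[R]_n)).
    by apply: le_ball bv; exact: ltW.
  by apply: le_ball uB; exact: ltW.
apply: countable_bigcupT_measurable => [|i]; first exact: countableP.
case: ifP => // _; apply: measurableX.
  by apply: open_measurable; apply: ball_open.
by apply: borel_open; apply: ball_open.
Qed.

Lemma rVcons_ball n (x : R) (v : 'rV[R]_n) r y u :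
  ball (rVcons (x, v) : 'rV[R]_n.+1) r (rVcons (y, u) : 'rV[R]_n.+1) <->
  ball x r y /\ ball v r u.
Proof.
split=> [[r0 h]|[h1 [r0 h2]]].
  split; first by have := h ord0 (lshift n (ord0 : 'I_1)); rewrite !rVconsEl.
  by split=> // i j; have := h i (rshift 1 j : 'I_(1 + n)); rewrite !rVconsEr.
split=> // i j; rewrite -(splitK (j : 'I_(1 + n))).
case: (fintype.split (j : 'I_(1 + n))) => j' /=; last by rewrite !rVconsEr.
by rewrite (ord1 j') !rVconsEl.
Qed.

Lemma rVcons_ball0 n (r : R) :
  @rVcons R n @^-1` ball (0 : 'rV[R]_n.+1) r =
  (ball (0 : R) r : set (measurableTypeR R)) `*`
  (ball (0 : 'rV[R]_n) r : set (borelRn R n)).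
Proof.
have -> : 0 = rVcons (0, 0) :> 'rV[R]_n.+1.
  by apply/rowP => j; rewrite /rVcons /= (_ : const_mx 0 = 0)// row_mx0 mxE.
by apply/seteqP; split => -[x v] /= /rVcons_ball.
Qed.

Lemma measurable_rVcons n : measurable_fun setT (@rVcons R n).
Proof.
apply: (@measurability _ _ _ _ setT (@rVcons R n) (@open 'rV[R]_n.+1)) => // _ [U oU <-].
rewrite setTI; apply: open_prod_measurable.
rewrite openE => -[x v] Uxv.
have : nbhs (rVcons (x, v) : 'rV[R]_n.+1) U by apply: open_nbhs_nbhs.
move=> /nbhs_ballP[e /= e0 eU].
apply/nbhs_ballP; exists e => // -[y u] [/= xy vu]; apply: eU.
exact/rVcons_ball.
Qed.

Lemma balls_sigma_finite n (mu : set (borelRn R n) -> \bar R) :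
  (forall r : R, 0 < r -> (mu (ball (0%R : 'rV[R]_n) r) < +oo)%E) ->
  sigma_finite setT mu.
Proof.
move=> mufin; exists (fun k => ball (0 : 'rV[R]_n) k.+1%:R) => [|k]; last first.
  by split; [apply: borel_open; exact: ball_open | exact: mufin].
apply/esym; rewrite -subTset => v _.
exists (Num.truncn `|v : 'rV[R]_n|) => //=.
rewrite -ball_normE /= sub0r normrN.
by have /andP[] := truncn_itv (normr_ge0 (v : 'rV[R]_n)).
Qed.

Section lebesgueRn_step.
Variables (n : nat) (m : {sigma_finite_measure set (borelRn R n) -> \bar R}).
Hypothesis mfin : forall r : R, 0 < r -> (m (ball (0%R : 'rV[R]_n) r) < +oo)%E.
Let mu := pushforward (lebesgue_measure \x m)%E (@rVcons R n).

Let mu_fin (r : R) : 0 < r -> (mu (ball (0%R : 'rV[R]_n.+1) r) < +oo)%E.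
Proof.
move=> r0; rewrite /mu /pushforward rVcons_ball0.
rewrite product_measure1E; last 2 first.
- by apply: open_measurable; apply: ball_open.
- by apply: borel_open; apply: ball_open.
rewrite [X in (X * _)%E](_ : _ = (r *+ 2)%:E).
  by rewrite lte_mul_pinfty ?lee_fin ?mulrn_wge0 ?ltW// mfin.
exact: lebesgue_measure_ball (ltW r0).
Qed.

Let mu_measure : {measure set (borelRn R n.+1) -> \bar R}.
Proof.
unshelve refine (pushforward (lebesgue_measure \x m)%E (@rVcons R n) : {measure set (borelRn R n.+1) -> \bar R}).
exact: measurable_rVcons.
Defined.

Lemma lebesgueRn_step : exists m' : {sigma_finite_measure set (borelRn R n.+1) -> \bar R},
  mu = m' /\ forall r : R, 0 < r -> (m' (ball (0%R : 'rV[R]_n.+1) r) < +oo)%E.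
Proof.
pose S := @Measure_isSigmaFinite.Build _ _ _ mu_measure (balls_sigma_finite mu_fin).
pose T : {sigma_finite_measure set (borelRn R n.+1) -> \bar R} :=
  HB.pack (mu : set _ -> _) (Measure.on mu_measure) S.
by exists T; split => //; exact: mu_fin.
Qed.
End lebesgueRn_step.

Lemma lebesgueRn_spec n : exists m : {sigma_finite_measure set (borelRn R n) -> \bar R},
  @lebesgueRn R n = m /\ forall r : R, 0 < r -> (m (ball (0%R : 'rV[R]_n) r) < +oo)%E.
Proof.
elim: n => [|n [m [Em mfin]]].
  exists (dirac (0 : borelRn R 0)); split => // r r0.
  by rewrite /= diracE ltry.
by have [m' [Em' m'fin]] := lebesgueRn_step mfin; exists m'; rewrite /= Em.
Qed.

End lebesgueRn_measure.

Section lebesgueRn_instances.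
Variables (R : realType) (n : nat).
Local Notation mu := (@lebesgueRn R n).

Let mu0 : mu set0 = 0%E.
Proof. by have [m [-> _]] := lebesgueRn_spec R n; exact: measure0. Qed.

Let mu_ge0 A : (0 <= mu A)%E.
Proof. by have [m [-> _]] := lebesgueRn_spec R n; exact: measure_ge0. Qed.

Let mu_sigma_additive : semi_sigma_additive mu.
Proof.
by have [m [-> _]] := lebesgueRn_spec R n; exact: measure_semi_sigma_additive.
Qed.

HB.instance Definition _ :=
  isMeasure.Build _ _ _ mu mu0 mu_ge0 mu_sigma_additive.

Let mu_sigma_finite : sigma_finite setT mu.
Proof. by have [m [-> _]] := lebesgueRn_spec R n; exact: sigma_finiteT. Qed.

HB.instance Definition _ := Measure_isSigmaFinite.Build _ _ _ mu mu_sigma_finite.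

End lebesgueRn_instances.

Section smooth_maps.
Context {R : realType}.

Definition iter_partial m (s : seq 'I_m) (f : 'rV[R]_m -> R) : 'rV[R]_m -> R :=
  foldr (fun i g x => 'D_(delta_mx 0 i) g x) f s.

(* C^oo on U: all iterated partial derivatives exist and are continuous at
   every point of U (U is meant to be open). *)
Definition smooth_fun m (U : set 'rV[R]_m) (f : 'rV[R]_m -> R) : Prop :=
  forall (s : seq 'I_m) x, U x ->
    {for x, continuous (iter_partial s f)} /\
    forall i, derivable (iter_partial s f) x (delta_mx 0 i).

Definition smooth_map m k (U : set 'rV[R]_m) (f : 'rV[R]_m -> 'rV[R]_k) : Prop :=
  forall j, smooth_fun U (fun x => f x 0 j).

(* The Jacobi matrix (d f_i / d x_j)_(i, j); the transpose is there because
   the library's jacobian acts on row vectors. *)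
Definition jacobi m k (f : 'rV[R]_m -> 'rV[R]_k) (x : 'rV[R]_m) : 'M[R]_(k, m) :=
  ('J f x)^T.

(* A 2-form on an open part of R^k is given by its matrix-valued function w,
   w_x(u, v) = u *m w x *m v^T, and this is its pullback by f. *)
Definition pullback_form m k (f : 'rV[R]_m -> 'rV[R]_k)
    (w : 'rV[R]_k -> 'M[R]_k) (x : 'rV[R]_m) : 'M[R]_m :=
  (jacobi f x)^T *m w (f x) *m jacobi f x.

Definition symplectic_form_on m (U : set 'rV[R]_m) (w : 'rV[R]_m -> 'M[R]_m) :=
  [/\ forall a b, smooth_fun U (fun x => w x a b),
      forall x, U x -> (w x)^T = - w x,
      forall x, U x -> w x \in unitmx &
      forall x, U x -> forall a b c : 'I_m,
        'D_(delta_mx 0 a) (fun y => w y b c) x +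
        'D_(delta_mx 0 b) (fun y => w y c a) x +
        'D_(delta_mx 0 c) (fun y => w y a b) x = 0].

Definition std_form n : 'M[R]_(n + n) := block_mx 0 1%:M (- 1%:M) 0.

End smooth_maps.

Record chart (R : realType) (M : topologicalType) (m : nat) := Chart {
  chart_fun :> M -> 'rV[R]_m ;
  chart_inv : 'rV[R]_m -> M ;
  chart_dom : set M ;
  chart_cod : set 'rV[R]_m ;
  chart_dom_open : open chart_dom ;
  chart_cod_open : open chart_cod ;
  chart_homo : forall x, chart_dom x -> chart_cod (chart_fun x) ;
  chart_inv_homo : forall y, chart_cod y -> chart_dom (chart_inv y) ;
  chart_funK : forall x, chart_dom x -> chart_inv (chart_fun x) = x ;
  chart_invK : forall y, chart_cod y -> chart_fun (chart_inv y) = y ;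
  chart_continuous : forall x, chart_dom x -> {for x, continuous chart_fun} ;
  chart_inv_continuous :
    forall y, chart_cod y -> {for y, continuous chart_inv} }.

(* The part of the codomain of c1 on which c2 \o f \o c1^-1 makes sense. *)
Definition local_dom (R : realType) (M N : topologicalType) m k
    (c1 : chart R M m) (c2 : chart R N k) (f : M -> N) : set 'rV[R]_m :=
  [set x | chart_cod c1 x /\ chart_dom c2 (f (chart_inv c1 x))].

Definition local_expr (R : realType) (M N : topologicalType) m k
    (c1 : chart R M m) (c2 : chart R N k) (f : M -> N) (x : 'rV[R]_m) : 'rV[R]_k :=
  c2 (f (chart_inv c1 x)).

(* A 2n-dimensional symplectic manifold: a Hausdorff second countable space
   with a smooth atlas and a closed nondegenerate 2-form, given by its
   expressions sm_form i in the charts of the atlas. *)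
Record symplectic_manifold (R : realType) (n : nat) := SymplecticManifold {
  sm_space :> topologicalType ;
  sm_hausdorff : hausdorff_space sm_space ;
  sm_second_countable : @second_countable sm_space ;
  sm_index : Type ;
  sm_chart : sm_index -> chart R sm_space (n + n) ;
  sm_cover : forall x, exists i, chart_dom (sm_chart i) x ;
  sm_smooth : forall i j,
    smooth_map (local_dom (sm_chart i) (sm_chart j) id)
               (local_expr (sm_chart i) (sm_chart j) id) ;
  sm_form : sm_index -> 'rV[R]_(n + n) -> 'M[R]_(n + n) ;
  sm_symplectic : forall i,
    symplectic_form_on (chart_cod (sm_chart i)) (sm_form i) ;
  sm_form_compat : forall i j x, local_dom (sm_chart i) (sm_chart j) id x ->
    pullback_form (local_expr (sm_chart i) (sm_chart j) id) (sm_form j) x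
      = sm_form i x }.

Section symplectomorphisms.
Context {R : realType} {n : nat} (M : symplectic_manifold R n).
Local Notation c := (@sm_chart R n M).

Definition smooth_self_map (g : M -> M) : Prop :=
  continuous g /\
  forall i j, smooth_map (local_dom (c i) (c j) g) (local_expr (c i) (c j) g).

Definition preserves_form (g : M -> M) : Prop :=
  forall i j x, local_dom (c i) (c j) g x ->
    pullback_form (local_expr (c i) (c j) g) (@sm_form R n M j) x
      = @sm_form R n M i x.

Definition Symp : set (M -> M) :=
  [set g : M -> M | [/\ exists h : M -> M,
                 [/\ cancel g h, cancel h g, smooth_self_map g & smooth_self_map h],
               preserves_form g &
               compact (closure [set x | g x <> x])]].

Definition null_set (A : set M) : Prop :=
  forall i, (@lebesgueRn R (n + n)).-negligible (c i @` (A `&` chart_dom (c i))).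

Record symplectic_embedding (Omega : set 'rV[R]_(n + n))
    (iota : 'rV[R]_(n + n) -> M) : Prop := SymplecticEmbedding {
  emb_inj : {in Omega &, injective iota} ;
  emb_continuous : forall x, Omega x -> {for x, continuous iota} ;
  emb_open_image : forall V, open V -> V `<=` Omega ->
    exists2 W, open W & iota @` V = W `&` iota @` Omega ;
  emb_smooth : forall j,
    smooth_map (Omega `&` iota @^-1` chart_dom (c j)) (c j \o iota) ;
  emb_immersion : forall j x, Omega x -> chart_dom (c j) (iota x) ->
    row_free ('J (c j \o iota) x) ;
  emb_form : forall j x, Omega x -> chart_dom (c j) (iota x) ->
    pullback_form (c j \o iota) (@sm_form R n M j) x = std_form n }.

(* iota is a total function of which only the restriction to Omega matters. *)
Record full_embedding (Omega : set 'rV[R]_(n + n))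
    (iota : 'rV[R]_(n + n) -> M) : Prop := FullEmbedding {
  full_open : open Omega ;
  full_symplectic : symplectic_embedding Omega iota ;
  full_null : null_set (~` (iota @` Omega)) }.

End symplectomorphisms.

Arguments Symp {R n} M _.

Section berezin_cocycle.

Definition mxln (K : numFieldType) n (A : 'M[K]_n) : 'M[K]_n :=
  lim (series (fun k => ((-1) ^+ k / k.+1%:R) *: (A - 1%:M) ^+ k.+1) @ \oo).

Context {R : realType} {n : nat}.

Definition cayley_mx : 'M[R[i]]_(n + n) :=
  ((Num.sqrt 2)^-1)%:C%C *: block_mx 1%:M ('i%C)%:M ('i%C)%:M 1%:M.

Definition Phi (g : 'M[R]_(n + n)) : 'M[R[i]]_n :=
  ulsubmx (invmx cayley_mx *m map_mx (real_complex R) g *m cayley_mx).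

Definition berezin (g1 g2 : 'M[R]_(n + n)) : R :=
  complex.Im (\tr (mxln (invmx (Phi g1) *m Phi (g1 *m g2) *m invmx (Phi g2)))).

End berezin_cocycle.

Section integral_cocycle.
Context {R : realType} {n : nat} (M : symplectic_manifold R n).
Variables (Omega : set 'rV[R]_(n + n)) (iota : 'rV[R]_(n + n) -> M).

(* q = iota^-1 g iota, and the set of points of Omega where it is defined *)
Definition transported (g : M -> M) : 'rV[R]_(n + n) -> 'rV[R]_(n + n) :=
  'pinv_(fun=> 0) Omega iota \o g \o iota.

Definition transported_dom (g : M -> M) : set 'rV[R]_(n + n) :=
  Omega `&` [set m | (iota @` Omega) (g (iota m))].

Definition symp_integrand (g1 g2 : M -> M) (m : 'rV[R]_(n + n)) : R :=
  berezin (jacobi (transported g1) (transported g2 m)) (jacobi (transported g2) m).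

(* The part of Omega, of full measure, where symp_integrand is defined; off it
   the values of the total function above are meaningless. *)
Definition symp_integrand_dom (g1 g2 : M -> M) : set 'rV[R]_(n + n) :=
  transported_dom g2 `&` transported g2 @^-1` transported_dom g1.

Definition symp_cocycle (g1 g2 : M -> M) : R :=
  Rintegral (@lebesgueRn R (n + n))
    (symp_integrand_dom g1 g2) (symp_integrand g1 g2).

End integral_cocycle.

(* Groups are given as subsets of an ambient type with an operation on it. *)
Section groups.
Variables (T : Type) (G : set T) (op : T -> T -> T).

Definition is_group : Prop :=
  [/\ forall x y, G x -> G y -> G (op x y),
      forall x y z, G x -> G y -> G z -> op x (op y z) = op (op x y) z &
      exists e, [/\ G e, forall x, G x -> op e x = x /\ op x e = x &
        forall x, G x -> exists y, [/\ G y, op x y = e & op y x = e]]].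

Definition is_cocycle2 (A : zmodType) (e : T) (c : T -> T -> A) : Prop :=
  (forall g, G g -> c e g = 0 /\ c g e = 0) /\
  forall g1 g2 g3, G g1 -> G g2 -> G g3 ->
    c g1 g2 + c (op g1 g2) g3 = c g1 (op g2 g3) + c g2 g3.

Definition is_coboundary2 (A : zmodType) (c : T -> T -> A) : Prop :=
  exists gamma : T -> A, forall g1 g2, G g1 -> G g2 ->
    c g1 g2 = gamma g1 + gamma g2 - gamma (op g1 g2).

Definition extension_mul (A : zmodType) (c : T -> T -> A) (p1 p2 : T * A) : T * A :=
  (op p1.1 p2.1, p1.2 + p2.2 + c p1.1 p2.1).

End groups.

(* Main.v *)
(* Berezin's c. After the Cayley transform, each argument of the logarithms in
   the cocycle identity is 1 + Z with Z a product of strict contractions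
   attached to the three matrices. Replace one of these contractions S by t S,
   0 <= t <= 1: the difference of the two sides of the identity changes by
   O(h^2) over a step of length h, hence is constant in t, and it vanishes at
   t = 0. Triangularising 1 + Z bounds |c| by n pi / 2.

   The cocycle C. On a conull open part of Omega the transported maps are
   differentiable with symplectic Jacobi matrices, and they preserve Lebesgue
   measure; by the chain rule and a change of variables, C inherits the identity
   of c. The integrals converge because c is bounded, c(A, 1) = 0, and q_2 is the
   identity off iota^-1 of a compact set, which has finite measure.

   Independence. If y = T'(m) for the change of frame T = iota'^-1 iota, then
   q' = T q T^-1 has Jacobi matrix A' = x A y^-1, with x = T'(q(m)) and A = q'(m).
   Writing s for the lift to the extension defined by c, s(x) s(A) s(y)^-1 and
   s(A') differ by the central element c(x, A) - c(A', y); its integral over m is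
   the cochain whose coboundary is the difference of the two cocycles. *)

Require Import Defs.
From HB Require Import structures.
From mathcomp Require Import all_boot all_order all_algebra.
From mathcomp Require Import perm spectral sesquilinear.
From mathcomp Require Import all_classical all_reals all_analysis.
From mathcomp Require Import measurable_realfun complex.
From mathcomp Require Import ring lra zify.
Set Implicit Arguments.
Unset Strict Implicit.
Unset Printing Implicit Defensive.
Import Order.TTheory GRing.Theory Num.Theory.
Import numFieldNormedType.Exports.
Local Open Scope classical_set_scope.
Local Open Scope ring_scope.
Local Open Scope sesquilinear_scope.

(** * The Berezin cocycle *)

Section operator_bounds.
Context {C : numClosedFieldType}.

(** Im tr ln is additive on products only modulo 2 pi, so the branch has to be followed along a
    path. The logarithm is never differentiated along it: every estimate concerns truncated series,
    uniformly in the truncation order N and in the number of steps, and the limits are taken last.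
    The first-order terms cancel by cyclicity of the trace.

    The inverse of an embedding is handled with a derivative at each point and without continuity of
    that derivative. The change of variables and the treatment of null sets therefore rest on
    coverings by dyadic cubes, which use pointwise differentiability only; the two inequalities come
    from exchanging a map with its inverse, all Jacobians having modulus 1.

    A transported map and a change of frame are both treated as arrows between frames. One cocycle
    identity over arrows then yields the cocycle property, and its three instances with the change
    of frame placed after, between and before two symplectomorphisms yield independence. *)

Definition hermnorm n (u : 'rV[C]_n) : C := sqrtC (dotmx u u).

Lemma hermnorm_ge0 n (u : 'rV[C]_n) : 0 <= hermnorm u.
Proof. by rewrite sqrtC_ge0 dnorm_ge0. Qed.

Lemma hermnorm_eq0 n (u : 'rV[C]_n) : (hermnorm u == 0) = (u == 0).
Proof. by rewrite sqrtC_eq0 dnorm_eq0. Qed.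

Lemma hermnormZ n a (u : 'rV[C]_n) : hermnorm (a *: u) = `|a| * hermnorm u.
Proof.
by rewrite /hermnorm dnormZ sqrtCM ?nnegrE ?exprn_ge0 ?dnorm_ge0// sqrCK.
Qed.

Lemma hermnormN n (u : 'rV[C]_n) : hermnorm (- u) = hermnorm u.
Proof. by rewrite -scaleN1r hermnormZ normrN1 mul1r. Qed.

Lemma ler_hermnormD n (u v : 'rV[C]_n) :
  hermnorm (u + v) <= hermnorm u + hermnorm v.
Proof. by have [] := triangle_lerif (@dotmx C n) u v. Qed.

Lemma ler_norm_dotmx n (u v : 'rV[C]_n) : `|dotmx u v| <= hermnorm u * hermnorm v.
Proof. by have [] := CauchySchwarz_sqrt (@dotmx C n) u v. Qed.

Lemma hermnorm_delta n (i : 'I_n) : hermnorm (delta_mx 0 i : 'rV[C]_n) = 1.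
Proof.
rewrite /hermnorm dotmxE mxE (bigD1 i)//= big1 => [|j /negPf ji].
  by rewrite !mxE !eqxx conjC1 mulr1 addr0 sqrtC1.
by rewrite !mxE ji andbF mul0r.
Qed.

Lemma ler_norm_hermnorm n (u : 'rV[C]_n) i : `|u 0 i| <= hermnorm u.
Proof.
have -> : u 0 i = dotmx u (delta_mx 0 i).
  rewrite dotmxE mxE (bigD1 i)//= big1 => [|j /negPf ji].
    by rewrite !mxE !eqxx conjC1 mulr1 addr0.
  by rewrite !mxE ji andbF conjC0 mulr0.
by apply: le_trans (ler_norm_dotmx _ _) _; rewrite hermnorm_delta mulr1.
Qed.

(** A bound for the operator norm, kept as a relation so that no supremum over the unit sphere is
    formed. Since [0 <= r] forces r to be real, [C] itself serves as the type of bounds. *)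
Definition opbd n (A : 'M[C]_n) (r : C) : Prop :=
  0 <= r /\ forall u : 'rV[C]_n, hermnorm (u *m A) <= r * hermnorm u.

Lemma opbd_ge0 n (A : 'M[C]_n) r : opbd A r -> 0 <= r.
Proof. by case. Qed.

Lemma opbd_le n (A : 'M[C]_n) r s : opbd A r -> r <= s -> opbd A s.
Proof.
move=> [r0 Ar] rs; split=> [|u]; first exact: le_trans rs.
by apply: le_trans (Ar u) _; rewrite ler_wpM2r ?hermnorm_ge0.
Qed.

Lemma opbdM n (A B : 'M[C]_n) r s : opbd A r -> opbd B s -> opbd (A *m B) (r * s).
Proof.
move=> [r0 Ar] [s0 Bs]; split=> [|u]; first exact: mulr_ge0.
rewrite mulmxA; apply: le_trans (Bs _) _.
by rewrite (mulrC r) -mulrA ler_wpM2l.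
Qed.

Lemma opbdD n (A B : 'M[C]_n) r s : opbd A r -> opbd B s -> opbd (A + B) (r + s).
Proof.
move=> [r0 Ar] [s0 Bs]; split=> [|u]; first exact: addr_ge0.
rewrite mulmxDr; apply: le_trans (ler_hermnormD _ _) _.
by rewrite mulrDl lerD.
Qed.

Lemma opbdN n (A : 'M[C]_n) r : opbd A r -> opbd (- A) r.
Proof. by move=> [r0 Ar]; split=> // u; rewrite mulmxN hermnormN. Qed.

Lemma opbdZ n a (A : 'M[C]_n) r : opbd A r -> opbd (a *: A) (`|a| * r).
Proof.
move=> [r0 Ar]; split=> [|u]; first by rewrite mulr_ge0.
by rewrite -scalemxAr hermnormZ -mulrA ler_wpM2l.
Qed.

Lemma opbd0 n : opbd (0 : 'M[C]_n) 0.
Proof.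
split=> // u; rewrite mulmx0 mul0r.
by have /eqP -> : hermnorm (0 : 'rV[C]_n) == 0 by rewrite hermnorm_eq0.
Qed.

Lemma opbd1 n : opbd (1%:M : 'M[C]_n) 1.
Proof. by split=> // u; rewrite mulmx1 mul1r. Qed.

Lemma opbdX n (A : 'M[C]_n) r k : opbd A r -> opbd (A ^+ k) (r ^+ k).
Proof.
move=> Ar; elim: k => [|k IH]; first by rewrite !expr0; exact: opbd1.
by rewrite !exprS; exact: opbdM.
Qed.

Lemma opbd_sum n (I : Type) (s : seq I) (P : pred I) (F : I -> 'M[C]_n) r :
  (forall i, P i -> opbd (F i) (r i)) ->
  opbd (\sum_(i <- s | P i) F i) (\sum_(i <- s | P i) r i).
Proof.
move=> H; apply: (big_rec2 (fun A r => opbd A r)) => [|i A a Pi Aa].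
  exact: opbd0.
by apply: opbdD => //; exact: H.
Qed.

Lemma opbd_entry n (A : 'M[C]_n) r i j : opbd A r -> `|A i j| <= r.
Proof.
move=> [r0 Ar]; have := Ar (delta_mx 0 i).
rewrite hermnorm_delta mulr1 -rowE; apply: le_trans.
by apply: le_trans (ler_norm_hermnorm _ j); rewrite mxE.
Qed.

Lemma opbd_tr n (A : 'M[C]_n) r : opbd A r -> `|\tr A| <= n%:R * r.
Proof.
move=> Ar; apply: le_trans (ler_norm_sum _ _ _) _.
rewrite -[n in n%:R]card_ord mulr_natl -sumr_const.
by apply: ler_sum => i _; exact: opbd_entry.
Qed.

(** An elementary matrix has norm at most 1, so the sum of the moduli of the entries is a bound; 1
    is added to make it positive. *)
Lemma opbd_ex n (A : 'M[C]_n) : exists2 r, 0 < r & opbd A r.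
Proof.
have D (i j : 'I_n) : opbd (delta_mx i j : 'M[C]_n) 1.
  split=> // u; rewrite mul1r.
  have -> : u *m delta_mx i j = u 0 i *: delta_mx 0 j :> 'rV_n.
    apply/rowP => k; rewrite !mxE (bigD1 i)//= big1 => [|l /negPf li].
      by rewrite !mxE !eqxx addr0.
    by rewrite !mxE li mulr0.
  by rewrite hermnormZ hermnorm_delta mulr1 ler_norm_hermnorm.
pose s := \sum_i \sum_j `|A i j| * 1.
have As : opbd A s.
  rewrite [A in opbd A]matrix_sum_delta.
  by apply: opbd_sum => i _; apply: opbd_sum => j _; exact: opbdZ.
exists (s + 1); last by apply: opbd_le As _; rewrite lerDl.
by rewrite ltr_wpDl ?(opbd_ge0 As).
Qed.

Lemma dotmx_adjoint n (A : 'M[C]_n) (u v : 'rV[C]_n) :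
  dotmx (u *m A) v = dotmx u (v *m A^t*).
Proof. by rewrite !dotmxE trmx_mul map_mxM trmxCK mulmxA. Qed.

(** With v the image of u under the adjoint, |v|^2 is the product of v A with u; Cauchy-Schwarz and
    the bound for A give |v|^2 <= r |v| |u|, and |v| is cancelled. *)
Lemma opbd_adj n (A : 'M[C]_n) r : opbd A r -> opbd (A^t*) r.
Proof.
move=> [r0 Ar]; split=> // u; have [->|u0] := eqVneq (u *m A^t*) 0.
  have /eqP -> : hermnorm (0 : 'rV[C]_n) == 0 by rewrite hermnorm_eq0.
  by rewrite mulr_ge0 ?hermnorm_ge0.
have p : 0 < hermnorm (u *m A^t*).
  by rewrite lt_neqAle hermnorm_ge0 andbT eq_sym hermnorm_eq0.
rewrite -(ler_pM2l p) -expr2.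
have <- : `|dotmx (u *m A^t* *m A) u| = hermnorm (u *m A^t*) ^+ 2.
  by rewrite dotmx_adjoint ger0_norm ?dnorm_ge0// sqrtCK.
apply: le_trans (ler_norm_dotmx _ _) _.
rewrite [leRHS]mulrCA mulrA; apply: ler_wpM2r; first exact: hermnorm_ge0.
exact: Ar.
Qed.

Lemma opbd_unit n (A : 'M[C]_n) r : opbd A r -> r < 1 -> 1%:M + A \in unitmx.
Proof.
move=> [r0 Ar] r1; rewrite -row_free_unit -kermx_eq0; apply/rowV0P => v.
move=> /sub_kermxP; rewrite mulmxDr mulmx1 => /eqP; rewrite addr_eq0 => /eqP vA.
apply/eqP; rewrite -hermnorm_eq0; have := Ar v.
have -> : v *m A = - v by rewrite [in RHS]vA opprK.
rewrite hermnormN -subr_ge0 -{2}[hermnorm v]mul1r -mulrBl.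
rewrite nmulr_rge0 ?subr_lt0// => v0; rewrite eq_le v0; exact: hermnorm_ge0.
Qed.

(** With v = u (1 + A)^-1 one has u = v + v A, hence |v| - r |v| <= |u|. *)
Lemma opbd_inv n (A : 'M[C]_n) r :
  opbd A r -> r < 1 -> opbd (invmx (1%:M + A)) (1 - r)^-1.
Proof.
move=> Ar r1; have [r0 Ar'] := Ar; have r1' : 0 < 1 - r by rewrite subr_gt0.
split=> [|u]; first by rewrite invr_ge0 ltW.
rewrite ler_pdivlMl//; set v := u *m _.
have vE : v = u *m invmx (1%:M + A) by [].
clearbody v.
have uv : u = v + v *m A by rewrite -{1}[v]mulmx1 -mulmxDr vE mulmxKV// (opbd_unit Ar).
rewrite mulrBl mul1r lerBlDr; apply: le_trans (lerD (lexx _) (Ar' v)).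
rewrite -(hermnormN (v *m A)); apply: le_trans (ler_hermnormD _ _).
by rewrite {1}(_ : v = u - v *m A) // uv addrK.
Qed.

End operator_bounds.

(** * Truncated series for the trace of a logarithm *)

Section trace_log.
Context {C : numClosedFieldType} {n : nat}.
Implicit Types X Y Z : 'M[C]_n.

(** The series of tr ln(1 + X), cut after N terms. *)
Definition trln (N : nat) X : C :=
  \sum_(k < N) (-1) ^+ k / k.+1%:R * \tr (X ^+ k.+1).

Lemma mxsubXX X Y k : Y ^+ k - X ^+ k =
  \sum_(0 <= i < k) Y ^+ i * (Y - X) * X ^+ (k - i.+1).
Proof.
transitivity (\sum_(0 <= i < k) (Y ^+ i.+1 * X ^+ (k - i.+1) - Y ^+ i * X ^+ (k - i))).
  by rewrite telescope_sumr// subnn subn0 !expr0 mulr1 mul1r.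
apply: eq_big_nat => i /= ik.
by rewrite mulrBr mulrBl -exprSr -mulrA -exprS subnSK.
Qed.

Lemma opbd_subXX X Y (r d : C) k : opbd X r -> opbd Y r -> opbd (Y - X) d ->
  opbd (Y ^+ k - X ^+ k) (k%:R * r ^+ k.-1 * d).
Proof.
move=> Xr Yr YXd; rewrite mxsubXX.
have -> : k%:R * r ^+ k.-1 * d = \sum_(0 <= i < k) r ^+ i * d * r ^+ (k - i.+1).
  rewrite (eq_big_nat _ _ (F2 := fun=> r ^+ k.-1 * d)) => [|i /= ik].
    by rewrite sumr_const_nat subn0 -mulrA mulr_natl.
  rewrite mulrAC -exprD; congr (_ ^+ _ * _); lia.
rewrite !big_nat; apply: opbd_sum => i _.
by apply: opbdM (opbdX _ Xr); apply: opbdM => //; exact: opbdX.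
Qed.

(** Telescoping and cyclicity write the difference of traces as the sum over i of tr X^(k-i) Y^i (Y
    - X). Subtracting the linear term leaves Y^i - X^i in place of Y^i, which is again of first
    order in d. *)
Lemma trXB2 X Y (r d : C) k : opbd X r -> opbd Y r -> opbd (Y - X) d ->
  `|\tr (Y ^+ k.+1) - \tr (X ^+ k.+1) - k.+1%:R * \tr (X ^+ k * (Y - X))|
    <= k.+1%:R * (n%:R * (k%:R * r ^+ k.-1 * d ^+ 2)).
Proof.
move=> Xr Yr YXd; have r0 := opbd_ge0 Xr; have d0 := opbd_ge0 YXd.
have -> : \tr (Y ^+ k.+1) - \tr (X ^+ k.+1) - k.+1%:R * \tr (X ^+ k * (Y - X)) =
    \sum_(0 <= i < k.+1) \tr (X ^+ (k - i) * (Y ^+ i - X ^+ i) * (Y - X)).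
  rewrite -raddfB /= mxsubXX raddf_sum /=.
  have -> : k.+1%:R * \tr (X ^+ k * (Y - X)) =
      \sum_(0 <= i < k.+1) \tr (X ^+ k * (Y - X)).
    by rewrite sumr_const_nat subn0 mulr_natl.
  rewrite -sumrB; apply: eq_big_nat => i /=; rewrite ltnS => ik.
  rewrite [_ * (Y ^+ i - X ^+ i)]mulrBr [in RHS]mulrBl [in RHS]raddfB /=.
  rewrite -exprD subnK// subSS; congr (_ - _).
  by rewrite -[LHS]/(\tr (_ *m _)) mxtrace_mulC /= mulmxA.
apply: le_trans (ler_norm_sum _ _ _) _.
rewrite mulr_natl -[k.+1 in leRHS]subn0 -sumr_const_nat !big_nat.
apply: ler_sum => i; rewrite /= ltnS => ik.
have B : opbd (X ^+ (k - i) * (Y ^+ i - X ^+ i) * (Y - X))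
    (r ^+ (k - i) * (i%:R * r ^+ i.-1 * d) * d).
  by apply: opbdM => //; apply: opbdM; [exact: opbdX|exact: opbd_subXX].
apply: le_trans (opbd_tr B) _; apply: ler_wpM2l => //.
rewrite expr2 !mulrA; do 2!apply: ler_wpM2r => //.
case: i ik {B} => [|i ik]; first by rewrite mulr0 mul0r mulr_ge0// exprn_ge0.
rewrite mulrAC mulrC -exprD /= (_ : (k - i.+1 + i)%N = k.-1); last by lia.
by rewrite ler_wpM2r ?exprn_ge0// ler_nat.
Qed.

(** Multiplied by (1 - r)^2 the sum has the closed form 1 - (r^N + N r^(N-1) (1 - r)), and what is
    subtracted there is nonnegative. *)
Lemma sum_arith_geom (r : C) N : 0 <= r -> r < 1 ->
  \sum_(k < N) k%:R * r ^+ k.-1 <= (1 - r) ^- 2.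
Proof.
move=> r0 r1; have r1' : 0 < 1 - r by rewrite subr_gt0.
rewrite -[leRHS]mul1r ler_pdivlMr ?exprn_gt0//.
suff -> : (\sum_(k < N) k%:R * r ^+ k.-1) * (1 - r) ^+ 2 =
    1 - (r ^+ N + N%:R * r ^+ N.-1 * (1 - r)).
  by rewrite lerBlDr lerDl addr_ge0 ?mulr_ge0 ?exprn_ge0// ltW.
elim: N => [|N IH]; first by rewrite big_ord0 expr0; ring.
rewrite big_ord_recr/= mulrDl IH; case: N {IH} => [|N]; first by rewrite /= expr0 expr1; ring.
by rewrite /= !exprS; ring.
Qed.

(** Truncated Neumann series of (1 + X)^-1: the derivative of [trln N] at X in the direction H is
    the trace of [neumann N X *m H]. *)
Definition neumann N X : 'M[C]_n := \sum_(k < N) (- X) ^+ k.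

Lemma neumannE N X : (1%:M + X) *m neumann N X = 1%:M - (- X) ^+ N.
Proof.
rewrite /neumann -[X in (1%:M + X) *m _]opprK -opprB mulNmx.
by rewrite -[_ *m _]/(_ * _) -[_%:M]/(1 : 'M[C]_n) -subrX1 opprB.
Qed.

Lemma trlnB2 N X Y (r d : C) : r < 1 -> opbd X r -> opbd Y r -> opbd (Y - X) d ->
  `|trln N Y - trln N X - \tr (neumann N X *m (Y - X))|
    <= n%:R * d ^+ 2 * (1 - r) ^- 2.
Proof.
move=> r1 Xr Yr YXd; have r0 := opbd_ge0 Xr; have d0 := opbd_ge0 YXd.
rewrite /trln /neumann mulmx_suml -sumrB [\tr _]raddf_sum -sumrB.
apply: le_trans (ler_norm_sum _ _ _) _.
apply: le_trans (_ : _ <= \sum_(k < N) n%:R * d ^+ 2 * (k%:R * r ^+ k.-1)) _; last first.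
  by rewrite -mulr_sumr ler_wpM2l ?mulr_ge0 ?exprn_ge0// sum_arith_geom.
apply: ler_sum => k _ /=.
have -> : (-1) ^+ k / k.+1%:R * \tr (Y ^+ k.+1) - (-1) ^+ k / k.+1%:R * \tr (X ^+ k.+1)
    - \tr ((- X) ^+ k *m (Y - X)) = (-1) ^+ k / k.+1%:R *
   (\tr (Y ^+ k.+1) - \tr (X ^+ k.+1) - k.+1%:R * \tr (X ^+ k * (Y - X))).
  rewrite (exprNn X).
  have -> : (-1) ^+ k * X ^+ k = (-1) ^+ k *: X ^+ k.
    by rewrite -signr_odd -[in RHS]signr_odd; case: (odd k); rewrite ?expr1 ?expr0 ?mulN1r ?scaleN1r ?mul1r ?scale1r.
  rewrite -scalemxAl mxtraceZ -[_ *m _]/(_ * _); move: (\tr _) (\tr _) (\tr _) => a b c.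
  by field; rewrite nat1r pnatr_eq0.
rewrite normrM normf_div normrX normrN1 expr1n normr_nat mul1r.
rewrite ler_pdivrMl ?ltr0n//; apply: le_trans (trXB2 k Xr Yr YXd) _.
by rewrite le_eqVlt; apply/orP; left; apply/eqP; ring.
Qed.

(** The inverse differs from the truncated Neumann series by (1 + X)^-1 (-X)^N, which is the source
    of the term in r^N. *)
Lemma trln_step N X Y (r d : C) : r < 1 -> opbd X r -> opbd Y r -> opbd (Y - X) d ->
  `|trln N Y - trln N X - \tr (invmx (1%:M + X) *m (Y - X))|
    <= n%:R * d ^+ 2 * (1 - r) ^- 2 + n%:R * (r ^+ N * d * (1 - r)^-1).
Proof.
move=> r1 Xr Yr YXd; have U := opbd_unit Xr r1.
have -> : invmx (1%:M + X) = neumann N X + invmx (1%:M + X) *m (- X) ^+ N.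
  by rewrite -[neumann N X](mulKmx U) neumannE mulmxBr mulmx1 subrK.
rewrite mulmxDl raddfD opprD addrA.
apply: le_trans (ler_normD _ _) _; apply: lerD; first exact: trlnB2.
rewrite normrN; apply: opbd_tr; rewrite mulrC -mulmxA.
by apply: opbdM; [exact: opbd_inv|apply: opbdM => //; apply/opbdX/opbdN].
Qed.

End trace_log.

(** * Variation of the cocycle expression along a path of contractions *)

Section trace_log_path.
Context {C : numClosedFieldType} {n : nat}.
Variables (A B P Q : 'M[C]_n) (r : C).
Hypotheses (r1 : r < 1) (Ar : opbd A r) (Br : opbd B r).

Let a (t : C) : 'M[C]_n := 1%:M + t *: A.
Let b (t : C) : 'M[C]_n := 1%:M + t *: B.
Let W (t : C) : 'M[C]_n := P *m (invmx (a t) *m b t) *m Q.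

Hypothesis Wr : forall t, 0 <= t <= 1 -> opbd (W t - 1%:M) r.

Let i := (1 - r)^-1.

Let r0 : 0 <= r. Proof. exact: opbd_ge0 Ar. Qed.
Let i0 : 0 <= i. Proof. by rewrite invr_ge0 subr_ge0 ltW. Qed.

Let scale_opbd (X : 'M[C]_n) t : opbd X r -> 0 <= t <= 1 -> opbd (t *: X) r.
Proof.
move=> Xr /andP[t0 t1]; apply: opbd_le (opbdZ t Xr) _.
by rewrite ger0_norm// ler_piMl.
Qed.

Let aU t : 0 <= t <= 1 -> a t \in unitmx.
Proof. by move=> t01; apply: opbd_unit r1; exact: scale_opbd. Qed.

Let bU t : 0 <= t <= 1 -> b t \in unitmx.
Proof. by move=> t01; apply: opbd_unit r1; exact: scale_opbd. Qed.

Let aV t : 0 <= t <= 1 -> opbd (invmx (a t)) i.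
Proof. by move=> t01; apply: opbd_inv r1; exact: scale_opbd. Qed.

Let bV t : 0 <= t <= 1 -> opbd (invmx (b t)) i.
Proof. by move=> t01; apply: opbd_inv r1; exact: scale_opbd. Qed.

Let WU t : 0 <= t <= 1 -> W t \in unitmx.
Proof. by move=> /Wr /opbd_unit - /(_ r1); rewrite addrC subrK. Qed.

Let PQU : P \in unitmx /\ Q \in unitmx.
Proof.
have := @WU 0; rewrite lexx ler01 => /(_ isT).
by rewrite !unitmx_mul => /andP[/andP[-> _] ->].
Qed.

Let invB s t : 0 <= s <= 1 -> 0 <= t <= 1 ->
  invmx (a s) - invmx (a t) = - ((s - t) *: (invmx (a s) *m A *m invmx (a t))).
Proof.
move=> s01 t01; have -> : (s - t) *: (invmx (a s) *m A *m invmx (a t)) =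
    invmx (a s) *m (a s - a t) *m invmx (a t).
  by rewrite /a opprD addrACA subrr add0r -scalerBl -scalemxAr -scalemxAl.
by rewrite mulmxBr mulmxBl mulVmx ?aU// mul1mx mulmxK ?aU// opprB.
Qed.

(** Cyclicity removes P and Q: the trace of W_t^-1 W_s is that of a_t a_s^-1 times b_s b_t^-1. Its
    linear part in s - t is tr B b^-1 - tr A a^-1, the opposite of what the two other logarithms
    contribute. *)
Let trW s t : 0 <= s <= 1 -> 0 <= t <= 1 ->
  \tr (invmx (a t) *m (s *: A - t *: A)) +
  \tr (invmx (W t) *m (W s - W t)) -
  \tr (invmx (b t) *m (s *: B - t *: B)) =
  (s - t) ^+ 2 * (\tr (A *m invmx (a s) *m (A *m invmx (a t)))
                 - \tr (A *m invmx (a s) *m (B *m invmx (b t)))).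
Proof.
move=> s01 t01; have [PU QU] := PQU.
have tW : \tr (invmx (W t) *m (W s - W t)) =
    \tr ((a t *m invmx (a s)) *m (b s *m invmx (b t))) - \tr (1%:M : 'M[C]_n).
  rewrite mulmxBr mulVmx ?WU// raddfB /=; congr (_ - _).
  have bt := bU t01; have at' := aU t01.
  have WE : invmx (W t) = invmx Q *m (invmx (b t) *m a t) *m invmx P.
    apply: (can_inj (mulKmx (WU t01))); rewrite mulmxV ?WU// /W !mulmxA.
    by rewrite mulmxK// mulmxK// mulmxKV// mulmxV.
  rewrite WE /W !mulmxA mulmxKV// -!mulmxA mxtrace_mulC !mulmxA mulmxK//.
  by rewrite -!mulmxA mxtrace_mulC !mulmxA.
have aE : a t *m invmx (a s) = 1%:M - (s - t) *: (A *m invmx (a s)).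
  have -> : a t = a s - (s - t) *: A.
    by rewrite /a scalerBl opprB addrACA (addrC (s *: A)) addrA subrK.
  by rewrite mulmxBl mulmxV ?aU// scalemxAl.
have bE : b s *m invmx (b t) = 1%:M + (s - t) *: (B *m invmx (b t)).
  have -> : b s = b t + (s - t) *: B.
    by rewrite /b scalerBl -addrA [t *: B + _]addrC subrK.
  by rewrite mulmxDl mulmxV ?bU// scalemxAl.
rewrite tW aE bE -!scalerBl -!scalemxAr !mxtraceZ.
have trE (h : C) (U V : 'M[C]_n) : \tr ((1%:M - h *: U) *m (1%:M + h *: V)) =
    \tr (1%:M : 'M[C]_n) + h * \tr V - h * \tr U - h ^+ 2 * \tr (U *m V).
  rewrite mulmxBl !mul1mx mulmxDr mulmx1 -scalemxAl -scalemxAr scalerA.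
  by rewrite raddfB /= !mxtraceD !mxtraceZ; ring.
(* Resolvent identity: the inverse appears here at s, whereas the logarithm of 1 + t A is linearised
   at t; the discrepancy has second order. *)
rewrite trE; have -> : \tr (A *m invmx (a s)) = \tr (A *m invmx (a t))
    - (s - t) * \tr (A *m invmx (a s) *m (A *m invmx (a t))).
  rewrite -mxtraceZ -raddfB /=; congr (\tr _).
  apply/eqP; rewrite eq_sym subr_eq addrC -subr_eq; apply/eqP.
  rewrite -mulmxBr -[invmx (a t) - _]opprB invB// opprK -scalemxAr.
  by rewrite !mulmxA.
rewrite (mxtrace_mulC (invmx (a t))) (mxtrace_mulC (invmx (b t))).
by ring.
Qed.

(** For the A, B, P, Q of [trln_cocycle], the value at t = 1 carries the three terms of the cocycle
    identity that involve G1; at t = 0 only W 0 = P Q is left, which is the argument of the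
    logarithm for G2 and G3. *)
Definition trln_path N (t : C) : C :=
  trln N (t *: A) + trln N (W t - 1%:M) - trln N (t *: B).

Let stepK : exists K1 K2 : C, [/\ 0 <= K1, 0 <= K2 & forall N s t,
  0 <= s <= 1 -> 0 <= t <= 1 ->
  `|trln_path N s - trln_path N t| <= K1 * `|s - t| ^+ 2 + K2 * r ^+ N * `|s - t|].
Proof.
have [p p0 Pp] := opbd_ex P; have [q q0 Qq] := opbd_ex Q.
(* A Lipschitz constant of W on [0, 1]: i r i bounds the factor of s - t in the difference of the
   inverses of a, 1 + r bounds b, and i r bounds the product of an inverse of a with B. *)
pose L := p * (i * r * i * (1 + r) + i * r) * q.
have L0 : 0 <= L.
  by rewrite /L !(mulr_ge0, addr_ge0)// ltW.
have WB s t : 0 <= s <= 1 -> 0 <= t <= 1 -> opbd (W s - W t) (L * `|s - t|).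
  move=> s01 t01.
  have -> : W s - W t = P *m ((invmx (a s) - invmx (a t)) *m b s +
      invmx (a t) *m ((s - t) *: B)) *m Q.
    have -> : (s - t) *: B = b s - b t.
      by rewrite /b opprD addrACA subrr add0r -scalerBl.
    by rewrite mulmxBl mulmxBr addrA subrK -mulmxBl -mulmxBr.
  have -> : L * `|s - t| = p * (`|s - t| * (i * r * i) * (1 + r) + i * (`|s - t| * r)) * q.
    by rewrite /L; ring.
  apply: opbdM => //; apply: opbdM => //; apply: opbdD.
    apply: opbdM; last by apply: opbdD; [exact: opbd1|exact: scale_opbd].
    rewrite invB//; apply/opbdN/opbdZ; apply: opbdM (aV t01).
    by apply: opbdM => //; exact: aV.
  by apply: opbdM; [exact: aV|exact: opbdZ].
clearbody L; pose c : C := n%:R * (1 - r) ^- 2.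
have c0 : 0 <= c by rewrite mulr_ge0// invr_ge0 exprn_ge0// subr_ge0 ltW.
(* The first summand bounds the right-hand side of [trW], the second the quadratic errors of the
   three logarithms; the constant after it collects their Neumann tails. *)
exists (2 * n%:R * (r * i * (r * i)) + c * (r ^+ 2 + L ^+ 2 + r ^+ 2)).
exists (n%:R * i * (r + L + r)); split.
- by do ?[apply: addr_ge0|exact: c0|apply: mulr_ge0|apply: exprn_ge0].
- by do ?[apply: addr_ge0|apply: mulr_ge0|apply: exprn_ge0|exact: i0].
move=> N s t s01 t01; set h := `|s - t|.
have h0 : 0 <= h by exact: normr_ge0.
have E1 := @trln_step _ _ N _ _ _ _ r1 (scale_opbd Ar t01) (scale_opbd Ar s01).
have := E1 (h * r); rewrite -{1}scalerBl => /(_ (opbdZ _ Ar)) {}E1.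
have E3 := @trln_step _ _ N _ _ _ _ r1 (scale_opbd Br t01) (scale_opbd Br s01).
have := E3 (h * r); rewrite -{1}scalerBl => /(_ (opbdZ _ Br)) {}E3.
have E2 := @trln_step _ _ N _ _ _ _ r1 (Wr t01) (Wr s01).
have := E2 (L * h); rewrite opprB addrA subrK [1%:M + (W t - _)]addrC subrK.
move=> /(_ (WB _ _ s01 t01)) {}E2.
have T := trW s01 t01.
have T' : `|(s - t) ^+ 2 * (\tr (A *m invmx (a s) *m (A *m invmx (a t)))
                 - \tr (A *m invmx (a s) *m (B *m invmx (b t))))| <=
   h ^+ 2 * (2 * n%:R * (r * i * (r * i))).
  rewrite normrM normrX ler_wpM2l ?exprn_ge0//.
  apply: le_trans (ler_normB _ _) _; rewrite -mulrA mulr_natl mulr2n.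
  by apply: lerD; apply: opbd_tr; apply: opbdM; apply: opbdM => //; auto.
rewrite -T in T'; rewrite /trln_path.
move: E1 E2 E3 T'.
set x1 := trln N (s *: A) - _; set x2 := trln N (W s - _) - _.
set x3 := trln N (s *: B) - _.
set y1 := \tr (invmx (a t) *m _); set y2 := \tr (invmx (W t) *m _).
set y3 := \tr (invmx (b t) *m _) => E1 E2 E3 T'.
have -> : trln N (s *: A) + trln N (W s - 1%:M) - trln N (s *: B) -
  (trln N (t *: A) + trln N (W t - 1%:M) - trln N (t *: B)) =
  (y1 + y2 - y3) + (x1 - y1) + (x2 - y2) - (x3 - y3).
  by rewrite /x1 /x2 /x3; ring.
apply: le_trans (ler_normB _ _) _.
apply: le_trans (lerD (ler_normD _ _) (lexx _)) _.
apply: le_trans (lerD (lerD (ler_normD _ _) (lexx _)) (lexx _)) _.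
apply: le_trans (lerD (lerD (lerD T' E1) E2) E3) _.
by rewrite le_eqVlt; apply/orP; left; apply/eqP; rewrite /c /i; ring.
Qed.

(** Over M + 1 equal steps the quadratic errors add up to K1 / (M + 1), while the truncation errors,
    linear in the step, add up to a quantity independent of M. *)
Lemma trln_path_bound : exists K1 K2 : C, [/\ 0 <= K1, 0 <= K2 & forall N M,
  `|trln_path N 1 - trln_path N 0| <= K1 / M.+1%:R + K2 * r ^+ N].
Proof.
have [K1 [K2 [K10 K20 H]]] := stepK; exists K1, K2; split=> // N M.
pose t (k : nat) : C := k%:R / M.+1%:R.
have M0 : 0 < M.+1%:R :> C by rewrite ltr0n.
have t01 k : (k <= M.+1)%N -> 0 <= t k <= 1.
  by move=> kM; rewrite /t divr_ge0//= ler_pdivrMr// mul1r ler_nat.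
have tS k : t k.+1 - t k = M.+1%:R^-1.
  by rewrite /t -mulrBl -natrB// subSnn mul1r.
have -> : trln_path N 1 - trln_path N 0 =
    \sum_(0 <= k < M.+1) (trln_path N (t k.+1) - trln_path N (t k)).
  by rewrite telescope_sumr// /t divff ?gt_eqF// mul0r.
apply: le_trans (ler_norm_sum _ _ _) _.
have -> : K1 / M.+1%:R + K2 * r ^+ N =
    \sum_(0 <= k < M.+1) (K1 * M.+1%:R^-1 ^+ 2 + K2 * r ^+ N * M.+1%:R^-1).
  rewrite sumr_const_nat subn0 -mulr_natl; field.
  by rewrite nat1r pnatr_eq0.
rewrite !big_nat; apply: ler_sum => k /= kM.
apply: le_trans (H N _ _ (t01 _ _) (t01 _ _)) _ => //; first exact: ltnW.
by rewrite tS ger0_norm// invr_ge0 ltW.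
Qed.

End trace_log_path.

(** * Limits of complex sequences and the series of the matrix logarithm *)

Section complex_limits.
Context {R : realType}.
Local Notation C := R[i].

Lemma RenormE (z : C) : `|z| = (complex.Re `|z|)%:C%C.
Proof. by rewrite normc_def. Qed.

Lemma ge0_RecE (e : C) : 0 <= e -> e = (complex.Re e)%:C%C.
Proof. by move=> e0; rewrite RRe_real// ger0_real. Qed.

Lemma ler_Re_norm (z : C) : `|complex.Re z| <= complex.Re `|z|.
Proof. by rewrite -lecR -RenormE; exact: normc_ge_Re. Qed.

Lemma ler_Im_norm (z : C) : `|complex.Im z| <= complex.Re `|z|.
Proof.
have -> : complex.Im z = complex.Re (- (z * 'i%C)) by rewrite raddfN /= ReiNIm opprK.
apply: le_trans (ler_Re_norm _) _.
by rewrite normrN normrM (_ : `|'i%C| = 1 :> C) ?mulr1// complexiE normCi.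
Qed.

Lemma normr_complexR (x : R) : `|x%:C%C| = `|x|%:C%C :> C.
Proof. by rewrite normc_def /= expr0n addr0 sqrtr_sqr. Qed.

Lemma ler_norm_ReIm (z : C) : complex.Re `|z| <= `|complex.Re z| + `|complex.Im z|.
Proof.
rewrite -lecR -RenormE {1}(complexE z) rmorphD /=.
apply: le_trans (ler_normD _ _) _; rewrite normrM complexiE normCi mul1r.
by rewrite -!normr_complexR.
Qed.

Lemma cvg_complex (u : nat -> (C : numFieldType)) (a b : R) :
  (fun k => complex.Re (u k)) @ \oo --> a ->
  (fun k => complex.Im (u k)) @ \oo --> b ->
  u @ \oo --> (Complex a b : (C : numFieldType)).
Proof.
move=> /cvgrPdist_lt ua /cvgrPdist_lt ub.
apply/cvgrPdist_lt => e e0; have eE := ge0_RecE (ltW e0).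
have e2 : 0 < complex.Re e / 2 by rewrite divr_gt0// -ltcR -eE.
near=> k; rewrite RenormE eE ltcR.
apply: le_lt_trans (ler_norm_ReIm _) _; rewrite !raddfB /= (splitr (complex.Re e)).
by apply: ltrD; near: k; [exact: ua|exact: ub].
Unshelve. all: by end_near. Qed.

Lemma cvg_mx_entry (K : numFieldType) m n (u : nat -> 'M[K]_(m, n)) (L : 'M[K]_(m, n)) :
  (forall i j, (fun k => u k i j) @ \oo --> L i j) -> u @ \oo --> L.
Proof.
move=> uL; apply/cvg_ballP => e e0.
have : \forall k \near \oo, forall ij : 'I_m * 'I_n, ball (L ij.1 ij.2) e (u k ij.1 ij.2).
  apply: filter_forall => -[i j]; have /cvg_ballP := uL i j; exact.
by apply: filterS => k H; split=> // i j; exact: (H (i, j)).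
Qed.

Lemma cvg_sumr (I : Type) (s : seq I) (f : I -> nat -> R) (a : I -> R) :
  (forall i, f i @ \oo --> a i) ->
  (fun N => \sum_(i <- s) f i N) @ \oo --> \sum_(i <- s) a i.
Proof.
move=> fa; elim: s => [|i s IH].
  by under eq_fun do rewrite big_nil; rewrite big_nil; exact: cvg_cst.
under eq_fun do rewrite big_cons; rewrite big_cons.
by apply: cvgD => //; exact: fa.
Qed.

End complex_limits.

Section mxln.
Context {R : realType} {n : nat}.
Local Notation C := R[i].

(** Entries are bounded by the operator bound, so the real and imaginary parts of each entry of the
    series are dominated by a geometric series. Hence the [lim] in [mxln] is a genuine limit, and
    the trace may be taken term by term. *)
Lemma mxln_cvg (Z : 'M[C]_n) (r : C) : opbd Z r -> r < 1 ->
  (fun N => complex.Im (trln N Z)) @ \oo --> complex.Im (\tr (mxln (1%:M + Z))).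
Proof.
move=> Zr r1; have r0 := opbd_ge0 Zr.
pose q : R := complex.Re r.
have rE : r = q%:C%C by exact: ge0_RecE.
have q0 : 0 <= q by rewrite -lecR -rE.
have q1 : q < 1 by rewrite -ltcR -rE.
pose v (k : nat) : 'M[C]_n := ((-1) ^+ k / k.+1%:R) *: Z ^+ k.+1.
have vb k i j : complex.Re `|v k i j| <= q ^+ k.
  rewrite -lecR -RenormE rmorphXn /= -rE /v mxE normrM normf_div normrX normrN1.
  rewrite expr1n normr_nat mul1r; apply: le_trans (_ : _ <= 1 * r ^+ k.+1) _.
    apply: ler_pM; rewrite ?invr_ge0 ?ler0n//.
      by rewrite invf_le1 ?ltr0n// ler1n.
    exact: opbd_entry (opbdX _ Zr).
  by rewrite mul1r exprS ler_piMl ?exprn_ge0// ltW.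
have geo : cvgn (series (fun k => q ^+ k)).
  have -> : (fun k => q ^+ k) = geometric 1 q by apply/funext => k /=; rewrite mul1r.
  by apply: is_cvg_geometric_series; rewrite ger0_norm.
have cRe i j : cvgn (series (fun k => complex.Re (v k i j))).
  apply: normed_cvg; apply: (series_le_cvg _ _ _ geo) => k //=; first exact: exprn_ge0.
  by apply: le_trans (ler_Re_norm _) _; exact: vb.
have cIm i j : cvgn (series (fun k => complex.Im (v k i j))).
  apply: normed_cvg; apply: (series_le_cvg _ _ _ geo) => k //=; first exact: exprn_ge0.
  by apply: le_trans (ler_Im_norm _) _; exact: vb.
pose L : 'M[C]_n := \matrix_(i, j) Complex
  (limn (series (fun k => complex.Re (v k i j))))
  (limn (series (fun k => complex.Im (v k i j)))).
have ReS N i j : complex.Re (series v N i j) = series (fun k => complex.Re (v k i j)) N.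
  by rewrite /series /= summxE raddf_sum.
have ImS N i j : complex.Im (series v N i j) = series (fun k => complex.Im (v k i j)) N.
  by rewrite /series /= summxE raddf_sum.
have vL : series (v : nat -> 'M[C : numFieldType]_n) @ \oo --> (L : 'M[C : numFieldType]_n).
  apply: cvg_mx_entry => i j; rewrite mxE; apply: cvg_complex.
    under eq_fun do rewrite ReS; exact: cRe.
  under eq_fun do rewrite ImS; exact: cIm.
have -> : mxln (1%:M + Z) = L.
  rewrite /mxln [1%:M + Z]addrC addrK; exact: (cvg_lim (@norm_hausdorff _ _) vL).
have -> : (fun N => complex.Im (trln N Z)) =
    (fun N => \sum_i series (fun k => complex.Im (v k i i)) N).
  apply/funext => N; under eq_bigr do rewrite -ImS.
  rewrite -raddf_sum; congr complex.Im.
  rewrite /trln -[RHS]/(\tr (series v N)) /series /= raddf_sum big_mkord.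
  by apply: eq_bigr => k _ /=; rewrite /v mxtraceZ.
have -> : complex.Im (\tr L) = \sum_i limn (series (fun k => complex.Im (v k i i))).
  by rewrite raddf_sum; apply: eq_bigr => i _; rewrite mxE.
by apply: cvg_sumr => i; exact: cIm.
Qed.

End mxln.

(** * Contractions obtained from Hermitian identities *)

Section contractions.
Context {C : numClosedFieldType} {n : nat}.
Implicit Types A F H : 'M[C]_n.

Lemma opbd_sqr A (r : C) : 0 <= r ->
  (forall u : 'rV_n, dotmx (u *m A) (u *m A) <= r ^+ 2 * dotmx u u) -> opbd A r.
Proof.
move=> r0 Ar; split=> // u; rewrite /hermnorm -[r in leRHS](sqrCK r0).
by rewrite -sqrtCM ?nnegrE ?exprn_ge0 ?dnorm_ge0// ler_sqrtC ?nnegrE ?mulr_ge0 ?exprn_ge0 ?dnorm_ge0.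
Qed.

Lemma opbd_dotmx A (r : C) (u : 'rV_n) : opbd A r ->
  dotmx (u *m A) (u *m A) <= r ^+ 2 * dotmx u u.
Proof.
move=> [r0 Ar]; rewrite -[leLHS]sqrtCK -[dotmx u u]sqrtCK -exprMn.
by rewrite ler_sqr ?nnegrE ?mulr_ge0 ?sqrtC_ge0 ?dnorm_ge0//; exact: Ar.
Qed.

Lemma dotmx_mul2 (u : 'rV[C]_n) F : dotmx (u *m F) (u *m F) = (u *m (F *m F^t*) *m u^t*) 0 0.
Proof. by rewrite dotmxE trmx_mul map_mxM !mulmxA. Qed.

Lemma dotmx_mulB (u : 'rV[C]_n) F H E : F *m F^t* - H *m H^t* = E ->
  dotmx (u *m F) (u *m F) - dotmx (u *m H) (u *m H) = (u *m E *m u^t*) 0 0.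
Proof. by move=> <-; rewrite !dotmx_mul2 mulmxBr mulmxBl !mxE. Qed.

Lemma unitmx_herm F H : F *m F^t* - H *m H^t* = 1%:M -> F \in unitmx.
Proof.
move=> FH; rewrite -row_free_unit -kermx_eq0; apply/rowV0P => v /sub_kermxP vF.
have E : dotmx v v = dotmx (v *m F) (v *m F) - dotmx (v *m H) (v *m H).
  by rewrite (dotmx_mulB _ FH) mulmx1 dotmxE.
have v0 : dotmx v v <= 0.
  by rewrite E vF linear0l sub0r oppr_le0 dnorm_ge0.
apply/eqP; rewrite -(dnorm_eq0 (@dotmx C n)); apply/eqP/le_anti.
by rewrite v0; exact: dnorm_ge0.
Qed.

(** With v = u F^-1 the hypothesis reads |v H|^2 = |u|^2 - |v|^2. If c bounds F then |u| <= c |v|,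
    so the square of the norm is at most 1 - c^-2; taking c above 1 makes the square root real. *)
Lemma contraction_herm F H : F *m F^t* - H *m H^t* = 1%:M ->
  exists r : C, r < 1 /\ opbd (invmx F *m H) r.
Proof.
move=> FH; have UF := unitmx_herm FH.
have [b b0 Fb] := opbd_ex F.
have b1 : 1 < b + 1 by rewrite ltrDr.
have {Fb} Fb : opbd F (b + 1) by apply: opbd_le Fb _; rewrite lerDl.
set c := b + 1 in b1 Fb; have c0 : 0 < c by apply: lt_trans b1.
have d0 : 0 <= 1 - c ^- 2.
  by rewrite subr_ge0 invf_le1 ?exprn_gt0// exprn_ege1 ?ltW.
exists (sqrtC (1 - c ^- 2)); split.
  rewrite -[ltRHS]sqrtC1 ltr_sqrtC ?nnegrE//.
  by rewrite ltrBlDr ltrDl invr_gt0 exprn_gt0.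
apply: opbd_sqr => [|u]; first by rewrite sqrtC_ge0.
rewrite sqrtCK mulmxA; set v := u *m invmx F.
have vF : v *m F = u by rewrite mulmxKV.
have E : dotmx (v *m H) (v *m H) = dotmx u u - dotmx v v.
  have -> : dotmx v v = dotmx (v *m F) (v *m F) - dotmx (v *m H) (v *m H).
    by rewrite (dotmx_mulB _ FH) mulmx1 dotmxE.
  by rewrite vF opprB addrC subrK.
rewrite E mulrBl mul1r lerD2l lerN2 ler_pdivrMl ?exprn_gt0//.
by rewrite -{1 2}vF; exact: opbd_dotmx.
Qed.

(** When the row (F H) is (1 S) G with G preserving the form of signature (n, n), F^-1 H is the
    image of S under the linear fractional action of G on the matrix ball. The hypothesis gives |v
    F|^2 - |v H|^2 = |v|^2 - |v S|^2 >= 0. *)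
Lemma contraction_move F H S : F \in unitmx ->
  F *m F^t* - H *m H^t* = 1%:M - S *m S^t* -> opbd S 1 ->
  opbd (invmx F *m H) 1.
Proof.
move=> UF FH S1; apply: opbd_sqr => // u.
rewrite expr1n mul1r mulmxA; set v := u *m invmx F.
have vF : v *m F = u by rewrite mulmxKV.
have E : dotmx v v - dotmx (v *m S) (v *m S) =
    dotmx (v *m F) (v *m F) - dotmx (v *m H) (v *m H).
  rewrite (dotmx_mulB _ FH) dotmx_mul2 mulmxBr mulmxBl mulmx1 dotmxE.
  by rewrite [RHS]mxE; congr (_ + _); rewrite [RHS]mxE.
have /= := opbd_dotmx v S1; rewrite expr1n mul1r -subr_ge0 E vF.
by rewrite subr_ge0.
Qed.

End contractions.

Lemma mulmx_scalar_blocks (K : comPzRingType) n (a b c d : 'M[K]_n)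
    (x1 x2 x3 x4 y1 y2 y3 y4 : K) :
  block_mx x1%:M x2%:M x3%:M x4%:M *m block_mx a b c d *m
  block_mx y1%:M y2%:M y3%:M y4%:M =
  block_mx (y1 *: (x1 *: a + x2 *: c) + y3 *: (x1 *: b + x2 *: d))
           (y2 *: (x1 *: a + x2 *: c) + y4 *: (x1 *: b + x2 *: d))
           (y1 *: (x3 *: a + x4 *: c) + y3 *: (x3 *: b + x4 *: d))
           (y2 *: (x3 *: a + x4 *: c) + y4 *: (x3 *: b + x4 *: d)).
Proof.
rewrite mulmx_block !mul_scalar_mx.
move: (x1 *: a + _) (x1 *: b + _) (x3 *: a + _) (x3 *: b + _) => e f g h.
by rewrite mulmx_block !mul_mx_scalar.
Qed.

Definition signature_mx (K : pzRingType) n : 'M[K]_(n + n) := block_mx 1%:M 0 0 (- 1%:M).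

Lemma signature_mxK (K : pzRingType) n : signature_mx K n *m signature_mx K n = 1%:M.
Proof.
rewrite /signature_mx mulmx_block !mulmx0 !mul0mx !addr0 !add0r mulmxN mulNmx.
by rewrite !mulmx1 opprK -scalar_mx_block.
Qed.

(** The Cayley matrix turns the symplectic form into i times the diagonal form of signature (n, n).
    Here s stands for the inverse square root of 2. *)
Lemma std_form_conj_cayley (K : comNzRingType) n (i s : K) :
  i * i = -1 -> s * s * 2 = 1 ->
  (s *: block_mx 1%:M (- i)%:M (- i)%:M 1%:M) *m block_mx 0 1%:M (- 1%:M) 0 *m
  (s *: block_mx 1%:M i%:M i%:M 1%:M) = i *: block_mx 1%:M 0 0 (- 1%:M) :> 'M[K]_(n + n).
Proof.
move=> ii ss; rewrite -scalemxAr -!scalemxAl scalerA mulmx_scalar_blocks.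
rewrite !scale_block_mx !scaler0 !addr0 !add0r !scalerA.
congr block_mx; rewrite ![_ *: - 1%:M]scalerN -scaleNr -scalerDl scalerA.
- by congr (_ *: _); ring: ss.
- by rewrite -[RHS](scale0r 1%:M); congr (_ *: _); ring: ii.
- by rewrite -[RHS](scale0r 1%:M); congr (_ *: _); ring: ii.
- rewrite -scaleNr; congr (_ *: _); transitivity (- (i * (s * s * 2))); last by rewrite ss mulr1.
  by ring.
Qed.

Lemma mulmx_scaleI (K : fieldType) n (x : K) (A L B : 'M[K]_n) : x != 0 ->
  A *m (x *: L) *m B = x *: L -> A *m L *m B = L.
Proof. by move=> x0; rewrite -scalemxAr -scalemxAl => /(scalerI x0). Qed.

Lemma mulmx_intertwine (K : comUnitRingType) n (A A' J J' G G' M : 'M[K]_n) :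
  A *m M *m A' = M -> J *m G = A' *m J -> G' *m J' = J' *m A ->
  G' *m (J' *m M *m J) *m G = J' *m M *m J.
Proof.
by move=> AMA JG GJ; rewrite !mulmxA GJ -!mulmxA JG -[in RHS]AMA !mulmxA.
Qed.

(** L B L is a left inverse of A, hence a right inverse since the matrices are square. *)
Lemma mulmx_form_swap (K : comUnitRingType) n (A B L : 'M[K]_n) :
  L *m L = 1%:M -> B *m L *m A = L -> A *m L *m B = L.
Proof.
move=> LL E; have : (L *m B *m L) *m A = 1%:M by rewrite -!mulmxA (mulmxA B) E.
move=> /mulmx1C E'; rewrite -[LHS]mulmx1 -LL mulmxA -[RHS]mul1mx -E'.
by rewrite !mulmxA.
Qed.

(** * Symplectic matrices under the Cayley transform *)

Section symplectic.
Context {R : realType} {n : nat}.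
Local Notation C := R[i].
Local Notation rc := (real_complex R).
Implicit Types g h : 'M[R]_(n + n).

Definition symplectic g := g^T *m std_form n *m g = std_form n.

Lemma symplecticM g h : symplectic g -> symplectic h -> symplectic (g *m h).
Proof.
move=> sg sh; rewrite /symplectic trmx_mul !mulmxA -(mulmxA h^T) -(mulmxA h^T).
by rewrite sg.
Qed.

Lemma std_form_sqr : std_form n *m std_form n = - 1%:M :> 'M[R]_(n + n).
Proof.
rewrite /std_form mulmx_block !mulmx0 !mul0mx !mulmx1 !mul1mx !addr0 !add0r.
by rewrite scalar_mx_block opp_block_mx !oppr0.
Qed.

Definition cayley_conj g : 'M[C]_(n + n) :=
  invmx cayley_mx *m map_mx rc g *m cayley_mx.

Let J : 'M[C]_(n + n) := cayley_mx.
Let s : C := ((Num.sqrt 2)^-1)%:C%C.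
Let I : C := 'i%C.

Let ss : s * s = 2^-1.
Proof.
rewrite /s -rmorphM /= -invfM -expr2 sqr_sqrtr ?ler0n//.
by rewrite fmorphV rmorph_nat.
Qed.

Let s2 : s * s * 2 = 1.
Proof. by rewrite ss mulVf ?pnatr_eq0. Qed.

Let II : I * I = -1. Proof. by rewrite -expr2 sqr_i. Qed.

Let JC : 'M[C]_(n + n) := s *: block_mx 1%:M (- I)%:M (- I)%:M 1%:M.

Let JCJ : JC *m J = 1%:M.
Proof.
rewrite /JC /J /cayley_mx -/s -/I -scalemxAl -scalemxAr scalerA mulmx_block.
rewrite -!scalar_mxM !mul1r !mulr1 -!raddfD /= mulNr II opprK subrr.
rewrite addNr -[1 + 1]/2 !raddf0 -scalar_mx_block scale_scalar_mx.
by rewrite s2.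
Qed.

Let JU : J \in unitmx. Proof. by have [] := mulmx1_unit JCJ. Qed.

Let conjI : Num.conj I = - I. Proof. by rewrite /I complexiE conjCi. Qed.

Let conjR (x : R) : Num.conj (x%:C%C : C) = x%:C%C. Proof. exact: conjc_real. Qed.

Let JCE : JC = J^t*.
Proof.
rewrite /JC /J /cayley_mx -/s -/I linearZ /= map_mxZ /= conjR.
rewrite tr_block_mx map_block_mx !tr_scalar_mx !map_scalar_mx /= conjC1.
by rewrite conjI.
Qed.

Lemma cayley_conj1 : cayley_conj 1%:M = 1%:M.
Proof. by rewrite /cayley_conj map_mx1 mulmx1 mulVmx. Qed.

Lemma cayley_conjM g h : cayley_conj (g *m h) = cayley_conj g *m cayley_conj h.
Proof.
by rewrite /cayley_conj map_mxM /= !mulmxA; congr (_ *m _ *m _); rewrite mulmxK.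
Qed.

Local Notation signature_mx := (signature_mx C n).

Let JKJ : J^t* *m map_mx rc (std_form n) *m J = I *: signature_mx.
Proof.
have -> : map_mx rc (std_form n) = block_mx 0 1%:M (- 1%:M) 0.
  by rewrite /std_form map_block_mx !raddf0 map_mx1 raddfN /= map_mx1.
by rewrite -JCE /JC /J /cayley_mx -/s -/I (std_form_conj_cayley _ II s2).
Qed.

(** For a real matrix the transpose is the adjoint, so invariance of the symplectic form is
    invariance of a sesquilinear form, and the latter is i times [signature_mx] after the change of
    basis. *)
Lemma cayley_conj_herm g : symplectic g ->
  (cayley_conj g)^t* *m signature_mx *m cayley_conj g = signature_mx.
Proof.
move=> sg; have I0 : I != 0 by rewrite -(normr_eq0 I) /I complexiE normCi oner_eq0.
have JG : J *m cayley_conj g = map_mx rc g *m J.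
  by rewrite /cayley_conj !mulmxA mulmxV// mul1mx.
apply: (mulmx_scaleI I0); rewrite -JKJ.
apply: (@mulmx_intertwine _ _ (map_mx rc g^T) (map_mx rc g)); [|exact: JG|].
  by rewrite -!map_mxM sg.
rewrite -map_mxM -trmx_mul /= JG trmx_mul map_mxM; congr (_ *m _).
apply/matrixP => i j; rewrite !mxE; exact: conjR.
Qed.

Lemma cayley_conj_herm' g : symplectic g ->
  cayley_conj g *m signature_mx *m (cayley_conj g)^t* = signature_mx.
Proof.
by move=> sg; exact: (mulmx_form_swap (signature_mxK _ _) (cayley_conj_herm sg)).
Qed.

End symplectic.

(** * Matrices preserving the Hermitian form of signature (n, n) *)

Section pseudo_unitary.
Context {C : numClosedFieldType} {n : nat}.
Local Notation L := (signature_mx C n).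
Implicit Types G : 'M[C]_(n + n).

Definition pseudo_unitary G := G^t* *m L *m G = L /\ G *m L *m G^t* = L.

Lemma pseudo_unitaryM G1 G2 :
  pseudo_unitary G1 -> pseudo_unitary G2 -> pseudo_unitary (G1 *m G2).
Proof.
move=> [h1 h1'] [h2 h2']; split; rewrite trmx_mul map_mxM !mulmxA.
  by rewrite -[RHS]h2 -[in RHS]h1 !mulmxA.
by rewrite -[RHS]h1' -[in RHS]h2' !mulmxA.
Qed.

Lemma pseudo_unitary_rows G : pseudo_unitary G ->
  ulsubmx G *m (ulsubmx G)^t* - ursubmx G *m (ursubmx G)^t* = 1%:M.
Proof.
move=> [_]; rewrite -[G]submxK tr_block_mx map_block_mx /signature_mx !mulmx_block.
move=> /eq_block_mx[+ _ _ _].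
by rewrite !mulmx0 mulmx1 addr0 add0r mulmxN mulmx1 mulNmx block_mxKul block_mxKur.
Qed.

Lemma pseudo_unitary_cols G : pseudo_unitary G ->
  (ulsubmx G)^t* *m (ulsubmx G)^t*^t* -
  (dlsubmx G)^t* *m (dlsubmx G)^t*^t* = 1%:M.
Proof.
rewrite !trmxCK => -[+ _]; rewrite -[G]submxK tr_block_mx map_block_mx /signature_mx !mulmx_block.
move=> /eq_block_mx[+ _ _ _].
by rewrite !mulmx0 mulmx1 addr0 add0r mulmxN mulmx1 mulNmx block_mxKul block_mxKdl.
Qed.

Lemma pseudo_unitary_ulU G : pseudo_unitary G -> ulsubmx G \in unitmx.
Proof. by move=> /pseudo_unitary_rows/unitmx_herm. Qed.

(** In the notation of the Berezin cocycle this is conj(Psi) Phi^-1, and [upper_ratio] is Phi^-1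
    Psi. They are the contractions attached to G: the bracket in c is 1 plus the upper ratio of the
    first matrix times the lower ratio of the second. *)
Definition lower_ratio G := dlsubmx G *m invmx (ulsubmx G).
Definition upper_ratio G := invmx (ulsubmx G) *m ursubmx G.

Lemma upper_ratio_contr G : pseudo_unitary G ->
  exists r : C, r < 1 /\ opbd (upper_ratio G) r.
Proof. by move=> /pseudo_unitary_rows/contraction_herm. Qed.

(** The relation between columns bounds the adjoint of the ratio, and passing to adjoints keeps the
    bound. *)
Lemma lower_ratio_contr G : pseudo_unitary G ->
  exists r : C, r < 1 /\ opbd (lower_ratio G) r.
Proof.
move=> pG; have [r [r1 H]] := contraction_herm (pseudo_unitary_cols pG).
exists r; split=> //; have := opbd_adj H.
by rewrite trmx_mul map_mxM trmxCK trmx_inv map_invmx /= trmxCK.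
Qed.

Definition berezin_mx G1 G2 : 'M[C]_n :=
  invmx (ulsubmx G1) *m ulsubmx (G1 *m G2) *m invmx (ulsubmx G2).

Lemma ulsubmxM G1 G2 : ulsubmx (G1 *m G2) =
  ulsubmx G1 *m ulsubmx G2 + ursubmx G1 *m dlsubmx G2.
Proof. by rewrite -{1}[G1]submxK -{1}[G2]submxK mulmx_block block_mxKul. Qed.

Lemma dlsubmxM G1 G2 : dlsubmx (G1 *m G2) =
  dlsubmx G1 *m ulsubmx G2 + drsubmx G1 *m dlsubmx G2.
Proof. by rewrite -{1}[G1]submxK -{1}[G2]submxK mulmx_block block_mxKdl. Qed.

Lemma berezin_mxE G1 G2 : pseudo_unitary G1 -> pseudo_unitary G2 ->
  berezin_mx G1 G2 = 1%:M + upper_ratio G1 *m lower_ratio G2.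
Proof.
move=> /pseudo_unitary_ulU U1 /pseudo_unitary_ulU U2.
rewrite /berezin_mx ulsubmxM mulmxDr mulmxDl mulKmx// mulmxV//.
by rewrite /upper_ratio /lower_ratio !mulmxA.
Qed.

Lemma berezin_mx_contr G1 G2 : pseudo_unitary G1 -> pseudo_unitary G2 ->
  exists r : C, r < 1 /\ opbd (berezin_mx G1 G2 - 1%:M) r.
Proof.
move=> p1 p2; rewrite berezin_mxE// addrC addKr.
have [r [r1 h1]] := upper_ratio_contr p1; have [s [s1 h2]] := lower_ratio_contr p2.
exists (r * s); split; last exact: opbdM.
by rewrite mulr_ilt1// ?(opbd_ge0 h1)// (opbd_ge0 h2).
Qed.

(* Replacing the contraction S attached to G1 by t S keeps the three arguments
   of the logarithm within a fixed distance r < 1 of the identity. *)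
Lemma trln_cocycle G1 G2 G3 :
  pseudo_unitary G1 -> pseudo_unitary G2 -> pseudo_unitary G3 ->
  exists r K1 K2 : C, [/\ 0 <= r, r < 1, 0 <= K1 & 0 <= K2] /\ forall N M,
  `|(trln N (berezin_mx G1 G2 - 1%:M) + trln N (berezin_mx (G1 *m G2) G3 - 1%:M)) -
    (trln N (berezin_mx G1 (G2 *m G3) - 1%:M) + trln N (berezin_mx G2 G3 - 1%:M))|
  <= K1 / M.+1%:R + K2 * r ^+ N.
Proof.
move=> p1 p2 p3; have p23 := pseudo_unitaryM p2 p3.
have [r1 [r11 S1]] := upper_ratio_contr p1.
have [r2 [r21 T2]] := lower_ratio_contr p2.
have [r23 [r231 T23]] := lower_ratio_contr p23.
have [r3 [r31 T3]] := lower_ratio_contr p3.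
have r10 := opbd_ge0 S1; have r30 := opbd_ge0 T3.
(* A bound below 1 that dominates both r1 and r3, given by a formula since [C] is only partially
   ordered. *)
pose r := 1 - (1 - r1) * (1 - r3).
have r1r : r1 <= r.
  have -> : r = r1 + r3 * (1 - r1) by rewrite /r; ring.
  by rewrite lerDl mulr_ge0// subr_ge0 ltW.
have r3r : r3 <= r.
  have -> : r = r3 + r1 * (1 - r3) by rewrite /r; ring.
  by rewrite lerDl mulr_ge0// subr_ge0 ltW.
have rl1 : r < 1 by rewrite ltrBlDr ltrDl mulr_gt0// subr_gt0.
have r0 : 0 <= r by apply: le_trans r1r.
pose S := upper_ratio G1.
pose A := S *m lower_ratio G2; pose B := S *m lower_ratio (G2 *m G3).
have Ar : opbd A r.
  apply: opbd_le (opbdM S1 T2) _; apply: le_trans r1r.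
  by rewrite ler_piMr// ltW.
have Br : opbd B r.
  apply: opbd_le (opbdM S1 T23) _; apply: le_trans r1r.
  by rewrite ler_piMr// ltW.
pose P := invmx (ulsubmx G2); pose Q := ulsubmx (G2 *m G3) *m invmx (ulsubmx G3).
have U1 := pseudo_unitary_ulU p1; have U2 := pseudo_unitary_ulU p2.
have U3 := pseudo_unitary_ulU p3; have U23 := pseudo_unitary_ulU p23.
have Wr t : 0 <= t <= 1 ->
  opbd (P *m (invmx (1%:M + t *: A) *m (1%:M + t *: B)) *m Q - 1%:M) r.
  move=> /andP[t0 t1].
  have tS : opbd (t *: S) r1.
    apply: opbd_le (opbdZ t S1) _; by rewrite ger0_norm// ler_piMl.
  have tA : opbd (t *: A) r.
    apply: opbd_le (opbdZ t Ar) _; by rewrite ger0_norm// ler_piMl.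
  have UA := opbd_unit tA rl1.
  (* The row (F H) is (1 tS) G2, so F^-1 H is the contraction t S moved by G2. The bracket W(t) is 1
     plus this contraction times the ratio of G3, which keeps it within r3 of the identity for every
     t. *)
  pose F := ulsubmx G2 + t *: S *m dlsubmx G2.
  pose H := ursubmx G2 + t *: S *m drsubmx G2.
  have FE : F = (1%:M + t *: A) *m ulsubmx G2.
    by rewrite mulmxDl mul1mx /A /lower_ratio mulmxA scalemxAl scalemxAl mulmxKV.
  have UF : F \in unitmx by rewrite FE unitmx_mul UA.
  have FH : F *m F^t* - H *m H^t* = 1%:M - (t *: S) *m (t *: S)^t*.
    have FHE : row_mx F H = row_mx 1%:M (t *: S) *m G2.
      by rewrite -[in RHS](submxK G2) mul_row_block !mul1mx.
    have LE (X Y : 'M[C]_n) :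
        row_mx X Y *m L *m (row_mx X Y)^t* = X *m X^t* - Y *m Y^t*.
      rewrite /signature_mx mul_row_block !mulmx0 addr0 add0r mulmx1 mulmxN mulmx1.
      by rewrite tr_row_mx map_col_mx mul_row_col mulNmx.
    rewrite -LE FHE trmx_mul map_mxM.
    have -> : row_mx 1%:M (t *: S) *m G2 *m L *m (G2^t* *m (row_mx 1%:M (t *: S))^t*) =
        row_mx 1%:M (t *: S) *m L *m (row_mx 1%:M (t *: S))^t*.
      by rewrite -[in RHS](proj2 p2) !mulmxA.
    by rewrite LE trmx1 map_mx1 mulmx1.
  have WE : P *m (invmx (1%:M + t *: A) *m (1%:M + t *: B)) *m Q =
      1%:M + (invmx F *m H) *m lower_ratio G3.
    have BE : (1%:M + t *: B) *m ulsubmx (G2 *m G3) = F *m ulsubmx G3 + H *m dlsubmx G3.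
      rewrite mulmxDl mul1mx /B /lower_ratio mulmxA scalemxAl scalemxAl mulmxKV//.
      rewrite ulsubmxM dlsubmxM mulmxDr /F /H !mulmxDl !mulmxA addrACA.
      by [].
    have iF : invmx F = P *m invmx (1%:M + t *: A).
      apply: (can_inj (mulKmx UF)); rewrite mulmxV// FE mulmxA mulmxK//.
      by rewrite mulmxV.
    rewrite /Q !mulmxA -iF -(mulmxA (invmx F)) BE mulmxDr.
    rewrite mulmxDl mulKmx// mulmxV// /lower_ratio; congr (_ + _).
    by rewrite !mulmxA.
  rewrite WE addrC addKr; apply: opbd_le r3r; rewrite -[r3]mul1r.
  apply: opbdM => //; apply: contraction_move UF FH _.
  by apply: opbd_le tS _; exact: ltW.
have [K1 [K2 [K10 K20 H]]] := trln_path_bound rl1 Ar Br Wr.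
exists r, K1, K2; split=> // N M; apply: le_trans (H N M).
rewrite le_eqVlt; apply/orP; left; apply/eqP; congr `|_|.
rewrite /trln_path !scale1r !scale0r !addr0 invmx1 !mulmx1.
have -> : berezin_mx G1 G2 - 1%:M = A by rewrite berezin_mxE// addrC addKr.
have -> : berezin_mx G1 (G2 *m G3) - 1%:M = B by rewrite berezin_mxE// addrC addKr.
have -> : berezin_mx G2 G3 = P *m Q by rewrite /berezin_mx /P /Q mulmxA.
have -> : berezin_mx (G1 *m G2) G3 = P *m (invmx (1%:M + A) *m (1%:M + B)) *m Q.
  have E12 : ulsubmx (G1 *m G2) = ulsubmx G1 *m (1%:M + A) *m ulsubmx G2.
    by rewrite /A -berezin_mxE// /berezin_mx !mulmxA mulmxV// mul1mx mulmxKV.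
  have E123 : ulsubmx (G1 *m G2 *m G3) = ulsubmx G1 *m (1%:M + B) *m ulsubmx (G2 *m G3).
    by rewrite /B -berezin_mxE// /berezin_mx !mulmxA mulmxV// mul1mx mulmxKV.
  have UA := opbd_unit Ar rl1.
  have i12 : invmx (ulsubmx (G1 *m G2)) = P *m invmx (1%:M + A) *m invmx (ulsubmx G1).
    have U12 : ulsubmx (G1 *m G2) \in unitmx by rewrite E12 !unitmx_mul U1 U2 UA.
    apply: (can_inj (mulKmx U12)); rewrite mulmxV// E12 /P !mulmxA.
    by rewrite mulmxK// mulmxK// mulmxV.
  by rewrite /berezin_mx i12 E123 /Q !mulmxA mulmxKV.
by ring.
Qed.

End pseudo_unitary.

Section triangular_trace.
Variable K : comNzRingType.

Lemma trig_mulmx n (A B : 'M[K]_n) : is_trig_mx A -> is_trig_mx B ->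
  is_trig_mx (A *m B) /\ forall i, (A *m B) i i = A i i * B i i.
Proof.
move=> /is_trig_mxP At /is_trig_mxP Bt; split=> [|i].
  apply/is_trig_mxP => i j ij; rewrite mxE big1// => k _.
  have [ik|ki] := ltnP i k; first by rewrite At ?mul0r.
  by rewrite Bt ?mulr0// (leq_ltn_trans ki).
rewrite mxE (bigD1 i)//= big1 ?addr0// => k ki.
have [ik|ik] := ltnP i k; first by rewrite At ?mul0r.
by rewrite Bt ?mulr0// ltn_neqAle ki.
Qed.

Lemma trig_exp n (A : 'M[K]_n) k : is_trig_mx A ->
  is_trig_mx (A ^+ k) /\ forall i, (A ^+ k) i i = A i i ^+ k.
Proof.
move=> At; elim: k => [|k [IHt IHd]].
  split=> [|i]; first by apply/is_trig_mxP => i j ij; rewrite expr0 mxE -val_eqE (ltn_eqF ij).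
  by rewrite !expr0 mxE eqxx.
rewrite exprS -[A * _]/(A *m _); have [h1 h2] := trig_mulmx At IHt.
by split=> // i; rewrite h2 IHd exprS.
Qed.

End triangular_trace.

(** * The argument of 1 + z inside the unit disc *)

Section arg_bound.
Context {R : realType}.
Local Notation C := R[i].

(** Both sides are the derivative in s of the argument of 1 + s z: on the left through the
    logarithm, on the right through the arctangent of imaginary over real part. *)
Lemma Im_ratio (z : C) (s : R) : 1 + s%:C%C * z != 0 -> 0 < 1 + complex.Re z * s ->
  complex.Im (z / (1 + s%:C%C * z)) =
  (1 + (s * complex.Im z / (1 + complex.Re z * s)) ^+ 2)^-1 *
  (complex.Im z / (1 + complex.Re z * s) ^+ 2).
Proof.
move=> W0 D0; have := mulfVK W0 z; move: D0 {W0}; set w := z / _; move: w.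
case: z => x y [a b] /= D0 wW.
have /= e1 := congr1 (@complex.Re R) wW; have /= e2 := congr1 (@complex.Im R) wW.
rewrite !mul0r !subr0 !addr0 ?add0r in e1 e2.
have D : b * ((1 + x * s) ^+ 2 + (s * y) ^+ 2) = y.
  transitivity ((a * (s * y) + b * (1 + s * x)) * (1 + x * s) -
    (a * (1 + s * x) - b * (s * y)) * (s * y)); first by ring.
  by rewrite e1 e2; ring.
have D1 : (1 + x * s) ^+ 2 + (s * y) ^+ 2 != 0.
  by rewrite gt_eqF// ltr_wpDr ?sqr_ge0// exprn_gt0.
have D2 : 1 + x * s != 0 by rewrite gt_eqF.
apply: (mulIf D1); rewrite D; field.
by rewrite D2 /= [X in X != 0](_ : _ = (1 + x * s) ^+ 2 + (s * y) ^+ 2)//; ring.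
Qed.

(** The real part of 1 + s z stays positive, so its argument is the arctangent [atan (h s)], which
    lies below pi / 2 in modulus. The mean value theorem on [0, 1] compares it with the truncated
    series, the polynomial p. *)
Lemma Im_log_bound (z : C) (q : R) N : 0 <= q -> q < 1 -> `|z| <= q%:C%C ->
  `|complex.Im (\sum_(k < N) (-1) ^+ k / k.+1%:R * z ^+ k.+1)|
    <= pi / 2 + q ^+ N / (1 - q).
Proof.
move=> q0 q1 zq; set x := complex.Re z; set y := complex.Im z.
have zq' : complex.Re `|z| <= q by rewrite -lecR -RenormE.
have xq : `|x| <= q by apply: le_trans (ler_Re_norm z) _.
pose c k : R := complex.Im (z ^+ k.+1).
pose p : {poly R} := \sum_(k < N) ((-1) ^+ k / k.+1%:R * c k) *: 'X^(k.+1).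
pose dn : {poly R} := 1 + x *: 'X.
have dnE s : dn.[s] = 1 + x * s by rewrite !hornerE.
have d0 (s : R) : 0 <= s <= 1 -> 0 < dn.[s].
  move=> /andP[s0 s1]; rewrite dnE -ltrBlDl sub0r.
  have xs : - (x * s) <= q.
    apply: le_trans (ler_norm _) _; rewrite normrN normrM (ger0_norm s0).
    by apply: le_trans xq; rewrite ler_piMr.
  by rewrite ltrNl; apply: le_lt_trans xs _.
pose h (s : R) := s * y / dn.[s].
pose g (s : R) := p.[s] - atan (h s).
pose dg (s : R) := p^`().[s] - (1 + h s ^+ 2)^-1 * (y / dn.[s] ^+ 2).
have gd (s : R) : 0 <= s <= 1 -> is_derive s 1 g (dg s).
  move=> /d0 ds; rewrite /g /dg.
  apply: (@is_deriveB _ _ _ (horner p) (atan \o h)).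
  apply: is_derive1_comp.
  have dV : is_derive s 1 (fun t => (dn.[t])^-1) (- dn.[s] ^- 2 *: x).
    have dd : is_derive s 1 (horner dn) x.
      by apply: is_derive_eq; rewrite /dn derivD derivZ derivX -[1]/(1%:P) derivC !hornerE.
    apply: DeriveDef; first by apply: derivableV; [rewrite gt_eqF|exact: ex_derive].
    by rewrite deriveV ?gt_eqF// ?derive_val//; exact: ex_derive.
  have dY : is_derive s 1 (horner (y *: 'X)) y.
    by apply: is_derive_eq; rewrite derivZ derivX !hornerE.
  have -> : h = horner (y *: 'X) * (fun t => (dn.[t])^-1).
    by apply/funext => t; rewrite fctE /h hornerZ hornerX [t * y]mulrC.
  apply: is_derive_eq; rewrite /= !hornerE -![_ *: _]/(_ * _).
  by rewrite -dnE; have := gt_eqF ds; rewrite dnE => ?; field; rewrite mulrC; lra.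
have dgE s : 0 <= s <= 1 -> `|dg s| <= q ^+ N / (1 - q).
  move=> s01; have ds := d0 _ s01; have /andP[s0 s1] := s01.
  have szq : `|s%:C%C * z| <= q%:C%C :> C.
    rewrite normrM normr_complexR (ger0_norm s0); apply: le_trans zq.
    by rewrite ler_piMl// lecR.
  have W0 : (1 - q)%:C%C <= `|1 + s%:C%C * z|.
    rewrite -[s%:C%C * z]opprK rmorphB /=; apply: le_trans (lerB_dist _ _).
    by rewrite normr1 normrN lerD2l lerN2.
  have Wn0 : 1 + s%:C%C * z != 0 by rewrite -normr_gt0 (lt_le_trans _ W0)// ltcR subr_gt0.
  pose w := z / (1 + s%:C%C * z).
  have wy : complex.Im w = (1 + h s ^+ 2)^-1 * (y / dn.[s] ^+ 2).
    by rewrite /h dnE; apply: Im_ratio => //; rewrite -dnE.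
  have pE : p^`().[s] = complex.Im (\sum_(k < N) z * (- (s%:C%C * z)) ^+ k).
    rewrite raddf_sum /p raddf_sum horner_sum; apply: eq_bigr => k _ /=.
    rewrite derivZ derivXn hornerZ hornerMn hornerXn /=.
    have -> : z * (- (s%:C%C * z)) ^+ k = ((-1) ^+ k * s ^+ k)%:C%C * z ^+ k.+1.
      by rewrite (exprNn (s%:C%C * z)) exprMn rmorphM !rmorphXn rmorphN1 exprS; ring.
    rewrite -/(c k) /c; case: (z ^+ k.+1) => a b /=; rewrite mul0r addr0.
    by rewrite -mulr_natl; field; rewrite nat1r pnatr_eq0.
  (* The derivative of p is a finite geometric sum; what separates it from the derivative of the
     arctangent is the geometric remainder. *)
  have -> : dg s = complex.Im (- (w * (- (s%:C%C * z)) ^+ N)).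
    rewrite /dg -wy pE -raddfB /=; congr complex.Im.
    rewrite -mulr_sumr; have := subrX1 (- (s%:C%C * z)) N.
    move: (\sum_(i < N) _) => S E; rewrite /w.
    have -> : S = (1 - (- (s%:C%C * z)) ^+ N) / (1 + s%:C%C * z).
      by apply: (mulIf Wn0); rewrite mulfVK// -[1 - _]opprB E; ring.
    by field.
  apply: le_trans (ler_Im_norm _) _; rewrite -lecR -RenormE normrN normrM normrX normrN.
  rewrite /w normrM normfV mulrAC rmorphM fmorphV /= rmorphXn /=.
  apply: ler_pM; rewrite ?mulr_ge0 ?invr_ge0 ?exprn_ge0//.
    rewrite -[leRHS]mul1r; apply: ler_pM; rewrite ?exprn_ge0//.
      by apply: le_trans zq _; rewrite lecR ltW.
    by rewrite lerXn2r// nnegrE lecR.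
  by rewrite lef_pV2 ?posrE ?normr_gt0 ?ltcR ?subr_gt0.
have gc : {within `[0, 1], continuous g}.
  apply: derivable_within_continuous => s; rewrite in_itv /= => s01.
  by have [] := gd _ s01.
have gd' (s : R) : s \in `]0, 1[ -> is_derive s 1 g (dg s).
  by rewrite in_itv /= => /andP[s0 s1]; apply: gd; rewrite !ltW.
have [s] := MVT_segment ler01 gd' gc.
rewrite in_itv /= subr0 mulr1 => s01 gE.
have g0 : g 0 = 0.
  rewrite /g /h !mul0r atan0 subr0 /p horner_sum big1// => k _.
  by rewrite !hornerE expr0n mulr0.
have -> : complex.Im (\sum_(k < N) (-1) ^+ k / k.+1%:R * z ^+ k.+1) = p.[1].
  rewrite raddf_sum /p horner_sum; apply: eq_bigr => k _ /=.
  rewrite !hornerE expr1n mulr1 /c.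
  have -> : (-1) ^+ k / k.+1%:R = ((-1) ^+ k / k.+1%:R)%:C%C :> C.
    by rewrite rmorphM fmorphV rmorphXn rmorphN1 rmorph_nat.
  by case: (z ^+ k.+1) => a b /=; rewrite mul0r addr0.
have -> : p.[1] = atan (h 1) + g 1 by rewrite /g addrC subrK.
apply: le_trans (ler_normD _ _) _; apply: lerD.
  by rewrite ler_norml; have := atan_gtNpi2 (h 1); have := atan_ltpi2 (h 1); lra.
by rewrite -[g 1]subr0 -g0 gE; exact: dgE.
Qed.

End arg_bound.

(** * The cocycle identity and the bound for c *)

Section berezin_theory.
Context {R : realType} {n : nat}.
Local Notation C := R[i].
Implicit Types g h : 'M[R]_(n + n).

Lemma cayley_conj_pu g : symplectic g -> pseudo_unitary (cayley_conj g).
Proof. by move=> sg; split; [exact: cayley_conj_herm|exact: cayley_conj_herm']. Qed.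

Lemma berezinE g h : berezin g h =
  complex.Im (\tr (mxln (1%:M + (berezin_mx (cayley_conj g) (cayley_conj h) - 1%:M)))).
Proof. by rewrite addrC subrK /berezin_mx -cayley_conjM. Qed.

Lemma Phi_unit g : symplectic g -> Phi g \in unitmx.
Proof. by move=> /cayley_conj_pu/pseudo_unitary_ulU. Qed.

Lemma Phi1 : Phi (1%:M : 'M[R]_(n + n)) = 1%:M.
Proof. by rewrite -[LHS]/(ulsubmx (cayley_conj _)) cayley_conj1 scalar_mx_block block_mxKul. Qed.

Lemma mxln1 : mxln (1%:M : 'M[C]_n) = 0.
Proof.
rewrite /mxln (_ : series _ = cst 0) ?lim_cst//.
apply/funext => N; rewrite /series /= big1// => k _.
by rewrite subrr expr0n scaler0.
Qed.

Lemma berezin1l g : symplectic g -> berezin 1%:M g = 0.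
Proof.
move=> /Phi_unit Ug; rewrite /berezin mul1mx Phi1 invmx1 mul1mx mulmxV//.
by rewrite mxln1 linear0.
Qed.

Lemma berezin1r g : symplectic g -> berezin g 1%:M = 0.
Proof.
move=> /Phi_unit Ug; rewrite /berezin mulmx1 Phi1 invmx1 mulmx1 mulVmx//.
by rewrite mxln1 linear0.
Qed.

Lemma ImDc (a b : C) : complex.Im (a + b) = complex.Im a + complex.Im b.
Proof. exact: raddfD. Qed.

Lemma ImBc (a b : C) : complex.Im (a - b) = complex.Im a - complex.Im b.
Proof. exact: raddfB. Qed.

Lemma geo_small (q k e : R) : 0 <= q -> q < 1 -> 0 < e ->
  \forall N \near \oo, k * q ^+ N < e.
Proof.
move=> q0 q1 e0; have : (fun N => k * q ^+ N) @ \oo --> k * 0.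
  by apply: cvgMr; apply: cvg_expr; rewrite ger0_norm.
by rewrite mulr0 => /cvgr0Pnorm_lt/(_ _ e0); apply: filterS => N; apply: le_lt_trans; exact: ler_norm.
Qed.

Lemma trln_lim g h : symplectic g -> symplectic h ->
  (fun N => complex.Im (trln N (berezin_mx (cayley_conj g) (cayley_conj h) - 1%:M)))
     @ \oo --> berezin g h.
Proof.
move=> /cayley_conj_pu sg /cayley_conj_pu sh; rewrite berezinE.
by have [r [r1 Z]] := berezin_mx_contr sg sh; exact: mxln_cvg Z r1.
Qed.

(** For each fixed N the term in K1 is removed by refining the path, that is by a choice of M
    depending on N; only then does N tend to infinity. *)
Lemma Im_lim_add (u1 u2 u3 u4 : nat -> C) (a b c d : R) (r K1 K2 : C) :
  (fun N => complex.Im (u1 N)) @ \oo --> a -> (fun N => complex.Im (u2 N)) @ \oo --> b ->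
  (fun N => complex.Im (u3 N)) @ \oo --> c -> (fun N => complex.Im (u4 N)) @ \oo --> d ->
  0 <= r -> r < 1 -> 0 <= K1 -> 0 <= K2 ->
  (forall N M, `|u1 N + u2 N - (u3 N + u4 N)| <= K1 / M.+1%:R + K2 * r ^+ N) ->
  a + b = c + d.
Proof.
move=> l1 l2 l3 l4 r0 r1 K10 K20 H.
have L := cvgB (cvgD l1 l2) (cvgD l3 l4).
apply/eqP; rewrite -subr_eq0; apply/eqP.
have fl : Filter (\oo : set_system nat) by exact: eventually_filter.
have {}L := L fl fl fl; rewrite -(cvg_lim (@norm_hausdorff _ _) L).
apply: (cvg_lim (@norm_hausdorff _ _)).
have rE := ge0_RecE r0; have K1E := ge0_RecE K10; have K2E := ge0_RecE K20.
have q0 : 0 <= complex.Re r by rewrite -lecR -rE.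
have q1 : complex.Re r < 1 by rewrite -ltcR -rE.
apply/cvgr0Pnorm_lt => e e0.
have e2 : 0 < e / 2 by rewrite divr_gt0.
have := geo_small (complex.Re K2) q0 q1 e2; apply: filterS => N KN.
have [M MK] : exists M : nat, complex.Re K1 / M.+1%:R < e / 2.
  exists (Num.truncn (complex.Re K1 / (e / 2))).
  by rewrite ltr_pdivrMr ?ltr0n// mulrC -ltr_pdivrMr// truncnS_gt.
apply: (@le_lt_trans _ _ (complex.Re K1 / M.+1%:R + complex.Re K2 * complex.Re r ^+ N)); last first.
  by rewrite (splitr e) ltrD.
have := H N M; rewrite K1E K2E rE.
have -> : (complex.Re K1)%:C%C / M.+1%:R + (complex.Re K2)%:C%C * (complex.Re r)%:C%C ^+ N =
  (complex.Re K1 / M.+1%:R + complex.Re K2 * complex.Re r ^+ N)%:C%C :> C.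
  by rewrite rmorphD !rmorphM fmorphV rmorphXn rmorph_nat.
rewrite RenormE lecR; apply: le_trans; apply: le_trans (ler_Im_norm _).
by rewrite ImBc !ImDc.
Qed.

Lemma berezin_cocycle g1 g2 g3 : symplectic g1 -> symplectic g2 -> symplectic g3 ->
  berezin g1 g2 + berezin (g1 *m g2) g3 = berezin g1 (g2 *m g3) + berezin g2 g3.
Proof.
move=> s1 s2 s3; have s12 := symplecticM s1 s2; have s23 := symplecticM s2 s3.
have [r [K1 [K2 [[r0 r1 K10 K20] H]]]] := trln_cocycle (cayley_conj_pu s1)
  (cayley_conj_pu s2) (cayley_conj_pu s3).
apply: (Im_lim_add (trln_lim s1 s2) (trln_lim s12 s3) (trln_lim s1 s23)
  (trln_lim s2 s3) r0 r1 K10 K20) => N M.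
rewrite !cayley_conjM; exact: H.
Qed.

(** The triangularisation is unitary, hence the diagonal entries inherit an operator bound below 1.
    Each eigenvalue of the bracket therefore lies in the right half-plane and contributes an
    argument of at most pi / 2. *)
Lemma berezin_bound g h : symplectic g -> symplectic h ->
  `|berezin g h| <= n%:R * (pi / 2).
Proof.
move=> sg sh; have := trln_lim sg sh.
have [r [r1 Z]] := berezin_mx_contr (cayley_conj_pu sg) (cayley_conj_pu sh).
move: (_ - 1%:M) Z => X Xr L; have r0 := opbd_ge0 Xr; have rE := ge0_RecE r0.
set q := complex.Re r in rE.
have q0 : 0 <= q by rewrite -lecR -rE.
have q1 : q < 1 by rewrite -ltcR -rE.
have B N : `|complex.Im (trln N X)| <= n%:R * (pi / 2 + q ^+ N / (1 - q)).
  (* [Schur] is stated for positive size; in size 0 every trace vanishes. *)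
  have [n0|n0] := posnP n.
    rewrite /trln big1 ?normr0 ?mulr_ge0 ?addr_ge0 ?divr_ge0 ?pi_ge0 ?exprn_ge0 ?subr_ge0 ?(ltW q1)// => k _.
    rewrite (_ : \tr _ = 0) ?mulr0// /mxtrace big1// => i _.
    by have := leq_ltn_trans (leq0n i) (ltn_ord i); rewrite [X in (_ < X)%N -> _]n0.
  have [P Pu] := Schur X n0; rewrite /similar_to /= conjumx ?unitarymx_unit//.
  rewrite invmx_unitary// => Tt; set T := P *m X *m P^t* in Tt.
  have PP := unitarymxP Pu.
  have PP' : P^t* *m P = 1%:M by exact: mulmx1C.
  have Tr : opbd T r.
    have Pu1 (Q : 'M[C]_n) : Q \is unitarymx -> opbd Q 1.
      move=> /unitarymxP QQ; apply: opbd_sqr => // u.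
      by rewrite dotmx_mul2 QQ mulmx1 expr1n mul1r dotmxE.
    rewrite -[r]mulr1 -[r]mul1r; apply: opbdM; first by apply: opbdM => //; exact: Pu1.
    by apply: Pu1; apply/unitarymxP; rewrite trmxCK.
  have trE k : \tr (X ^+ k) = \sum_i T i i ^+ k.
    have -> : X ^+ k = P^t* *m T ^+ k *m P.
      elim: k => [|k IH]; first by rewrite !expr0 -[1]/(1%:M) mulmx1.
      rewrite !exprS IH -[X * _]/(X *m _) -[T * _]/(T *m _) /T !mulmxA PP' mul1mx.
      by rewrite -!mulmxA.
    rewrite -mulmxA mxtrace_mulC -mulmxA PP mulmx1.
    by apply: eq_bigr => i _; case: (trig_exp k Tt).
  have -> : trln N X = \sum_i \sum_(k < N) (-1) ^+ k / k.+1%:R * T i i ^+ k.+1.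
    by rewrite exchange_big; apply: eq_bigr => k _; rewrite trE mulr_sumr.
  rewrite raddf_sum /=; apply: le_trans (ler_norm_sum _ _ _) _.
  rewrite -[n in n%:R]card_ord mulr_natl -sumr_const; apply: ler_sum => i _.
  by apply: Im_log_bound => //; rewrite -rE; exact: opbd_entry.
have LB : (fun N => n%:R * (pi / 2 + q ^+ N / (1 - q))) @ \oo --> n%:R * (pi / 2 + 0 / (1 - q)).
  apply: cvgMr; apply: cvgD; first exact: cvg_cst.
  by apply: cvgMl; apply: cvg_expr; rewrite ger0_norm.
rewrite mul0r addr0 in LB.
apply: (ler_cvg_to (cvg_norm L) LB); exact: nearW.
Qed.

End berezin_theory.

Local Close Scope sesquilinear_scope.

(** * Measurability of c along measurable families of matrices *)

Section complex_measurability.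
Context {R : realType} {d : measure_display} {T : measurableType d} (D : set T).
Local Notation C := R[i].

Definition cmeasurable (f : T -> C) : Prop :=
  measurable_fun D (fun x => complex.Re (f x)) /\
  measurable_fun D (fun x => complex.Im (f x)).

Definition mxmeasurable m n (A : T -> 'M[C]_(m, n)) : Prop :=
  forall i j, cmeasurable (fun x => A x i j).

Lemma eq_cmeasurable f g : (forall x, D x -> f x = g x) -> cmeasurable f -> cmeasurable g.
Proof.
move=> fg [f1 f2]; split.
  by apply: eq_measurable_fun f1 => x; rewrite inE => /fg ->.
by apply: eq_measurable_fun f2 => x; rewrite inE => /fg ->.
Qed.

Lemma cmeasurable_cst c : cmeasurable (cst c).
Proof. by split; exact: measurable_cst. Qed.

Lemma cmeasurable_real (f : T -> R) : measurable_fun D f ->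
  cmeasurable (fun x => (f x)%:C%C).
Proof. by move=> mf; split=> //; exact: measurable_cst. Qed.

Lemma cmeasurableD f g : cmeasurable f -> cmeasurable g ->
  cmeasurable (fun x => f x + g x).
Proof.
move=> [f1 f2] [g1 g2]; split.
  by apply: eq_measurable_fun (measurable_funD f1 g1) => x _ /=; rewrite raddfD.
by apply: eq_measurable_fun (measurable_funD f2 g2) => x _ /=; rewrite raddfD.
Qed.

Lemma cmeasurableM f g : cmeasurable f -> cmeasurable g ->
  cmeasurable (fun x => f x * g x).
Proof.
move=> [f1 f2] [g1 g2]; split.
  apply: eq_measurable_fun (measurable_funB (measurable_funM f1 g1) (measurable_funM f2 g2)).
  by move=> x _ /=; case: (f x) (g x) => a b [].
apply: eq_measurable_fun (measurable_funD (measurable_funM f1 g2) (measurable_funM f2 g1)).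
by move=> x _ /=; case: (f x) (g x) => a b [].
Qed.

Lemma cmeasurableV f : cmeasurable f -> cmeasurable (fun x => (f x)^-1).
Proof.
move=> [f1 f2].
have m : measurable_fun D (fun x => (complex.Re (f x) ^+ 2 + complex.Im (f x) ^+ 2)^-1).
  have h := measurable_funD (measurable_funX 2 f1) (measurable_funX 2 f2).
  have h' := measurableT_comp (@measurable_powR R (-1)) h.
  apply: eq_measurable_fun h'.
  by move=> x _ /=; rewrite powR_inv1// addr_ge0 ?sqr_ge0.
split.
  apply: eq_measurable_fun (measurable_funM f1 m) => x _ /=.
  by case: (f x) => a b.
apply: eq_measurable_fun (measurable_funM (measurable_funN f2) m) => x _ /=.
by case: (f x) => a b /=; rewrite mulNr.
Qed.

Lemma cmeasurable_sum (I : Type) (s : seq I) (P : pred I) (f : I -> T -> C) :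
  (forall i, cmeasurable (f i)) -> cmeasurable (fun x => \sum_(i <- s | P i) f i x).
Proof.
move=> mf; elim: s => [|i s IH].
  by apply: eq_cmeasurable (cmeasurable_cst 0) => x _; rewrite big_nil.
apply: (@eq_cmeasurable (fun x => (if P i then f i x else 0) + \sum_(i <- s | P i) f i x)).
  by move=> x _; rewrite big_cons; case: ifP => // _; rewrite add0r.
by apply: cmeasurableD => //; case: (P i); [exact: mf|exact: cmeasurable_cst].
Qed.

Lemma cmeasurable_prod (I : Type) (s : seq I) (P : pred I) (f : I -> T -> C) :
  (forall i, cmeasurable (f i)) -> cmeasurable (fun x => \prod_(i <- s | P i) f i x).
Proof.
move=> mf; elim: s => [|i s IH].
  by apply: eq_cmeasurable (cmeasurable_cst 1) => x _; rewrite big_nil.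
apply: (@eq_cmeasurable (fun x => (if P i then f i x else 1) * \prod_(i <- s | P i) f i x)).
  by move=> x _; rewrite big_cons; case: ifP => // _; rewrite mul1r.
by apply: cmeasurableM => //; case: (P i); [exact: mf|exact: cmeasurable_cst].
Qed.

Lemma mxmeasurable_cst m n (A : 'M[C]_(m, n)) : mxmeasurable (cst A).
Proof. by move=> i j; exact: cmeasurable_cst. Qed.

Lemma mxmeasurableM m n p (A : T -> 'M[C]_(m, n)) (B : T -> 'M[C]_(n, p)) :
  mxmeasurable A -> mxmeasurable B -> mxmeasurable (fun x => A x *m B x).
Proof.
move=> mA mB i j; apply: (@eq_cmeasurable (fun x => \sum_k A x i k * B x k j)).
  by move=> x _; rewrite mxE.
by apply: cmeasurable_sum => k; exact: cmeasurableM.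
Qed.

Lemma mxmeasurableX n (A : T -> 'M[C]_n) k :
  mxmeasurable A -> mxmeasurable (fun x => A x ^+ k).
Proof.
move=> mA; elim: k => [|k IH]; first exact: (mxmeasurable_cst (1 : 'M[C]_n)).
move=> i j; apply: eq_cmeasurable (mxmeasurableM mA IH i j) => x _.
by rewrite exprS.
Qed.

Lemma cmeasurable_det n (A : T -> 'M[C]_n) :
  mxmeasurable A -> cmeasurable (fun x => \det (A x)).
Proof.
move=> mA; apply: cmeasurable_sum => s; apply: cmeasurableM; first exact: cmeasurable_cst.
by apply: cmeasurable_prod => i; exact: mA.
Qed.

Lemma mxmeasurableV n (A : T -> 'M[C]_n) : (forall x, D x -> A x \in unitmx) ->
  mxmeasurable A -> mxmeasurable (fun x => invmx (A x)).
Proof.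
move=> UA mA i j.
apply: (@eq_cmeasurable (fun x => (\det (A x))^-1 * ((-1) ^+ (j + i) * \det (row' j (col' i (A x)))))).
  by move=> x /UA Ux; rewrite /invmx Ux !mxE.
apply: cmeasurableM; first exact/cmeasurableV/cmeasurable_det.
apply: cmeasurableM; first exact: cmeasurable_cst.
apply: cmeasurable_det => k l; apply: eq_cmeasurable (mA (lift j k) (lift i l)).
by move=> x _; rewrite !mxE.
Qed.

Lemma mxmeasurable_Phi n (g : T -> 'M[R]_(n + n)) :
  (forall i j, measurable_fun D (fun x => g x i j)) ->
  mxmeasurable (fun x => Phi (g x)).
Proof.
move=> mg i j.
have : mxmeasurable (fun x => invmx cayley_mx *m map_mx (real_complex R) (g x) *m cayley_mx).
  apply: mxmeasurableM (mxmeasurable_cst _); apply: mxmeasurableM (mxmeasurable_cst _) _.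
  move=> k l; apply: eq_cmeasurable (cmeasurable_real (mg k l)) => x _.
  by rewrite mxE.
move=> /(_ (lshift n i) (lshift n j)); apply: eq_cmeasurable => x _.
by rewrite /Phi !mxE.
Qed.

(** The truncations are polynomial in the entries of Z, whose inverses are measurable by Cramer's
    rule, and c is their pointwise limit. *)
Lemma measurable_berezin n (g h : T -> 'M[R]_(n + n)) :
  (forall x, D x -> symplectic (g x)) -> (forall x, D x -> symplectic (h x)) ->
  (forall i j, measurable_fun D (fun x => g x i j)) ->
  (forall i j, measurable_fun D (fun x => h x i j)) ->
  measurable_fun D (fun x => berezin (g x) (h x)).
Proof.
move=> sg sh mg mh.
pose Z x : 'M[C]_n := invmx (Phi (g x)) *m Phi (g x *m h x) *m invmx (Phi (h x)) - 1%:M.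
have mgh i j : measurable_fun D (fun x => (g x *m h x) i j).
  have : measurable_fun D (fun x => \sum_k g x i k * h x k j).
    by apply: measurable_sum => k; exact: measurable_funM.
  by apply: eq_measurable_fun => x _; rewrite mxE.
have mZ : mxmeasurable Z.
  move=> i j; apply: (@eq_cmeasurable (fun x => (invmx (Phi (g x)) *m Phi (g x *m h x) *m
      invmx (Phi (h x))) i j + (- 1%:M : 'M[C]_n) i j)); first by move=> x _; rewrite [in RHS]mxE.
  apply: cmeasurableD; last exact: cmeasurable_cst.
  apply: mxmeasurableM; first apply: mxmeasurableM.
  - by apply: mxmeasurableV; [move=> x /sg/Phi_unit|exact: mxmeasurable_Phi].
  - exact: mxmeasurable_Phi.
  - by apply: mxmeasurableV; [move=> x /sh/Phi_unit|exact: mxmeasurable_Phi].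
apply: (@measurable_fun_cvg _ _ _ _ (fun N x => complex.Im (trln N (Z x)))) => [N|x Dx].
  suff [] : cmeasurable (fun x => trln N (Z x)) by [].
  apply: cmeasurable_sum => k; apply: cmeasurableM; first exact: cmeasurable_cst.
  by apply: cmeasurable_sum => i; exact: mxmeasurableX.
have := trln_lim (sg _ Dx) (sh _ Dx); apply: cvg_trans.
by rewrite /berezin_mx -cayley_conjM.
Qed.

End complex_measurability.

(** * Differential calculus *)

Section first_order.
Context {R : realType}.

Lemma ler_mxnorm m n (A : 'M[R]_(m, n)) (e : R) : 0 <= e ->
  (forall i j, `|A i j| <= e) -> `|A| <= e.
Proof.
move=> e0 Ae; rewrite -[`|A|]/(mx_norm A) mx_normrE.
by apply: bigmax_le => // -[i j] _; exact: Ae.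
Qed.

Lemma ler_entry_mxnorm m n (A : 'M[R]_(m, n)) i j : `|A i j| <= `|A|.
Proof.
rewrite -[`|A|]/(mx_norm A) mx_normrE.
by exact: (le_bigmax _ (fun ij => `|A ij.1 ij.2|) (i, j)).
Qed.

Lemma mulmx_bound m n (A : 'M[R]_(m, n)) : exists2 K : R, 0 < K &
  forall v : 'rV_m, `|v *m A| <= K * `|v|.
Proof.
pose K := m%:R * `|A| + 1.
have K0 : 0 < K by rewrite ltr_wpDl// mulr_ge0.
exists K => // v; apply: ler_mxnorm => [|i j]; first by rewrite mulr_ge0// ltW.
rewrite mxE; apply: le_trans (ler_norm_sum _ _ _) _.
apply: le_trans (_ : _ <= \sum_(k < m) `|v| * `|A|) _.
  by apply: ler_sum => k _; rewrite normrM ler_pM// ler_entry_mxnorm.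
by rewrite sumr_const card_ord -mulr_natl /K mulrDl mul1r (mulrC `|v|) mulrA lerDl.
Qed.

(** Differentiability at x in epsilon form. Vectors are rows and A acts on the right, so A is the
    transpose of the usual Jacobi matrix. *)
Definition approx m n (f : 'rV[R]_m -> 'rV[R]_n) (x : 'rV[R]_m) (A : 'M[R]_(m, n)) : Prop :=
  forall e : R, 0 < e -> \forall z \near x, `|f z - f x - (z - x) *m A| <= e * `|z - x|.

Lemma approx_locally m n (f : 'rV[R]_m -> 'rV[R]_n) (x : 'rV[R]_m) A :
  approx f x A <-> f \o shift x = cst (f x) + (mulmxr A : 'rV[R]_m -> 'rV[R]_n) +o_ (0 : 'rV[R]_m) id.
Proof.
split=> [fA|/eqaddoP fA e /fA].
  apply/eqaddoP => e /fA; rewrite (near_shift 0) /= subr0; apply: filterS => z /=.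
  by rewrite addrK -addrA -opprD.
rewrite [X in _ -> X](near_shift 0) /= subr0; apply: filterS => z /=.
by rewrite addrK fctE /= opprD addrA.
Qed.

Lemma mulmxr_continuous m n (A : 'M[R]_(m, n)) :
  continuous (mulmxr A : 'rV[R]_m -> 'rV[R]_n).
Proof.
have [K K0 KA] := mulmx_bound A.
apply: (@bounded_linear_continuous _ _ _ (mulmxr A : {linear 'rV[R]_m -> 'rV[R]_n})).
apply/linear_boundedP; near=> r => x; apply: le_trans (KA x) _.
by apply: ler_wpM2r => //; near: r; apply: nbhs_pinfty_ge; exact: num_real.
Unshelve. all: by end_near. Qed.

Lemma approxP m n (f : 'rV[R]_m -> 'rV[R]_n) (x : 'rV[R]_m) A :
  approx f x A <-> differentiable f x /\ 'J f x = A.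
Proof.
split=> [/approx_locally fA|[df <-]].
  pose L : {linear 'rV[R]_m -> 'rV[R]_n} := mulmxr A.
  have Lc : continuous L by exact: mulmxr_continuous.
  have dL := diff_unique Lc fA.
  split; first by apply/diff_locallyP; rewrite dL.
  by apply/row_matrixP => i; rewrite !rowE mul_rV_lin1 /= dL.
apply/approx_locally; rewrite (_ : (mulmxr _ : _ -> _) = 'd f x); first exact: diff_locally.
by apply/funext => u /=; rewrite mul_rV_lin1.
Qed.

Lemma approx_jacobian m n (f : 'rV[R]_m -> 'rV[R]_n) (x : 'rV[R]_m) A : approx f x A -> 'J f x = A.
Proof. by move=> /approxP[]. Qed.

Lemma approx_near m n (f g : 'rV[R]_m -> 'rV[R]_n) (x : 'rV[R]_m) A :
  (\near x, f x = g x) -> approx f x A -> approx g x A.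
Proof.
move=> fg fA e e0; have fgx : f x = g x by exact: (@nbhs_singleton _ x (fun y => f y = g y) fg).
near=> z; rewrite -fgx -(near fg z)//; near: z; exact: fA.
Unshelve. all: by end_near. Qed.

Lemma approx_id m (x : 'rV[R]_m) : approx (id : 'rV[R]_m -> 'rV[R]_m) x 1%:M.
Proof.
move=> e e0; near=> z; rewrite mulmx1 subrr normr0 mulr_ge0// ltW//.
Unshelve. all: by end_near.
Qed.

Lemma approx_comp m n p (f : 'rV[R]_m -> 'rV[R]_n) (g : 'rV[R]_n -> 'rV[R]_p) (x : 'rV[R]_m) A B :
  approx f x A -> approx g (f x) B -> approx (g \o f) x (A *m B).
Proof.
move=> /approxP[df <-] /approxP[dg <-]; apply/approxP; split.
  exact: differentiable_comp.
apply/row_matrixP => i; rewrite !rowE mul_rV_lin1 /= diff_comp//= mulmxA.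
by rewrite mul_rV_lin1 /= mul_rV_lin1.
Qed.

Lemma approx_continuous m n (f : 'rV[R]_m -> 'rV[R]_n) (x : 'rV[R]_m) A :
  approx f x A -> {for x, continuous f}.
Proof. by move=> /approxP[/differentiable_continuous]. Qed.

Lemma approx_derivable m n (f : 'rV[R]_m -> 'rV[R]_n) (x : 'rV[R]_m) A v :
  approx f x A -> derivable f x v /\ 'D_v f x = v *m A.
Proof.
move=> /approxP[df <-]; split; first exact: diff_derivable.
exact: deriveEjacobian.
Qed.

(** Strict differentiability: both points vary near x. This makes f minus its linear part a map with
    small Lipschitz constant, as the fixed point argument for local inverses demands, and it is
    stable under composition. *)
Definition strict_approx m n (f : 'rV[R]_m -> 'rV[R]_n) (x : 'rV[R]_m) (A : 'M[R]_(m, n)) : Prop :=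
  forall e : R, 0 < e -> exists2 d : R, 0 < d & forall y z, ball x d y -> ball x d z ->
    `|f z - f y - (z - y) *m A| <= e * `|z - y|.

Lemma strict_approxW m n (f : 'rV[R]_m -> 'rV[R]_n) (x : 'rV[R]_m) A :
  strict_approx f x A -> approx f x A.
Proof.
move=> fA e /fA[d d0 H]; apply/nbhs_ballP; exists d => // z xz.
by apply: H => //; exact: ballxx.
Qed.

Lemma mvt_line m (f : 'rV[R]_m -> R) (y v : 'rV[R]_m) (h : R) :
  (forall t, 0 <= t <= 1 -> derivable f (y + (t * h) *: v) v) ->
  exists2 t, 0 <= t <= 1 & f (y + h *: v) - f y = h * 'D_v f (y + (t * h) *: v).
Proof.
move=> df; pose g (s : R) := f (y + s *: v).
have gd (t : R) : 0 <= t <= 1 -> is_derive (t * h) 1 g ('D_v f (y + (t * h) *: v)).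
  move=> /df ft; have H : (fun k : R => k^-1 *: (g (k *: 1 + t * h) - g (t * h))) =
      (fun k : R => k^-1 *: (f (k *: v + (y + (t * h) *: v)) - f (y + (t * h) *: v))).
    by apply/funext => k; rewrite /g -[k *: 1]/(k * 1) mulr1 scalerDl addrCA.
  by apply: DeriveDef; rewrite /derivable /derive H.
have [h0|h0|h0] := ltgtP 0 h; last first.
- exists 0; rewrite ?lexx ?ler01// -h0 !scale0r addr0 subrr mul0r//.
- have gd' (s : R) : h <= s <= 0 -> is_derive s 1 g ('D_v f (y + s *: v)).
    move=> /andP[s1 s2]; rewrite -(divfK (ltr0_neq0 h0) s); apply: gd.
    by rewrite ler_ndivlMr// mul0r s2 ler_ndivrMr// mul1r.
  have [||s] := @MVT_segment _ g (fun s => 'D_v f (y + s *: v)) _ _ (ltW h0).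
  + by move=> s; rewrite in_itv /= => /andP[s1 s2]; apply: gd'; rewrite !ltW.
  + by apply: derivable_within_continuous => s; rewrite in_itv /= => /gd'[].
  rewrite in_itv /= sub0r => /andP[s1 s2] gE; exists (s / h).
    by rewrite ler_ndivlMr// mul0r s2 ler_ndivrMr// mul1r.
  rewrite divfK ?ltr0_neq0//; move: gE; rewrite {1 2}/g scale0r addr0.
  by move/(congr1 -%R); rewrite opprB mulrN opprK mulrC.
- have gd' (s : R) : 0 <= s <= h -> is_derive s 1 g ('D_v f (y + s *: v)).
    move=> /andP[s1 s2]; rewrite -(divfK (lt0r_neq0 h0) s); apply: gd.
    by rewrite ler_pdivlMr// mul0r s1 ler_pdivrMr// mul1r.
  have [||s] := @MVT_segment _ g (fun s => 'D_v f (y + s *: v)) _ _ (ltW h0).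
  + by move=> s; rewrite in_itv /= => /andP[s1 s2]; apply: gd'; rewrite !ltW.
  + by apply: derivable_within_continuous => s; rewrite in_itv /= => /gd'[].
  rewrite in_itv /= subr0 => /andP[s1 s2] gE; exists (s / h).
    by rewrite ler_pdivlMr// mul0r s1 ler_pdivrMr// mul1r.
  rewrite divfK ?gt_eqF//; move: gE; rewrite {1 2}/g scale0r addr0.
  by rewrite mulrC.
Qed.

Lemma ball_segment (x y z t d : R) : 0 <= t -> t <= 1 ->
  ball x d y -> ball x d z -> ball x d (y + t * (z - y)).
Proof.
move=> t0 t1; rewrite /ball /= !ltr_norml => /andP[y1 y2] /andP[z1 z2].
have pos (a b : R) : 0 < a -> 0 < b -> 0 < (1 - t) * a + t * b.
  move=> a0 b0; have [->|tn0] := eqVneq t 0; first by rewrite subr0 mul1r mul0r addr0.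
  rewrite ltr_wpDl// ?mulr_ge0 ?subr_ge0// ?(ltW a0)// mulr_gt0// lt_neqAle eq_sym tn0.
  by [].
apply/andP; split; rewrite -subr_gt0.
  have -> : x - (y + t * (z - y)) - - d = (1 - t) * (d + (x - y)) + t * (d + (x - z)).
    by ring.
  by apply: pos; lra.
have -> : d - (x - (y + t * (z - y))) = (1 - t) * (d - (x - y)) + t * (d - (x - z)).
  by ring.
by apply: pos; lra.
Qed.

(** From y to z the coordinates are changed one at a time, and the mean value theorem is applied on
    each edge; continuity of the partial derivatives at x replaces the intermediate values by those
    at x. *)
Lemma strict_diff_scalar m (U : set 'rV[R]_m) (f : 'rV[R]_m -> R) (x : 'rV[R]_m) :
  open U -> U x ->
  (forall y i, U y -> derivable f y (delta_mx 0 i)) ->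
  (forall i, {for x, continuous (fun y => 'D_(delta_mx 0 i) f y)}) ->
  forall e : R, 0 < e -> exists2 d : R, 0 < d & forall y z, ball x d y -> ball x d z ->
    `|f z - f y - \sum_i (z - y) 0 i * 'D_(delta_mx 0 i) f x| <= e * `|z - y|.
Proof.
move=> oU Ux df cf e e0.
(* The path has m edges; the divisor m + 1 is nonzero in dimension 0 as well. *)
pose e' := e / m.+1%:R; have e'0 : 0 < e' by rewrite divr_gt0.
have : \forall y \near x, U y /\ forall i : 'I_m,
    `|'D_(delta_mx 0 i) f y - 'D_(delta_mx 0 i) f x| <= e'.
  have nU : \forall y \near x, U y by exact: open_nbhs_nbhs.
  have nD : \forall y \near x, forall i : 'I_m,
      `|'D_(delta_mx 0 i) f y - 'D_(delta_mx 0 i) f x| <= e'.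
    apply: (@filter_forall _ _ (fun i y => `|'D_(delta_mx 0 i) f y - 'D_(delta_mx 0 i) f x| <= e') (nbhs x)) => i; have /cvgrPdist_le := cf i.
    move=> /(_ _ e'0); rewrite near_simpl; apply: filterS => y.
    by rewrite distrC.
  by near=> y; split; near: y.
move=> /nbhs_ballP[d /= d0 dU]; exists d => // y z xy xz.
(* The first k coordinates are those of z, the others those of y. Balls are taken in the maximum
   norm, so the whole path stays inside the ball. *)
pose p (k : nat) : 'rV[R]_m := \row_(j < m) (if (j < k)%N then z 0 j else y 0 j).
have pb (k : 'I_m) (t : R) : 0 <= t <= 1 ->
    ball x d (p k + (t * (z - y) 0 k) *: delta_mx 0 k).
  move=> /andP[t0 t1]; split=> // i j; rewrite ord1 !mxE /=.
  have [_ xyj] := xy; have [_ xzj] := xz.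
  have [->|jk] := eqVneq j k; last first.
    by rewrite mulr0 addr0; case: ifP => _; [exact: xzj|exact: xyj].
  by rewrite ltnn mulr1; apply: ball_segment.
have pS (k : 'I_m) : p k.+1 = p k + (z - y) 0 k *: delta_mx 0 k.
  apply/rowP => j; rewrite !mxE eqxx /= ltnS.
  have [->|jk] := eqVneq j k; first by rewrite leqnn ltnn mulr1 addrC subrK.
  by rewrite mulr0 addr0 leq_eqVlt val_eqE (negPf jk).
have p0 : p 0%N = y by apply/rowP => j; rewrite mxE.
have pm : p m = z by apply/rowP => j; rewrite mxE ltn_ord.
have fS (k : 'I_m) : `|f (p k.+1) - f (p k) - (z - y) 0 k * 'D_(delta_mx 0 k) f x|
    <= e' * `|z - y|.
  have [t t01 tE] := @mvt_line _ f (p k) (delta_mx 0 k) ((z - y) 0 k)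
    (fun t t01 => df _ k (dU _ (pb k t t01)).1).
  rewrite pS tE -mulrBr normrM mulrC ler_pM//; last exact: ler_entry_mxnorm.
  by have [_] := dU _ (pb k t t01); exact.
have -> : f z - f y - \sum_i (z - y) 0 i * 'D_(delta_mx 0 i) f x =
    \sum_(k < m) (f (p k.+1) - f (p k) - (z - y) 0 k * 'D_(delta_mx 0 k) f x).
  rewrite [RHS]sumrB; congr (_ - _).
  by rewrite -(big_mkord predT (fun k => f (p k.+1) - f (p k))) telescope_sumr// pm p0.
apply: le_trans (ler_norm_sum _ _ _) _.
apply: le_trans (ler_sum _ (fun k _ => fS k)) _.
rewrite sumr_const card_ord -mulr_natl mulrA ler_wpM2r// /e' mulrCA ler_piMr ?(ltW e0)//.
by rewrite ler_pdivrMr ?ltr0n// mul1r ler_nat.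
Unshelve. all: by end_near. Qed.

End first_order.

(** * Calculus of smooth functions *)

Section smooth_calculus.
Context {R : realType}.

Lemma open_nearP (T : topologicalType) (U : set T) (x : T) (P : T -> Prop) :
  open U -> U x -> (forall y, U y -> P y) -> \forall y \near x, P y.
Proof. by move=> oU Ux UP; apply: filterS UP _; exact: open_nbhs_nbhs. Qed.

(** A bound on the length of the words of derivatives, which makes induction on the order possible.
    Order 0 already contains the existence of the first partial derivatives. *)
Definition smooth_upto m (N : nat) (U : set 'rV[R]_m) (f : 'rV[R]_m -> R) : Prop :=
  forall s : seq 'I_m, (size s <= N)%N -> forall x, U x ->
    {for x, continuous (iter_partial s f)} /\
    forall i, derivable (iter_partial s f) x (delta_mx 0 i).

Lemma smooth_funP m (U : set 'rV[R]_m) f : smooth_fun U f <-> forall N, smooth_upto N U f.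
Proof. by split=> [sf N s _|sf s]; [exact: sf|exact: (sf (size s))]. Qed.

Definition partial m (i : 'I_m) (f : 'rV[R]_m -> R) : 'rV[R]_m -> R :=
  fun x => 'D_(delta_mx 0 i) f x.

(** The last letter of a word is the derivative taken first, so words are peeled from the right. *)
Lemma smooth_uptoS m N (U : set 'rV[R]_m) f :
  smooth_upto N.+1 U f <-> smooth_upto 0 U f /\ forall i, smooth_upto N U (partial i f).
Proof.
have E s i : iter_partial s (partial i f) = iter_partial (rcons s i) f.
  by rewrite /iter_partial foldr_rcons.
split=> [sf|[s0 sS] s].
  split=> [[|]// _|i s sN]; first exact: (sf [::]).
  by rewrite E; apply: sf; rewrite size_rcons.
case/lastP: s => [_|s i]; first exact: (s0 [::]).
by rewrite size_rcons ltnS -E; exact: sS.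
Qed.

Lemma smooth_uptoW m N (U : set 'rV[R]_m) f : smooth_upto N.+1 U f -> smooth_upto N U f.
Proof. by move=> sf s sN; apply: sf; exact: leqW. Qed.

Lemma smooth_upto0 m N (U : set 'rV[R]_m) f : smooth_upto N U f -> smooth_upto 0 U f.
Proof. by move=> sf s; rewrite leqn0 => /nilP ->; exact: (sf [::]). Qed.

Lemma smooth_upto0P m (U : set 'rV[R]_m) f : smooth_upto 0 U f <->
  forall x, U x -> {for x, continuous f} /\ forall i, derivable f x (delta_mx 0 i).
Proof. by split=> [sf|sf [|]//]; exact: (sf [::]). Qed.

Lemma smooth_fun_partial m (U : set 'rV[R]_m) f i :
  smooth_fun U f -> smooth_fun U (partial i f).
Proof.
by move=> /smooth_funP sf; apply/smooth_funP => N; exact: ((smooth_uptoS _ _ _).1 (sf N.+1)).2.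
Qed.

Lemma smooth_fun_sub m (U V : set 'rV[R]_m) f :
  V `<=` U -> smooth_fun U f -> smooth_fun V f.
Proof. by move=> VU sf s x /VU; exact: sf. Qed.

Lemma eq_smooth_upto m N (U : set 'rV[R]_m) f g : open U ->
  (forall x, U x -> f x = g x) -> smooth_upto N U f -> smooth_upto N U g.
Proof.
move=> oU; elim: N f g => [|N IH] f g fg.
  move=> /smooth_upto0P sf; apply/smooth_upto0P => x Ux; have [cf df] := sf _ Ux.
  have nfg : \forall y \near x, f y = g y by exact: open_nearP fg.
  split=> [|i]; last exact: near_eq_derivable (df i).
  by rewrite /prop_for /continuous_at -(fg _ Ux); exact: (cvg_trans (near_eq_cvg nfg) cf).
move=> /smooth_uptoS[s0 sS]; apply/smooth_uptoS; split=> [|i].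
  by apply: smooth_upto0; apply: (IH f) => //; apply: smooth_uptoW; apply/smooth_uptoS; split=> //.
apply: IH (sS i) => x Ux; apply: near_eq_derive; exact: open_nearP fg.
Qed.

Lemma smooth_upto_cst m N (U : set 'rV[R]_m) (c : R) : open U -> smooth_upto N U (cst c).
Proof.
move=> oU; elim: N c => [|N IH] c.
  by apply/smooth_upto0P => x Ux; split=> [|i]; [exact: cst_continuous|exact: derivable_cst].
apply/smooth_uptoS; split=> [|i]; first exact: smooth_upto0 (IH c).
by apply: eq_smooth_upto (IH 0) => // x Ux; rewrite /partial derive_cst.
Qed.

Lemma smooth_uptoD m N (U : set 'rV[R]_m) f g : open U ->
  smooth_upto N U f -> smooth_upto N U g -> smooth_upto N U (fun x => f x + g x).
Proof.
move=> oU; elim: N f g => [|N IH] f g.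
  move=> /smooth_upto0P sf /smooth_upto0P sg; apply/smooth_upto0P => x Ux.
  have [cf df] := sf _ Ux; have [cg dg] := sg _ Ux.
  by split=> [|i]; [exact: continuousD|exact: derivableD].
move=> sf sg; have /smooth_uptoS[sf0 sfS] := sf; have /smooth_uptoS[sg0 sgS] := sg.
apply/smooth_uptoS; split=> [|i].
  by apply: smooth_upto0; apply: IH; exact: smooth_uptoW.
apply: eq_smooth_upto (IH _ _ (sfS i) (sgS i)) => // x Ux.
by rewrite /partial deriveD//; [exact: ((sf [::] isT x Ux).2 i)|exact: ((sg [::] isT x Ux).2 i)].
Qed.

Lemma smooth_uptoM m N (U : set 'rV[R]_m) f g : open U ->
  smooth_upto N U f -> smooth_upto N U g -> smooth_upto N U (fun x => f x * g x).
Proof.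
move=> oU; elim: N f g => [|N IH] f g.
  move=> /smooth_upto0P sf /smooth_upto0P sg; apply/smooth_upto0P => x Ux.
  have [cf df] := sf _ Ux; have [cg dg] := sg _ Ux.
  by split=> [|i]; [exact: continuousM|exact: derivableM].
move=> sf sg; have /smooth_uptoS[sf0 sfS] := sf; have /smooth_uptoS[sg0 sgS] := sg.
apply/smooth_uptoS; split=> [|i].
  by apply: smooth_upto0; apply: IH; exact: smooth_uptoW.
apply: eq_smooth_upto (smooth_uptoD oU (IH _ _ (smooth_uptoW sf) (sgS i))
  (IH _ _ (smooth_uptoW sg) (sfS i))) => // x Ux.
by rewrite /partial deriveM//; [exact: ((sf [::] isT x Ux).2 i)|exact: ((sg [::] isT x Ux).2 i)].
Qed.

Lemma smooth_upto_sum m N (U : set 'rV[R]_m) (I : Type) (r : seq I)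
    (f : I -> 'rV[R]_m -> R) : open U ->
  (forall i, smooth_upto N U (f i)) -> smooth_upto N U (fun x => \sum_(i <- r) f i x).
Proof.
move=> oU sf; elim: r => [|i r IH].
  have h := @smooth_upto_cst m N U 0 oU.
  by apply: (eq_smooth_upto oU _ h) => x Ux; rewrite big_nil.
by apply: (eq_smooth_upto oU _ (smooth_uptoD oU (sf i) IH)) => x Ux; rewrite big_cons.
Qed.

Definition jac_mx m k (f : 'rV[R]_m -> 'rV[R]_k) (x : 'rV[R]_m) : 'M[R]_(m, k) :=
  \matrix_(i, j) partial i (fun y => f y 0 j) x.

Lemma smooth_map_strict m k (U : set 'rV[R]_m) (f : 'rV[R]_m -> 'rV[R]_k) x :
  open U -> U x -> smooth_map U f -> strict_approx f x (jac_mx f x).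
Proof.
move=> oU Ux sf e e0.
have H (j : 'I_k) : exists d : R, 0 < d /\ forall y z, ball x d y -> ball x d z ->
    `|f z 0 j - f y 0 j - \sum_i (z - y) 0 i * partial i (fun y => f y 0 j) x|
      <= e * `|z - y|.
  have [||d d0 Hd] := @strict_diff_scalar _ _ U (fun y => f y 0 j) x oU Ux _ _ _ e0.
  - by move=> y i Uy; exact: (sf j [::] y Uy).2.
  - by move=> i; exact: (sf j [:: i] x Ux).1.
  by exists d.
have [d Hd] := choice H; pose d' := \big[Num.min/1]_j d j.
exists d'; first by rewrite lt_bigmin// => j _; exact: (Hd j).1.
move=> y z xy xz; apply: ler_mxnorm => [|i j]; first by rewrite mulr_ge0// ltW.
have le j' : d' <= d j' by exact: bigmin_le_cond.
have := (Hd j).2 y z (le_ball (le j) xy) (le_ball (le j) xz).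
congr (`|_| <= _); rewrite ord1 mxE [(f z - _) 0 j]mxE [(- f y) 0 j]mxE; congr (_ + _).
rewrite mxE mxE; congr (- _); apply: eq_bigr => l _; congr (_ * _).
by rewrite [RHS]mxE.
Qed.

Lemma smooth_map_approx m k (U : set 'rV[R]_m) (f : 'rV[R]_m -> 'rV[R]_k) x :
  open U -> U x -> smooth_map U f -> approx f x (jac_mx f x).
Proof. by move=> oU Ux sf; apply: strict_approxW; exact: smooth_map_strict sf. Qed.

Lemma partial_comp m k (U : set 'rV[R]_m) (V : set 'rV[R]_k)
    (f : 'rV[R]_k -> R) (g : 'rV[R]_m -> 'rV[R]_k) x i :
  open U -> open V -> (forall x, U x -> V (g x)) ->
  smooth_map U g -> smooth_fun V f -> U x ->
  derivable (f \o g) x (delta_mx 0 i) /\ partial i (f \o g) x =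
  \sum_j partial j f (g x) * partial i (fun y => g y 0 j) x.
Proof.
move=> oU oV UV sg sf Ux.
pose F : 'rV[R]_k -> 'rV[R]_1 := fun y => \row__ f y.
have sF : smooth_map V F.
  move=> j; rewrite (_ : (fun x => _) = f)//; by apply/funext => y; rewrite mxE.
have aF := smooth_map_approx oV (UV _ Ux) sF.
have ag := smooth_map_approx oU Ux sg.
have [d E] := approx_derivable (delta_mx 0 i) (approx_comp ag aF).
have fE : f \o g = fun y => (F \o g) y 0 0 by apply/funext => y; rewrite /= mxE.
have dfE : derivable (f \o g) x (delta_mx 0 i) /\
    'D_(delta_mx 0 i) (f \o g) x = ('D_(delta_mx 0 i) (F \o g) x) 0 0.
  have fg := cvg_comp _ _ d (@coord_continuous _ 1 1 0 0 _).
  have H : (fun h : R => h^-1 *: ((f \o g) (h *: delta_mx 0 i + x) - (f \o g) x)) =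
     (fun M : 'rV[R]_1 => M 0 0) \o (fun h : R => h^-1 *: ((F \o g) (h *: delta_mx 0 i + x) - (F \o g) x)).
    by apply/funext => h; rewrite /= !mxE.
  split; first by rewrite /derivable H; apply/cvg_ex; eexists; exact: fg.
  by rewrite /derive H; apply: (cvg_lim (@norm_hausdorff _ _)) fg.
split; first by case: dfE.
rewrite /partial dfE.2 E -rowE !mxE; apply: eq_bigr => j _; rewrite !mxE mulrC.
congr (_ * _); rewrite /partial; congr ('D__ _ _).
by apply/funext => y; rewrite mxE.
Qed.

(** By the chain rule a partial derivative of the composite is a sum of products of a partial
    derivative of g with some partial derivative of f composed with g. The latter factor is again a
    smooth function composed with g, so the induction on the order runs over all f at once. *)
Lemma smooth_comp m k (U : set 'rV[R]_m) (V : set 'rV[R]_k)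
    (f : 'rV[R]_k -> R) (g : 'rV[R]_m -> 'rV[R]_k) :
  open U -> open V -> (forall x, U x -> V (g x)) ->
  smooth_map U g -> smooth_fun V f -> smooth_fun U (f \o g).
Proof.
move=> oU oV UV sg sf; apply/smooth_funP => N.
have s0 h : smooth_fun V h -> smooth_upto 0 U (h \o g).
  move=> sh; apply/smooth_upto0P => x Ux; split=> [|i].
    apply: continuous_comp; first exact: approx_continuous (smooth_map_approx oU Ux sg).
    exact: (sh [::] _ (UV _ Ux)).1.
  exact: (partial_comp i oU oV UV sg sh Ux).1.
elim: N f sf => [|N IH] f sf; first exact: s0.
apply/smooth_uptoS; split=> [|i]; first exact: s0.
apply: (@eq_smooth_upto _ _ _ (fun x => \sum_j (partial j f \o g) x *
  partial i (fun y => g y 0 j) x)) => //.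
  by move=> x Ux; rewrite (partial_comp i oU oV UV sg sf Ux).2.
apply: smooth_upto_sum => // j; apply: smooth_uptoM => //.
  by apply: IH; exact: smooth_fun_partial.
by move: N {IH}; apply/smooth_funP; apply: smooth_fun_partial; exact: sg.
Qed.

Lemma smooth_map_comp m k l (U : set 'rV[R]_m) (V : set 'rV[R]_k)
    (f : 'rV[R]_k -> 'rV[R]_l) (g : 'rV[R]_m -> 'rV[R]_k) :
  open U -> open V -> (forall x, U x -> V (g x)) ->
  smooth_map U g -> smooth_map V f -> smooth_map U (f \o g).
Proof. by move=> oU oV UV sg sf j; apply: (smooth_comp oU oV UV sg (sf j)). Qed.

Lemma eq_smooth_fun m (U : set 'rV[R]_m) f g : open U ->
  (forall x, U x -> f x = g x) -> smooth_fun U f -> smooth_fun U g.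
Proof.
by move=> oU fg /smooth_funP sf; apply/smooth_funP => N; exact: eq_smooth_upto (sf N).
Qed.

Lemma smooth_fun_cover m (U : set 'rV[R]_m) f :
  (forall x, U x -> exists V, [/\ open V, V x & smooth_fun V f]) -> smooth_fun U f.
Proof. by move=> H s x /H[V [oV Vx sV]]; exact: sV. Qed.

End smooth_calculus.

(** Completeness, for Banach's fixed point theorem in spaces of row vectors. *)
HB.instance Definition _ (R : realType) (m n : nat) :=
  Uniform_isComplete.Build 'M[R]_(m, n) cauchy_cvg.

(** * Local inverses *)

Section inverse_function.
Context {R : realType} {m : nat}.
Implicit Types f G : 'rV[R]_m -> 'rV[R]_m.

(* Solutions of f z = y are the fixed points of the contraction
   z |-> z - (f z - y) A^-1. *)
Lemma strict_approx_open f (x : 'rV[R]_m) (A : 'M[R]_m) (r : R) :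
  strict_approx f x A -> A \in unitmx -> 0 < r ->
  nbhs (f x) (f @` ball x r).
Proof.
move=> fA UA r0; have [K K0 KA] := mulmx_bound (invmx A).
(* With K a bound for A^-1, this error makes the map T below a contraction of ratio 1/2. *)
have e0 : 0 < (2 * K)^-1 by rewrite invr_gt0 mulr_gt0.
have [d d0 H] := fA _ e0.
pose s := Num.min d r / 2; have dr : 0 < Num.min d r by rewrite lt_min d0.
have s0 : 0 < s by rewrite divr_gt0.
have sm : s < Num.min d r by rewrite /s ltr_pdivrMr// ltr_pMr// ltr1n.
have sd : s < d by apply: lt_le_trans sm _; rewrite ge_min lexx.
have sr : s < r by apply: lt_le_trans sm _; rewrite ge_min lexx orbT.
pose B := [set z : 'rV[R]_m | `|x - z| <= s].
have Bd z : B z -> ball x d z.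
  by move=> Bz; rewrite -ball_normE /ball_ /=; apply: le_lt_trans Bz sd.
(* Then K |f x - y| <= s / 2 puts T x within s / 2 of x, and the ratio 1/2 does the rest to keep T
   inside the closed ball of radius s. *)
apply/nbhs_ballP; exists (s / (2 * K)); first by rewrite /= divr_gt0// mulr_gt0.
move=> y; rewrite -ball_normE /ball_ /= => xy.
pose T (z : 'rV[R]_m) := z - (f z - y) *m invmx A.
have TE z w : T z - T w = - ((f z - f w - (z - w) *m A) *m invmx A).
  rewrite /T [in RHS]mulmxBl mulmxK// !mulmxBl.
  set a := f z *m _; set b := f w *m _; set c := y *m _.
  by apply/rowP => j; rewrite !mxE; ring.
have TL z w : B z -> B w -> `|T z - T w| <= 2^-1 * `|z - w|.
  move=> /Bd Bz /Bd Bw; rewrite TE normrN; apply: le_trans (KA _) _.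
  have := H _ _ Bw Bz; rewrite -(ler_pM2l K0) => /le_trans; apply.
  by rewrite mulrA invfM mulrCA divff ?gt_eqF// mulr1.
have Bx : B x by rewrite /B /= subrr normr0 ltW.
have TB z : B z -> B (T z).
  move=> Bz; rewrite /B /=.
  have -> : x - T z = (x - T x) + (T x - T z) by rewrite addrA subrK.
  apply: le_trans (ler_normD _ _) _; rewrite (splitr s); apply: lerD.
    rewrite /T opprB addrC subrK; apply: le_trans (KA _) _.
    rewrite -ler_pdivlMl//; apply: le_trans (ltW xy) _.
    by rewrite invfM mulrA mulrC mulrA.
  apply: le_trans (TL _ _ Bx Bz) _; rewrite mulrC ler_wpM2r//.
have cB : closed B.
  have -> : B = closed_ball x s by rewrite closed_ballE.
  exact: closed_ball_closed.
have TF : set_fun B B T by [].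
pose TT : {fun B >-> B} := mkfun TF.
have [] := @banach_fixed_point R _ B TT _ cB.
- exists (2^-1)%:nng; split=> /=; first by rewrite invf_lt1// ltr1n.
  by move=> [z w] [/= Bz Bw]; exact: TL.
- by exists x.
move=> z Bz zT; exists z; first exact: le_lt_trans Bz sr.
have h : T z = z by exact: esym zT.
move: h; rewrite /T => /eqP; rewrite -subr_eq0 addrAC subrr sub0r oppr_eq0 => /eqP.
move=> /(congr1 (mulmx^~ A)); rewrite mul0mx mulmxKV// => /eqP.
by rewrite subr_eq0 => /eqP.
Qed.

(** Every point near f x is f z for some z near x, because the images of small balls are
    neighbourhoods; there G has the value z, so the estimate for f can be read backwards. In this
    way G gets its derivative although nothing is assumed on its continuity. *)
Lemma approx_inverse f G (U : set 'rV[R]_m) (x : 'rV[R]_m) (A : 'M[R]_m) :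
  strict_approx f x A -> A \in unitmx -> open U -> U x ->
  (forall z, U z -> G (f z) = z) -> approx G (f x) (invmx A).
Proof.
move=> fA UA oU Ux Gf e e0; have [K K0 KA] := mulmx_bound (invmx A).
(* The first bound yields |z - x| <= 2 K |f z - f x|; with it the second turns the error of f into
   an error e for G. *)
pose e' := Num.min (2 * K)^-1 (e / (2 * K * K)).
have e'0 : 0 < e' by rewrite lt_min invr_gt0 ?divr_gt0 ?mulr_gt0.
have /nbhs_ballP[r /= r0 rU] : nbhs x U by exact: open_nbhs_nbhs.
have [d d0 H] := fA _ e'0.
have s0 : 0 < Num.min d r by rewrite lt_min d0.
have := strict_approx_open fA UA s0; apply: filterS => _ [z xz <-].
have xd : ball x d z by apply: le_ball xz; rewrite ge_min lexx.
have xr : ball x r z by apply: le_ball xz; rewrite ge_min lexx orbT.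
have {}H := H _ _ (ballxx _ d0) xd.
rewrite !Gf//; last exact: rU.
have -> : z - x - (f z - f x) *m invmx A = - ((f z - f x - (z - x) *m A) *m invmx A).
  by rewrite [in RHS]mulmxBl mulmxK// opprB.
rewrite normrN; apply: le_trans (KA _) _.
have zx : `|z - x| <= 2 * K * `|f z - f x|.
  have := KA ((z - x) *m A); rewrite mulmxK// => h.
  have h2 : `|(z - x) *m A| <= `|f z - f x| + e' * `|z - x|.
    have -> : (z - x) *m A = (f z - f x) - (f z - f x - (z - x) *m A).
      by rewrite [in RHS]opprB [RHS]addrC subrK.
    by apply: le_trans (ler_normB _ _) _; rewrite lerD2l.
  have h3 : K * (e' * `|z - x|) <= 2^-1 * `|z - x|.
    rewrite mulrA ler_wpM2r// -ler_pdivlMl// mulrC -invfM mulrC.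
    by rewrite ge_min [K * 2]mulrC lexx.
  have h4 : `|z - x| <= K * `|f z - f x| + 2^-1 * `|z - x|.
    apply: le_trans h _; apply: le_trans (_ : _ <= K * (`|f z - f x| + e' * `|z - x|)) _.
      by rewrite ler_pM2l.
    by rewrite mulrDr lerD2l.
  by rewrite -mulrA; move: h4; move: (K * _) `|_| => a b; lra.
have := H; rewrite -(ler_pM2l K0) => /le_trans; apply.
apply: le_trans (_ : _ <= K * ((e / (2 * K * K)) * (2 * K * `|f z - f x|))) _.
  rewrite ler_pM2l//; apply: ler_pM => //; first exact: ltW.
  by rewrite /e' ge_min lexx orbT.
by rewrite le_eqVlt; apply/orP; left; apply/eqP; field; rewrite gt_eqF.
Qed.

End inverse_function.

(** * Lebesgue measure and changes of variables *)

Section borel.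
Context {R : realType}.

Lemma open_preimage (S T : topologicalType) (D : set S) (f : S -> T) (V : set T) :
  open D -> (forall x, D x -> {for x, continuous f}) -> open V -> open (D `&` f @^-1` V).
Proof.
move=> oD cf oV; rewrite openE => x [Dx Vx]; apply: filterI.
  exact: open_nbhs_nbhs.
by apply: (cf _ Dx); exact: open_nbhs_nbhs.
Qed.

Lemma open_measurable_real n (D : set 'rV[R]_n) (f : 'rV[R]_n -> R) :
  open D -> (forall x, D x -> {for x, continuous f}) ->
  measurable_fun (D : set (borelRn R n)) f.
Proof.
move=> oD cf; apply: (measurability _ (RGenOpens.measurableE R)).
move=> _ [_ [a [b ->] <-]]; apply: borel_open; apply: open_preimage => //.
Qed.

Lemma open_measurable_map m n (D : set 'rV[R]_m) (f : 'rV[R]_m -> 'rV[R]_n) :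
  open D -> (forall x, D x -> {for x, continuous f}) ->
  measurable_fun (D : set (borelRn R m)) (f : borelRn R m -> borelRn R n).
Proof.
move=> oD cf; apply: (@measurability _ _ _ _ (D : set (borelRn R m))
  (f : borelRn R m -> borelRn R n) (@open 'rV[R]_n)) => //.
by move=> _ [U oU <-]; apply: borel_open; exact: open_preimage.
Qed.

Lemma lebesgueRnS n (S : set 'rV[R]_n.+1) : lebesgueRn (S : set (borelRn R n.+1)) =
  (lebesgue_measure \x @lebesgueRn R n)%E (@rVcons R n @^-1` S).
Proof. by []. Qed.

Lemma lebesgueRn_ball n (r : R) : 0 < r ->
  (lebesgueRn (ball (0%R : 'rV[R]_n) r : set (borelRn R n)) < +oo)%E.
Proof. by have [m [-> H]] := lebesgueRn_spec R n; exact: H. Qed.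

(* [a, b) in the directions where l holds, (a, b] in the others. *)
Definition hbox n (l : 'I_n -> bool) (a b : 'rV[R]_n) : set 'rV[R]_n :=
  [set y | forall i, y 0 i \in Interval (BSide (l i) (a 0 i)) (BSide (l i) (b 0 i))].

Definition box n (a b : 'rV[R]_n) := hbox (fun=> true) a b.

Lemma boxE n (a b : 'rV[R]_n) : box a b = [set y | forall i, a 0 i <= y 0 i < b 0 i].
Proof. by apply/seteqP; split => y H i; have := H i; rewrite in_itv. Qed.

Lemma measurable_hbox n l (a b : 'rV[R]_n) : measurable (hbox l a b : set (borelRn R n)).
Proof.
have -> : hbox l a b = \bigcap_(i in [set: 'I_n])
    ((fun y : borelRn R n => (y : 'rV[R]_n) 0 i) @^-1`
      [set` Interval (BSide (l i) (a 0 i)) (BSide (l i) (b 0 i))]).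
  by apply/seteqP; split => [y yab i _|y yab i]; exact: yab.
apply: fin_bigcap_measurable => // i _; rewrite -[X in measurable X]setTI.
have cont (y : 'rV[R]_n) : setT y -> {for y, continuous (fun y : 'rV[R]_n => y 0 i)}.
  by move=> _; exact: coord_continuous.
by apply: (open_measurable_real openT cont) => //; exact: measurable_itv.
Qed.

Lemma measurable_box n (a b : 'rV[R]_n) : measurable (box a b : set (borelRn R n)).
Proof. exact: measurable_hbox. Qed.

Lemma lebesgueRn_hbox n l (a b : 'rV[R]_n) : (forall i, a 0 i <= b 0 i) ->
  lebesgueRn (hbox l a b : set (borelRn R n)) = (\prod_i (b 0 i - a 0 i))%:E.
Proof.
elim: n l a b => [|n IH] l a b ab.
  by rewrite big_ord0 /= diracE mem_set// => -[].
rewrite lebesgueRnS.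
pose ra (c : 'rV[R]_n.+1) : 'rV[R]_n := \row_j c 0 (rshift 1 j).
pose rl : 'I_n -> bool := fun j => l (rshift 1 j).
pose I0 := Interval (BSide (l ord0) (a 0 ord0)) (BSide (l ord0) (b 0 ord0)).
have -> : @rVcons R n @^-1` hbox l a b =
    ([set` I0] : set (measurableTypeR R)) `*` (hbox rl (ra a) (ra b) : set (borelRn R n)).
  have e0 : lshift n (ord0 : 'I_1) = ord0 :> 'I_n.+1 by exact: ord_inj.
  have x0 x (v : borelRn R n) : (rVcons (x, v) : 'rV[R]_n.+1) 0 ord0 = x.
    by rewrite -e0 rVconsEl.
  apply/seteqP; split => -[x v] /=.
    move=> H; split => [|j]; first by have := H ord0; rewrite x0.
    by have := H (rshift 1 j); rewrite rVconsEr !mxE.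
  move=> [xab vab] i; rewrite -(splitK (i : 'I_(1 + n))).
  case: (fintype.split (i : 'I_(1 + n))) => j /=.
    by rewrite (ord1 j) e0 x0.
  by rewrite rVconsEr; have := vab j; rewrite !mxE.
rewrite product_measure1E; [|exact: measurable_itv|exact: measurable_hbox].
rewrite [X in (_ * X)%E]IH; last by move=> i; rewrite !mxE.
rewrite [X in (X * _)%E](_ : _ = (b 0 ord0 - a 0 ord0)%:E); last first.
  have := lebesgue_measure_itv I0; rewrite /= lte_fin => ->.
  by have := ab ord0; rewrite le_eqVlt => /predU1P[->|->]; rewrite ?ltxx ?subrr ?EFinB.
rewrite big_ord_recl EFinM; congr (_ * _)%E.
congr EFin; apply: eq_bigr => i _; rewrite !mxE.
by congr (b 0 _ - a 0 _); apply: ord_inj.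
Qed.

Lemma lebesgueRn_box n (a b : 'rV[R]_n) : (forall i, a 0 i <= b 0 i) ->
  lebesgueRn (box a b : set (borelRn R n)) = (\prod_i (b 0 i - a 0 i))%:E.
Proof. exact: lebesgueRn_hbox. Qed.

End borel.

(** * Dyadic cubes *)

Section dyadic.
Context {R : realType} {n : nat}.
Local Notation mu := (@lebesgueRn R n).
Local Notation V := 'rV[R]_n.
Local Notation BV := (borelRn R n).
Local Notation index := (nat * 'rV[int]_n)%type.

Definition dyadic_index (j : nat) (x : V) : 'rV[int]_n :=
  \row_i Num.floor (2 ^+ j * x 0 i).

Definition cube (c : index) : set V := [set y | dyadic_index c.1 y = c.2].

Definition cube_at (j : nat) (x : V) : set V := cube (j, dyadic_index j x).

Lemma cubeE (c : index) : cube c = box (\row_i (2 ^- c.1 * (c.2 0 i)%:~R))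
  (\row_i (2 ^- c.1 * (c.2 0 i + 1)%:~R)).
Proof.
case: c => j k; have p0 : 0 < 2 ^+ j :> R by rewrite exprn_gt0.
have E (y : R) (z : int) : (Num.floor (2 ^+ j * y) == z) =
    (2 ^- j * z%:~R <= y < 2 ^- j * (z + 1)%:~R).
  by rewrite floor_eq ler_pdivrMl// ltr_pdivlMl.
rewrite boxE; apply/seteqP; split => y /=.
  by move=> /rowP kE i; have := kE i; rewrite !mxE -E => ->.
by move=> H; apply/rowP => i; have := H i; rewrite !mxE -E => /eqP.
Qed.

Lemma measurable_cube c : measurable (cube c : set BV).
Proof. by rewrite cubeE; exact: measurable_box. Qed.

Lemma lebesgueRn_cube c : mu (cube c) = ((2 ^- c.1) ^+ n)%:E.
Proof.
rewrite cubeE lebesgueRn_box => [|i]; last first.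
  by rewrite !mxE ler_pM2l ?invr_gt0 ?exprn_gt0// ler_int lerDl.
congr EFin; transitivity (\prod_(i < n) (2 ^- c.1 : R)); last by rewrite prodr_const card_ord.
apply: eq_bigr => i _.
by rewrite !mxE -mulrBr -intrB addrAC subrr add0r mulr1.
Qed.

Lemma cube_at_dist j x y i : cube_at j x y -> `|y 0 i - x 0 i| < 2 ^- j.
Proof.
move=> /rowP/(_ i); rewrite !mxE => E; have p0 : 0 < 2 ^+ j :> R by rewrite exprn_gt0.
have /andP[x1 x2] := floor_itv (2 ^+ j * x 0 i).
have /andP[y1 y2] := floor_itv (2 ^+ j * y 0 i); rewrite E in y1 y2.
rewrite -[ltRHS]mulr1 ltr_pdivlMl// -{1}(ger0_norm (ltW p0)) -normrM mulrBr.
move: x1 x2 y1 y2; rewrite intrD; move: (2 ^+ j * _) (2 ^+ j * _) (_%:~R) => a b c.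
by rewrite ltr_norml; lra.
Qed.

Lemma cube_at_ball j x (r : R) : 2 ^- j <= r -> cube_at j x `<=` ball x r.
Proof.
move=> jr y xy; split; first by apply: lt_le_trans jr; rewrite invr_gt0 exprn_gt0.
move=> i k; rewrite ord1 /ball /= distrC.
exact: lt_le_trans (cube_at_dist k xy) jr.
Qed.

Lemma dyadic_small (r : R) : 0 < r -> exists j0, forall j, (j0 <= j)%N -> 2 ^- j <= r.
Proof.
move=> r0; exists (Num.truncn r^-1).+1 => j j0j.
rewrite -[r]invrK lef_pV2 ?posrE ?invr_gt0 ?exprn_gt0//.
apply: le_trans (ltW (truncnS_gt _)) _; rewrite -natrX ler_nat.
by apply: leq_trans j0j _; apply: ltnW; exact: ltn_expl.
Qed.

Lemma cube_at_open (U : set V) x : open U -> U x ->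
  exists j0, forall j, (j0 <= j)%N -> cube_at j x `<=` U.
Proof.
move=> oU Ux; have /nbhs_ballP[r /= r0 rU] : nbhs x U by exact: open_nbhs_nbhs.
have [j0 H] := dyadic_small r0; exists j0 => j /H jr.
exact: subset_trans (cube_at_ball jr) rU.
Qed.

Lemma dyadic_index_coarse i j (x y : V) : (i <= j)%N ->
  dyadic_index j x = dyadic_index j y -> dyadic_index i x = dyadic_index i y.
Proof.
move=> /subnK <-; elim: (j - i)%N => [//|d IH] E; apply: IH.
apply/rowP => k; move/rowP/(_ k): E; rewrite !mxE addSn !exprS -!mulrA.
move: (2 ^+ _ * _) (2 ^+ _ * _) => a b E.
have /andP[a1 a2] := floor_itv a; have /andP[b1 b2] := floor_itv b.
have /andP[c1 c2] := floor_itv (2 * a); have /andP[d1 d2] := floor_itv (2 * b).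
rewrite -E in c1 c2.
move: a1 a2 b1 b2 c1 c2 d1 d2; rewrite !intrD.
set fa := Num.floor a; set fb := Num.floor b; set c := Num.floor (2 * b) => *.
have h1 : (2%:Z * fa < c + 1)%R by rewrite -(ltr_int R) intrM intrD; lra.
have h2 : (2%:Z * fb < c + 1)%R by rewrite -(ltr_int R) intrM intrD; lra.
have h3 : (c < 2%:Z * fa + 2%:Z)%R by rewrite -(ltr_int R) intrD intrM; lra.
have h4 : (c < 2%:Z * fb + 2%:Z)%R by rewrite -(ltr_int R) intrD intrM; lra.
by clearbody fa fb c; lia.
Qed.

Lemma cube_nested (c d : index) y : (c.1 <= d.1)%N -> cube c y -> cube d y ->
  cube d `<=` cube c.
Proof.
by move=> cd /= cy dy z dz; rewrite /cube /= -cy; apply: dyadic_index_coarse cd _; rewrite dz dy.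
Qed.

(** Level 0 is the coarsest, so above a good cube there are finitely many candidates and each of its
    points lies in a maximal one; nestedness makes the maximal ones pairwise disjoint. *)
Definition maximal_cube (good : index -> Prop) (c : index) : Prop :=
  good c /\ forall d : index, (d.1 < c.1)%N -> cube c `<=` cube d -> ~ good d.

Lemma maximal_cube_disjoint good c d y : maximal_cube good c -> maximal_cube good d ->
  cube c y -> cube d y -> c = d.
Proof.
move=> mc md cy dy; have [cd|dc|e] := ltngtP c.1 d.1.
- by exfalso; apply: (md.2 c cd) mc.1; exact: cube_nested (ltnW cd) cy dy.
- by exfalso; apply: (mc.2 d dc) md.1; exact: cube_nested (ltnW dc) dy cy.
move: cy dy e; rewrite /cube; case: c d {mc md} => [j k] [j' k'] /= cy dy e.
by rewrite e; congr pair; rewrite -[k]cy -[k']dy e.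
Qed.

Lemma maximal_cube_cover good j x : good (j, dyadic_index j x) ->
  exists2 c, maximal_cube good c & cube c x.
Proof.
move=> gj; pose P i := `[< good (i, dyadic_index i x) >].
have exP : exists i, P i by exists j; apply/asboolP.
case: (ex_minnP exP) => i /asboolP Pi min.
exists (i, dyadic_index i x) => //; split=> // -[i' k'] /= i'i sub gd.
have /= k'E := sub x erefl.
have := min i'; rewrite leqNgt i'i => H; suff : false by [].
by apply: H; apply/asboolP; rewrite k'E.
Qed.

(** The cubes in M listed along the countable index type, with the empty set at codes that name none
    of them: the form in which countable additivity applies. *)
Definition cube_seq (M : index -> Prop) (i : nat) : set V :=
  if pickle_inv i is Some c then (if `[< M c >] then cube c else set0) else set0.

Lemma measurable_cube_seq M i : measurable (cube_seq M i : set BV).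
Proof.
rewrite /cube_seq; case: pickle_inv => [c|]; last exact: measurable0.
by case: ifP => _; [exact: measurable_cube|exact: measurable0].
Qed.

Lemma trivIset_cube_seq good : trivIset setT (cube_seq (maximal_cube good)).
Proof.
move=> i j _ _ [y []]; rewrite /cube_seq.
case ui: pickle_inv => [c|//]; case: asboolP => // mc cy.
case uj: pickle_inv => [d|//]; case: asboolP => // md dy.
have E := maximal_cube_disjoint mc md cy dy.
have := @pickle_invK index i; have := @pickle_invK index j.
by rewrite ui uj /= E => -> ->.
Qed.

Lemma bigcup_cube_seq M : \bigcup_i cube_seq M i = \bigcup_(c in M) cube c.
Proof.
apply/seteqP; split => [y [i _]|y [c Mc cy]].
  by rewrite /cube_seq; case: pickle_inv => // c; case: asboolP => // Mc cy; exists c.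
by exists (pickle c) => //; rewrite /cube_seq pickleK_inv; case: asboolP.
Qed.

Lemma open_cubes (U : set V) : open U ->
  U = \bigcup_(c in [set c | cube c `<=` U]) cube c.
Proof.
move=> oU; apply/seteqP; split => [x Ux|x [c cU cx]]; last exact: cU.
have [j0 H] := cube_at_open oU Ux.
by exists (j0, dyadic_index j0 x) => //; exact: H.
Qed.

(** Two cubes are nested or disjoint, so cubes together with the empty set form a pi-system; it
    generates the Borel sets because an open set is a countable union of cubes. The cubes of level 0
    exhaust the space. *)
Lemma measure_unique_cube (m1 m2 : {measure set BV -> \bar R}) :
  (forall c, m1 (cube c) = m2 (cube c)) -> (forall c, (m1 (cube c) < +oo)%E) ->
  forall S : set BV, measurable S -> m1 S = m2 S.
Proof.
move=> m12 m1f S mS.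
pose G : set (set BV) := [set A | A = set0 \/ exists c, A = cube c].
pose g := cube_seq (fun c => c.1 = 0%N).
apply: (@g_sigma_algebra_measure_unique _ _ _ G _ g) => //.
- by move=> A [->|[c ->]]; [exact: measurable0|exact: measurable_cube].
- move=> i; rewrite /g /cube_seq; case: pickle_inv => [c|]; last by left.
  by case: ifP => _; [right; exists c|left].
- rewrite bigcup_cube_seq -subTset => x _.
  by exists (0%N, dyadic_index 0 x).
- move=> A B [->|[c ->]]; first by left; rewrite set0I.
  move=> [->|[d ->]]; first by left; rewrite setI0.
  have [[y [cy dy]]|/nonemptyPn e] := pselect ((cube c `&` cube d) !=set0); last by left.
  right; have [cd|/ltnW dc] := leqP c.1 d.1.
    by exists d; apply: setIidr; exact: cube_nested cd cy dy.
  by exists c; apply: setIidl; exact: cube_nested dc dy cy.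
- by move=> A [->|[c ->]]; [rewrite !measure0|exact: m12].
- move=> i; rewrite /g /cube_seq; case: pickle_inv => [c|]; last by rewrite measure0 ltry.
  by case: ifP => _; [exact: m1f|rewrite measure0 ltry].
move: S mS; apply: smallest_sub; first exact: smallest_sigma_algebra.
move=> U oU; rewrite (open_cubes oU) -bigcup_cube_seq.
apply: sigma_algebra_bigcup => i; rewrite /cube_seq.
apply: sub_sigma_algebra; case: pickle_inv => [c|]; last by left.
by case: ifP => _; [right; exists c|left].
Qed.

End dyadic.

(** * Lebesgue measure under linear maps *)

Section scaling.
Context {R : realType}.

(** Preimages make this the equality of a pushforward with a multiple of Lebesgue measure, a
    property stable under composition; an invertible linear map A gets the constant 1 / |det A|. *)
Definition scales n (f : 'rV[R]_n -> 'rV[R]_n) (c : R) : Prop :=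
  [/\ 0 <= c, continuous f & forall S : set (borelRn R n), measurable S ->
      lebesgueRn (f @^-1` S : set (borelRn R n)) = (c%:E * lebesgueRn S)%E].

Lemma continuous_measurable_map m n (f : 'rV[R]_m -> 'rV[R]_n) : continuous f ->
  measurable_fun setT (f : borelRn R m -> borelRn R n).
Proof. by move=> cf; apply: (open_measurable_map openT) => x _; exact: cf. Qed.

Lemma measurable_preimage m n (f : 'rV[R]_m -> 'rV[R]_n) (S : set (borelRn R n)) :
  continuous f -> measurable S -> measurable (f @^-1` S : set (borelRn R m)).
Proof.
move=> cf mS; rewrite -[X in measurable X]setTI.
exact: (continuous_measurable_map cf).
Qed.

Lemma scales_comp n (f g : 'rV[R]_n -> 'rV[R]_n) (c d : R) :
  scales f c -> scales g d -> scales (g \o f) (c * d).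
Proof.
move=> [c0 cf fc] [d0 cg gd]; split; first exact: mulr_ge0.
  by move=> x; apply: continuous_comp; [exact: cf|exact: cg].
move=> S mS; rewrite -[X in lebesgueRn X]/(f @^-1` (g @^-1` S)) fc.
  by rewrite gd// EFinM muleA.
exact: measurable_preimage.
Qed.

Lemma scales_cube n (f : 'rV[R]_n -> 'rV[R]_n) (c : R) : 0 <= c -> continuous f ->
  (forall k, lebesgueRn (f @^-1` cube k : set (borelRn R n)) =
             (c%:E * lebesgueRn (cube k : set (borelRn R n)))%E) ->
  scales f c.
Proof.
move=> c0 cf H; split=> // S mS.
unshelve epose (m1 := (pushforward (@lebesgueRn R n) (f : borelRn R n -> borelRn R n)
  : {measure set (borelRn R n) -> \bar R})).
  exact: continuous_measurable_map.
pose m2 : {measure set (borelRn R n) -> \bar R} := mscale (NngNum c0) (@lebesgueRn R n).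
rewrite -[LHS]/(m1 S) -[RHS]/(m2 S); apply: measure_unique_cube => // k.
  rewrite -[X in (X < _)%E]/(lebesgueRn (f @^-1` cube k)) H.
  by rewrite lebesgueRn_cube -EFinM ltry.
Qed.

Lemma continuous_mulmxr n (A : 'M[R]_n) : continuous (fun x : 'rV[R]_n => x *m A).
Proof. exact: mulmxr_continuous. Qed.

Lemma scales_shift n (v : 'rV[R]_n) : scales (fun x => x + v) 1.
Proof.
apply: scales_cube => //.
  by move=> x; apply: continuousD; [exact: id|exact: cst_continuous].
move=> k; rewrite mul1e [in RHS]lebesgueRn_cube cubeE.
set a := \row__ _; set b := \row__ _.
have -> : (fun x => x + v) @^-1` box a b = box (a - v) (b - v).
  rewrite !boxE; apply/seteqP; split => y H i; have := H i;
  by rewrite !mxE ?lerBlDr ?ltrBrDr.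
rewrite lebesgueRn_box => [|i].
  transitivity ((\prod_(i < n) (2 ^- k.1 : R))%:E); last by rewrite prodr_const card_ord.
  congr EFin; apply: eq_bigr => i _; rewrite !mxE opprB addrA subrK.
  by rewrite -mulrBr -intrB addrAC subrr add0r mulr1.
by rewrite !mxE lerD2r ler_pM2l ?invr_gt0 ?exprn_gt0// ler_int lerDl.
Qed.

Lemma scales_perm n (s : 'S_n) : scales (fun x : 'rV[R]_n => x *m perm_mx s) 1.
Proof.
apply: scales_cube => //; first exact: continuous_mulmxr.
move=> k; rewrite mul1e [in RHS]lebesgueRn_cube cubeE.
set a := \row__ _; set b := \row__ _.
have E (y : 'rV[R]_n) i : (y *m perm_mx s) 0 (s i) = y 0 i.
  rewrite -[s in perm_mx s]invgK -col_permE mxE permK//.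
have -> : (fun x : 'rV[R]_n => x *m perm_mx s) @^-1` box a b =
    box (\row_i a 0 (s i)) (\row_i b 0 (s i)).
  rewrite !boxE; apply/seteqP; split => y H i /=.
    by rewrite [(\row__ a _ _) 0 i]mxE [(\row__ b _ _) 0 i]mxE -E; exact: H.
  have := H ((s^-1)%g i); rewrite [(\row__ a _ _) 0 _]mxE [(\row__ b _ _) 0 _]mxE.
  by rewrite -E permKV.
rewrite lebesgueRn_box => [|i].
  transitivity ((\prod_(i < n) (2 ^- k.1 : R))%:E); last by rewrite prodr_const card_ord.
  congr EFin; apply: eq_bigr => i _; rewrite !mxE.
  by rewrite -mulrBr -intrB addrAC subrr add0r mulr1.
by rewrite !mxE ler_pM2l ?invr_gt0 ?exprn_gt0// ler_int lerDl.
Qed.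

(** The preimage of a box is a box, but a negative entry exchanges its closed and open sides; the
    sides l of [hbox] record the signs. *)
Lemma scales_diag n (d : 'rV[R]_n) : (forall i, d 0 i != 0) ->
  scales (fun x : 'rV[R]_n => x *m diag_mx d) (\prod_i `|d 0 i|^-1).
Proof.
move=> d0; apply: scales_cube; first by rewrite prodr_ge0.
  exact: continuous_mulmxr.
move=> k; rewrite [in RHS]lebesgueRn_cube cubeE.
set a := \row__ _; set b := \row__ _.
have ab i : a 0 i <= b 0 i.
  by rewrite !mxE ler_pM2l ?invr_gt0 ?exprn_gt0// ler_int lerDl.
have E (y : 'rV[R]_n) i : (y *m diag_mx d) 0 i = y 0 i * d 0 i by rewrite mul_mx_diag mxE.
pose l i := 0 < d 0 i.
pose a' : 'rV[R]_n := \row_i (if l i then a 0 i / d 0 i else b 0 i / d 0 i).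
pose b' : 'rV[R]_n := \row_i (if l i then b 0 i / d 0 i else a 0 i / d 0 i).
have a'E i : a' 0 i = if l i then a 0 i / d 0 i else b 0 i / d 0 i by rewrite mxE.
have b'E i : b' 0 i = if l i then b 0 i / d 0 i else a 0 i / d 0 i by rewrite mxE.
have dneg i : ~~ l i -> d 0 i < 0 by rewrite -leNgt lt_neqAle d0.
have -> : (fun x : 'rV[R]_n => x *m diag_mx d) @^-1` box a b = hbox l a' b'.
  have EE (y : 'rV[R]_n) i : (a 0 i <= y 0 i * d 0 i < b 0 i) =
      (y 0 i \in Interval (BSide (l i) (a' 0 i)) (BSide (l i) (b' 0 i))).
    rewrite [in RHS]in_itv /= a'E b'E; case: ifPn => li /=.
      by rewrite ler_pdivrMr// ltr_pdivlMr.
    by rewrite andbC ltr_ndivrMr ?dneg// ler_ndivlMr ?dneg.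
  rewrite boxE; apply/seteqP; split => y H i.
    by rewrite -EE -E; exact: H.
  by rewrite E EE; exact: H.
rewrite lebesgueRn_hbox => [|i].
  rewrite -EFinM; congr EFin.
  have -> : (2 ^- k.1 : R) ^+ n = \prod_(i < n) 2 ^- k.1 by rewrite prodr_const card_ord.
  rewrite -big_split; apply: eq_bigr => i _ /=.
  have ba : b 0 i - a 0 i = 2 ^- k.1.
    by rewrite !mxE -mulrBr -intrB addrAC subrr add0r mulr1.
  rewrite a'E b'E; case: ifPn => li; rewrite -mulrBl.
    by rewrite ba mulrC gtr0_norm.
  by rewrite -opprB ba mulNr -mulrN mulrC ltr0_norm ?dneg// invrN.
rewrite a'E b'E; case: ifPn => li.
  by rewrite ler_pM2r ?invr_gt0.
by rewrite ler_nM2r ?invr_lt0 ?dneg.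
Qed.

Definition upper_unitri n (U : 'M[R]_n) : Prop :=
  (forall i j : 'I_n, (j < i)%N -> U i j = 0) /\ forall i, U i i = 1.

(** Fubini and induction on the dimension: with the first coordinate x fixed, the map acts on the
    remaining ones by a smaller unitriangular matrix followed by the translation by x w. *)
Lemma scales_upper n (U : 'M[R]_n) : upper_unitri U -> scales (fun x : 'rV[R]_n => x *m U) 1.
Proof.
elim: n U => [|n IH] U [Ut Ud].
  have -> : (fun x : 'rV[R]_0 => x *m U) = id by apply/funext => x; apply/rowP => -[].
  by split=> // [x|S mS]; [exact: cvg_id|rewrite mul1e].
split=> //; first exact: continuous_mulmxr.
move=> S mS; rewrite mul1e.
pose U' : 'M[R]_(1 + n) := U.
pose w : 'rV[R]_n := ursubmx U'.
have UE : U' = block_mx 1%:M w 0 (drsubmx U').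
  rewrite -[U' in LHS]submxK; congr block_mx.
    by apply/matrixP => i j; rewrite !ord1 !mxE /= (_ : lshift n 0 = ord0) ?Ud//; apply: ord_inj.
  by apply/matrixP => i j; rewrite !mxE Ut//= ord1.
have dU : upper_unitri (drsubmx U').
  split=> [i j ij|i]; rewrite !mxE; first by rewrite Ut//= ltn_add2l.
  by rewrite Ud.
have [_ _ dS] := IH _ dU.
rewrite !lebesgueRnS -[LHS]/(\int[lebesgue_measure]_x _)%E -[RHS]/(\int[lebesgue_measure]_x _)%E.
apply: eq_integral => x _ /=.
set S' := @rVcons R n @^-1` S.
have mS' : measurable S'.
  by rewrite -[X in measurable X]setTI; exact: (@measurable_rVcons R n).
have mx := measurable_xsection x mS'.
have rowE' (v : 'rV[R]_n) : (rVcons (x, v : borelRn R n) : 'rV[R]_n.+1) *m U =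
    rVcons (x, (v *m drsubmx U' + x *: w : borelRn R n)).
  have E : (row_mx (const_mx x : 'rV_1) v : 'rV[R]_(1 + n)) *m U' =
      row_mx (const_mx x) (v *m drsubmx U' + x *: w).
    rewrite {1}UE mul_row_block mulmx1 mulmx0 addr0 [in RHS]addrC.
    suff -> : (const_mx x : 'rV_1) *m w = x *: w by [].
    by apply/matrixP => i j; rewrite !mxE big_ord1 !mxE !ord1.
  exact: E.
have -> : xsection (@rVcons R n @^-1` ((fun y : 'rV[R]_n.+1 => y *m U) @^-1` S)) x =
    (fun v : 'rV[R]_n => v *m drsubmx U' + x *: w) @^-1` xsection S' x.
  by apply/seteqP; split => v; rewrite /xsection /= !inE /S' /= -rowE'.
have [_ _ H] := scales_comp (IH _ dU) (scales_shift (x *: w)).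
by have := H _ mx; rewrite mulr1 mul1e.
Qed.

End scaling.

Section linear_scaling.
Context {R : realType}.

Lemma scales_mulM n (A B : 'M[R]_n) (c d : R) :
  scales (fun x : 'rV_n => x *m A) c -> scales (fun x : 'rV_n => x *m B) d ->
  scales (fun x : 'rV_n => x *m (A *m B)) (c * d).
Proof.
move=> Ac Bd; have := scales_comp Ac Bd.
by congr scales; apply/funext => x; rewrite /= mulmxA.
Qed.

(** The LUP decomposition leaves permutations and unitriangular factors, all of constant 1, and the
    diagonal of U, which carries the determinant up to sign. *)
Lemma scales_mulmx n (A : 'M[R]_n) : A \in unitmx ->
  scales (fun x : 'rV_n => x *m A) `|\det A|^-1.
Proof.
case: n A => [|n] A UA.
  rewrite det_mx00 normr1 invr1.
  have -> : (fun x : 'rV[R]_0 => x *m A) = id by apply/funext => x; apply/rowP => -[].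
  by split=> // [x|S mS]; [exact: cvg_id|rewrite mul1e].
have := cormen_lup_correct A; have := cormen_lup_perm A; have := cormen_lup_detL A.
have := @cormen_lup_lower _ n A; have := @cormen_lup_upper _ n A.
case: (cormen_lup A) => [[P L] U] /= Uu Ll dL /is_perm_mxP[s ->] PAE.
have {}PAE : perm_mx s *m A = L *m U by [].
have UL : L \in unitmx by rewrite unitmxE dL unitr1.
have UP : perm_mx s \in unitmx := unitmx_perm R s.
have UU : U \in unitmx.
  have : L *m U \in unitmx by rewrite -PAE unitmx_mul UP.
  by rewrite unitmx_mul => /andP[].
have AE : A = perm_mx s^-1 *m (L *m U).
  by rewrite -PAE mulmxA -perm_mxM mulVg perm_mx1 mul1mx.
have detU : \det U = \prod_i U i i.
  rewrite -det_tr det_trig; first by apply: eq_bigr => i _; rewrite mxE.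
  by apply/is_trig_mxP => i j ij; rewrite mxE Uu.
pose d : 'rV[R]_n.+1 := \row_i U i i.
have d0 i : d 0 i != 0.
  move: UU; rewrite unitmxE detU unitfE => /prodf_neq0/(_ i isT).
  by rewrite mxE.
pose U1 : 'M[R]_n.+1 := \matrix_(i, j) (U i j / U i i).
have UE : U = diag_mx d *m U1.
  apply/matrixP => i j; rewrite mul_diag_mx !mxE mulrCA mulfV ?mulr1//.
  by have := d0 i; rewrite mxE.
have U1u : upper_unitri U1.
  split=> [i j ji|i]; rewrite mxE; first by rewrite Uu// mul0r.
  by rewrite mulfV//; have := d0 i; rewrite mxE.
(* Reversing the order of the coordinates turns the lower unitriangular L into an upper one. *)
pose r : 'S_n.+1 := perm (@rev_ord_inj n.+1).
pose L1 : 'M[R]_n.+1 := row_perm r (col_perm r L).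
have L1u : upper_unitri L1.
  split=> [i j ji|i]; rewrite !mxE Ll ?eqxx//; last first.
    by rewrite !permE /= leq_sub2l// ltnW.
  by rewrite (inj_eq perm_inj) -val_eqE gtn_eqF.
have LE : L = perm_mx r^-1 *m (L1 *m perm_mx r).
  rewrite /L1 row_permE col_permE !mulmxA -perm_mxM mulVg perm_mx1 mul1mx.
  by rewrite -mulmxA -perm_mxM mulVg perm_mx1 mulmx1.
have sL : scales (fun x : 'rV_n.+1 => x *m L) 1.
  rewrite LE -[1](mulr1 1) -{2}[1](mulr1 1); apply: scales_mulM; first exact: scales_perm.
  by apply: scales_mulM; [exact: scales_upper|exact: scales_perm].
have sU : scales (fun x : 'rV_n.+1 => x *m U) (\prod_i `|d 0 i|^-1).
  have := scales_mulM (scales_diag d0) (scales_upper U1u).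
  by rewrite mulr1 -UE.
have -> : `|\det A|^-1 = 1 * (1 * \prod_i `|d 0 i|^-1).
  rewrite AE !mul1r !det_mulmx dL mul1r det_perm normrM normr_sign mul1r detU.
  by rewrite normr_prod prodfV; congr _^-1; apply: eq_bigr => i _; rewrite mxE.
rewrite {1}AE; apply: scales_mulM; first exact: scales_perm.
exact: scales_mulM.
Qed.

(** The set is c + S A, written as a preimage so that its measurability comes from continuity. *)
Lemma lebesgueRn_parallelepiped n (A : 'M[R]_n) (c : 'rV[R]_n) (S : set (borelRn R n)) :
  A \in unitmx -> measurable S ->
  measurable ([set y | S ((y - c) *m invmx A)] : set (borelRn R n)) /\
  lebesgueRn ([set y | S ((y - c) *m invmx A)] : set (borelRn R n)) =
    (`|\det A|%:E * lebesgueRn S)%E.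
Proof.
move=> UA mS.
have [_ cf H] := scales_comp (scales_shift (- c)) (scales_mulmx (etrans (unitmx_inv A) UA)).
split; first exact: (measurable_preimage cf mS).
by rewrite [LHS]H// mul1r det_inv normfV invrK.
Qed.

End linear_scaling.

(** * Measure of images by coverings with cubes *)

Section cube_covering.
Context {R : realType} {n : nat}.
Local Notation mu := (@lebesgueRn R n).
Local Notation V := 'rV[R]_n.
Local Notation BV := (borelRn R n).

(** Call a cube good if it lies in U and satisfies the local estimate. The maximal good cubes cover
    E and are disjoint, so the local estimates add up with the same constant K. *)
Lemma cube_cover (f : V -> V) (E U : set V) (K : R) : 0 <= K ->
  measurable (U : set BV) ->
  (forall x, E x -> exists j, cube_at j x `<=` U /\
     exists W : set BV, [/\ measurable W, f @` (cube_at j x `&` E) `<=` W &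
                           (mu W <= K%:E * mu (cube_at j x))%E]) ->
  exists W : set BV, [/\ measurable W, f @` E `<=` W & (mu W <= K%:E * mu U)%E].
Proof.
move=> K0 mU H.
pose good (c : nat * 'rV[int]_n) := cube c `<=` U /\
  exists W : set BV, [/\ measurable W, f @` (cube c `&` E) `<=` W & (mu W <= K%:E * mu (cube c))%E].
pose F := @cube_seq R n (@maximal_cube R n good).
have FW i : exists W : set BV, [/\ measurable W, f @` (F i `&` E) `<=` W & (mu W <= K%:E * mu (F i))%E].
  have e0 : exists W : set BV, [/\ measurable W, f @` (set0 `&` E) `<=` W & (mu W <= K%:E * mu set0)%E].
    by exists set0; split; [exact: measurable0|rewrite set0I image_set0|rewrite !measure0 mule0].
  rewrite /F /cube_seq; case: pickle_inv => [c|//].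
  by case: asboolP => // -[[_ HW] _].
have [W HW] := choice FW.
have mF i : measurable (F i : set BV) by exact: measurable_cube_seq.
have mW i : measurable (W i) by have [] := HW i.
exists (\bigcup_i W i); split; first exact: bigcup_measurable.
  move=> _ [x Ex <-]; have [j [jU jW]] := H x Ex.
  have : good (j, dyadic_index j x) by [].
  move=> /maximal_cube_cover[c mc cx].
  have : (\bigcup_i F i) x by rewrite /F bigcup_cube_seq; exists c.
  move=> [i _ Fx]; exists i => //; have [_ sub _] := HW i.
  by apply: sub; exists x.
have sW := @measure_sigma_subadditive _ _ _ mu (\bigcup_i W i) W mW
  (bigcup_measurable (fun i _ => mW i)) (@subset_refl _ _).
apply: le_trans sW _.
apply: (@le_trans _ _ (\sum_(i <oo) (K%:E * mu (F i)))%E).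
  by apply: lee_nneseries => // i _; have [_ _] := HW i.
rewrite nneseriesZl//; apply: lee_pmul => //; first exact: nneseries_ge0.
rewrite -measure_semi_bigcup//; [|exact: trivIset_cube_seq|exact: bigcup_measurable].
apply: le_measure; rewrite ?inE//; first exact: bigcup_measurable.
by rewrite /F bigcup_cube_seq => x [c [[cU _] _] cx]; exact: cU.
Qed.

Lemma widened_cube (K c : R) : 0 <= c -> c < K ->
  exists2 t : R, 0 < t & c * (1 + 2 * t) ^+ n <= K.
Proof.
move=> c0 cK.
have : (fun t : R => c * (1 + 2 * t) ^+ n) @ (0 : R) --> c * (1 + 2 * 0) ^+ n.
  apply: cvgMr; apply: (@continuous_comp _ _ _ (fun t : R => 1 + 2 * t) (fun t => t ^+ n)).
    by apply: continuousD; [exact: cst_continuous|exact: mulrl_continuous].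
  exact: exprn_continuous.
rewrite mulr0 addr0 expr1n mulr1 => /cvgrPdist_lt/(_ (K - c)).
rewrite subr_gt0 => /(_ cK)/nbhs_ballP[d /= d0 H].
have d2 : 0 < d / 2 by rewrite divr_gt0.
exists (d / 2) => //; have := H (d / 2).
rewrite /ball /= sub0r normrN gtr0_norm// ltr_pdivrMr// ltr_pMr// ltr1n => /(_ isT).
by rewrite distrC => /(le_lt_trans (ler_norm _)); rewrite ltrBlDr subrK => /ltW.
Qed.

(* Near x the map f is the affine map of matrix A up to an error that only
   widens the cubes, so the image of a small cube lies in a parallelepiped of
   almost |det A| times its volume. *)
Lemma approx_cube (f : V -> V) x (A : 'M[R]_n) (K : R) : approx f x A -> A \in unitmx ->
  `|\det A| < K -> exists j0, forall j, (j0 <= j)%N ->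
    exists W : set BV, [/\ measurable W, f @` cube_at j x `<=` W &
                          (mu W <= K%:E * mu (cube_at j x))%E].
Proof.
move=> fA UA AK; have [t t0 tK] := widened_cube (normr_ge0 (\det A)) AK.
have [M M0 MA] := mulmx_bound (invmx A).
(* Multiplication by A^-1 costs a factor M, so on a cube of side s the error becomes at most t s.
   The box is widened by that much on either side, whence the factor 1 + 2 t. *)
have := fA (t / M); rewrite divr_gt0// => /(_ isT)/nbhs_ballP[d /= d0 H].
have [j0 Hj] := dyadic_small d0.
exists j0 => j j0j; set s : R := 2 ^- j.
have s0 : 0 < s by rewrite invr_gt0 exprn_gt0.
pose a : 'rV[R]_n := \row_i (s * (dyadic_index j x 0 i)%:~R - x 0 i - t * s).
pose b : 'rV[R]_n := \row_i (s * (dyadic_index j x 0 i + 1)%:~R - x 0 i + t * s).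
have [mW WE] := lebesgueRn_parallelepiped (f x) UA (measurable_box a b).
exists [set y | box a b ((y - f x) *m invmx A)]; split=> //.
  move=> _ [y xy <-] /=; rewrite boxE /= => i.
  have yb : ball x d y by apply: cube_at_ball xy; exact: Hj.
  have yx : `|y - x| <= s.
    by apply: ler_mxnorm => [|k l]; [exact: ltW|rewrite ord1 !mxE; exact: ltW (cube_at_dist l xy)].
  pose e := (f y - f x - (y - x) *m A) *m invmx A.
  have ee : `|e| <= t * s.
    apply: le_trans (MA _) _; rewrite -ler_pdivlMl// mulrA (mulrC M^-1).
    apply: le_trans (H _ yb) _; rewrite ler_wpM2l// divr_ge0// ltW//.
  have -> : (f y - f x) *m invmx A = y - x + e.
    by rewrite /e [in RHS]mulmxBl mulmxK// [RHS]addrC subrK.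
  clearbody e.
  have ei : `|e 0 i| <= t * s by apply: le_trans (ler_entry_mxnorm _ _ _) ee.
  move: xy; rewrite /cube_at cubeE boxE => /(_ i); rewrite /= !mxE -/s => /andP[y1 y2].
  move: ei; rewrite ler_norml => /andP[e1 e2]; rewrite -/s in y1 y2; apply/andP; split; lra.
rewrite WE lebesgueRn_box => [|i]; last first.
  rewrite !mxE intrD mulrDr.
  have : 0 <= t * s by rewrite mulr_ge0// ltW.
  by move: s0; lra.
rewrite lebesgueRn_cube -!EFinM lee_fin -/s.
have -> : \prod_i (b 0 i - a 0 i) = ((1 + 2 * t) * s) ^+ n.
  transitivity (\prod_(i < n) ((1 + 2 * t) * s)); last by rewrite prodr_const card_ord.
  by apply: eq_bigr => i _; rewrite !mxE intrD; ring.
by rewrite exprMn mulrA ler_wpM2r// exprn_ge0// ltW.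
Qed.

(** W measures f(E) from outside, f(E) itself being possibly nonmeasurable; f has to be
    differentiable at the points of E alone. *)
Lemma jacobian_cover (f : V -> V) (E U : set V) (K : R) : open U -> E `<=` U -> 0 <= K ->
  (forall x, E x -> exists A : 'M[R]_n, [/\ approx f x A, A \in unitmx & `|\det A| < K]) ->
  exists W : set BV, [/\ measurable W, f @` E `<=` W & (mu W <= K%:E * mu U)%E].
Proof.
move=> oU EU K0 H; apply: cube_cover => //; first exact: borel_open.
move=> x Ex; have [A [fA UA AK]] := H x Ex.
have [j0 H0] := approx_cube fA UA AK; have [j1 H1] := cube_at_open oU (EU _ Ex).
exists (maxn j0 j1); split; first by apply: H1; exact: leq_maxr.
have [W [mW fW WK]] := H0 _ (leq_maxl j0 j1); exists W; split=> //.
by apply: subset_trans fW; apply: image_subset => y [].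
Qed.

End cube_covering.

(** * Regularity of Lebesgue measure and images of null sets *)

Section regularity.
Context {R : realType} {n : nat}.
Local Notation V := 'rV[R]_n.
Local Notation BV := (borelRn R n).
Local Notation mu := (@lebesgueRn R n).

(* Symmetric in S and its complement, which makes stability under complements
   immediate. *)
Definition sandwiched (m : set BV -> \bar R) (S : set V) : Prop :=
  forall e : R, 0 < e -> exists U C : set V,
    [/\ open U, open C, S `<=` U, ~` S `<=` C & (m (U `&` C) < e%:E)%E].

Lemma nonincreasing_lt (m : {measure set BV -> \bar R}) (F : nat -> set V) (e : R) :
  (m setT < +oo)%E -> (forall i, open (F i)) ->
  measurable (\bigcap_i F i : set BV) ->
  {homo F : i j / (i <= j)%N >-> (j <= i)%O} -> (m (\bigcap_i F i) < e%:E)%E ->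
  exists i, (m (F i) < e%:E)%E.
Proof.
move=> mfin oF mF dF me.
have mFi i : measurable (F i : set BV) by exact: borel_open.
have := @nonincreasing_cvg_mu _ _ _ m F (le_lt_trans (le_measure _ _ _ (@subsetT _ _)) mfin) mFi mF dF.
rewrite !inE => /(_ (mFi 0%N) measurableT) H.
have fl : Filter (\oo : set_system nat) by exact: eventually_filter.
have : \forall i \near \oo, (m (F i) < e%:E)%E.
  by apply: (H [set x | (x < e%:E)%E]); apply: open_nbhs_nbhs; split => //; exact: open_ereal_lt_ereal.
by case=> N _ /(_ N (leqnn N)) ?; exists N.
Qed.

(** The open neighbourhoods of the complement of radius 1 / (k + 1) meet S in sets that decrease to
    the empty set; finiteness of m gives continuity from above. *)
Lemma sandwiched_open (m : {measure set BV -> \bar R}) (S : set V) :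
  (m setT < +oo)%E -> open S -> sandwiched m S.
Proof.
move=> mfin oS e e0.
pose C (k : nat) : set V := \bigcup_(y in ~` S) ball y (k.+1%:R^-1 : R).
have oC k : open (C k) by apply: bigcup_open => y _; exact: ball_open.
have k0 (k : nat) : 0 < k.+1%:R^-1 :> R by rewrite invr_gt0 ltr0n.
have E : \bigcap_k (S `&` C k) = set0.
  rewrite -subset0 => x Cx; have Sx : S x by have [] := Cx 0%N I.
  have /nbhs_ballP[r /= r0 rS] : nbhs x S by exact: open_nbhs_nbhs.
  have [k _ /(_ k (leqnn k)) kr] := near_infty_natSinv_lt (PosNum r0).
  have [_ [y Sy yx]] := Cx k I; apply: Sy; apply: rS.
  by apply: ball_sym; apply: le_ball yx; exact: ltW.
have [||||k mk] := @nonincreasing_lt m (fun k => S `&` C k) e mfin.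
- by move=> k; exact: openI.
- by rewrite E; exact: measurable0.
- move=> i j ij; apply/subsetPset => x [Sx [y Sy yx]]; split => //; exists y => //.
  by apply: le_ball yx; rewrite lef_pV2 ?posrE// ler_nat.
- by rewrite E measure0 lte_fin.
by exists S, (C k); split => // y Sy; exists y => //; exact: ballxx.
Qed.

(** The complement of the union lies in every C i, but an infinite intersection of open sets need
    not be open. The finite intersections D k are used, and continuity from above brings the measure
    of the overlap below e for some k. *)
Lemma sandwiched_bigcup (m : {measure set BV -> \bar R}) (S : nat -> set V) :
  (m setT < +oo)%E -> (forall i, sandwiched m (S i)) -> sandwiched m (\bigcup_i S i).
Proof.
move=> mfin sS e e0; have e20 : 0 < e / 2 by rewrite divr_gt0.
have /choice[U /choice[C UC]] : forall i, exists U C : set V,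
    [/\ open U, open C, S i `<=` U, ~` S i `<=` C & (m (U `&` C) < (e / 2 / (2 ^ i.+1)%:R)%:E)%E].
  by move=> i; apply: sS; rewrite divr_gt0// ltr0n expn_gt0.
pose W := \bigcup_i U i.
have oW : open W by apply: bigcup_open => i _; have [] := UC i.
pose D k : set V := \bigcap_(i in [set i | (i <= k)%N]) C i.
have oD k : open (D k).
  have -> : D k = \bigcap_(i in `I_k.+1) C i by [].
  rewrite bigcap_mkord; elim/big_ind: _ => [|A B|i _]; [exact: openT|exact: openI|].
  by have [] := UC i.
have E : \bigcap_k (W `&` D k) `<=` \bigcup_i (U i `&` C i).
  move=> x H; have [[i _ Ux] _] := H 0%N I; exists i => //; split => //.
  by have [_] := H i I; apply => /=.
have mUC i : measurable (U i `&` C i : set BV).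
  by have [oU oC _ _ _] := UC i; apply: borel_open; exact: openI.
have mI : measurable (\bigcap_k (W `&` D k) : set BV).
  by apply: bigcapT_measurable => k; apply: borel_open; exact: openI.
have [||||k mk] := @nonincreasing_lt m (fun k => W `&` D k) e mfin.
- by move=> k; exact: openI.
- exact: mI.
- move=> i j ij; apply/subsetPset => x [Wx Dx]; split => // l /= li; apply: Dx => /=.
  exact: leq_trans li ij.
- apply: (@le_lt_trans _ _ (e / 2)%:E); last by rewrite lte_fin ltr_pdivrMr// mulr_natr mulr2n ltrDl.
  apply: (le_trans (measure_sigma_subadditive m mUC mI E)).
  apply: le_trans (epsilon_trick0 predT (ltW e20)).
  by apply: lee_nneseries => [i _ _|i _]; [exact: measure_ge0|have [_ _ _ _ /ltW] := UC i].
exists W, (D k); split => //.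
  by move=> x [i _ Sx]; exists i => //; have [_ _ + _ _] := UC i; apply.
by move=> x Sx i _; have [_ _ _ + _] := UC i; apply => Six; apply: Sx; exists i.
Qed.

Lemma measurable_sandwiched (m : {measure set BV -> \bar R}) (S : set BV) :
  (m setT < +oo)%E -> measurable S -> sandwiched m S.
Proof.
move=> mfin; suff : <<s (@open V) >> `<=` sandwiched m by apply.
apply: smallest_sub => [|U oU]; last exact: sandwiched_open.
split=> [|A sA e /sA[U [C [oU oC AU AC mUC]]]|A sA].
- by apply: sandwiched_open => //; exact: open0.
- by exists C, U; rewrite setIC setTD setCK.
- exact: sandwiched_bigcup.
Qed.

(** Sandwiching asks for a finite measure, so it is applied to the restriction to a ball. Inside the
    ball U exceeds the null set A only within the overlap of U and C. *)
Lemma negligible_open_cover (N : set BV) (r e : R) : mu.-negligible N -> 0 < r -> 0 < e ->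
  exists U : set V, [/\ open U, N `&` ball (0 : V) r `<=` U & (mu U <= e%:E)%E].
Proof.
move=> [A [mA A0 NA]] r0 e0; pose B : set BV := ball (0 : V) r.
have mB : measurable B by apply: borel_open; exact: ball_open.
pose m : {measure set BV -> \bar R} := mrestr mu mB.
have mfin : (m setT < +oo)%E by rewrite /m /= /mrestr setTI; exact: lebesgueRn_ball.
have [U [C [oU oC AU AC mUC]]] := measurable_sandwiched mfin mA e0.
exists (U `&` B); split; first by apply: openI => //; exact: ball_open.
  by move=> x [/NA/AU].
have mm (S : set V) : open S -> measurable (S : set BV) by exact: borel_open.
apply: (@le_trans _ _ (mu (A `|` (U `&` C `&` B)))).
  apply: le_measure; rewrite ?inE.
  - by apply: mm; apply: openI => //; exact: ball_open.
  - by apply: measurableU => //; apply: measurableI => //; apply: measurableI; exact: mm.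
  by move=> x [Ux Bx]; have [Ax|Ax] := pselect (A x); [left|right; do 2?split => //; exact: AC].
apply: le_trans (measureU2 _ _ _) _ => //.
  by apply: measurableI => //; apply: measurableI; exact: mm.
by rewrite [X in (X + _)%E](_ : _ = 0%E)// add0e; exact: ltW.
Qed.

(** N is cut into countably many pieces on which the norm and the determinant are bounded by k + 1;
    each piece has open neighbourhoods of small measure, and the covering estimate multiplies this
    measure by k + 1 only. *)
Lemma null_image (N : set BV) (f : V -> V) : mu.-negligible N ->
  (forall x, N x -> exists A : 'M[R]_n, approx f x A /\ A \in unitmx) ->
  mu.-negligible (f @` N).
Proof.
move=> nN H.
pose E k : set V := [set x | N x /\ ball (0 : V) k.+1%:R x /\
  exists A : 'M[R]_n, [/\ approx f x A, A \in unitmx & `|\det A| < k.+1%:R]].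
have -> : f @` N = \bigcup_k (f @` E k).
  apply/seteqP; split => [_ [x Nx <-]|_ [k _ [x [Nx _] <-]]]; last by exists x.
  have [A [fA UA]] := H x Nx.
  pose t := Num.max `|x| `|\det A|; pose k := Num.truncn t; have tk : t < k.+1%:R.
    exact: truncnS_gt.
  exists k => //; exists x => //; split => //; split.
    by rewrite -ball_normE /= sub0r normrN; apply: le_lt_trans tk; rewrite le_max lexx.
  by exists A; split => //; apply: le_lt_trans tk; rewrite le_max lexx orbT.
apply: negligible_bigcup => k.
have k0 : 0 < k.+1%:R :> R by rewrite ltr0n.
have /choice[W HW] : forall i : nat, exists W : set BV,
    [/\ measurable W, f @` E k `<=` W & (mu W <= (i.+1%:R^-1)%:E)%E].
  move=> i; have e0 : 0 < i.+1%:R^-1 / k.+1%:R :> R by rewrite divr_gt0// invr_gt0 ltr0n.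
  have [U [oU NU mUe]] := negligible_open_cover nN k0 e0.
  have [|||W [mW fW WK]] := @jacobian_cover R n f (E k) U k.+1%:R oU.
  - by move=> x [Nx [Bx _]]; exact: NU.
  - exact: ltW.
  - by move=> x [_ [_]].
  exists W; split => //; apply: (le_trans WK); apply: (le_trans (lee_wpmul2l _ mUe)).
    by rewrite lee_fin ltW.
  by rewrite -EFinM mulrC divfK// gt_eqF.
have mW : measurable (\bigcap_i W i) by apply: bigcapT_measurable => i; have [] := HW i.
exists (\bigcap_i W i); split => //; last by move=> y fy i _; have [_ + _] := HW i; apply.
apply/eqP; rewrite eq_le measure_ge0 andbT; apply/lee_addgt0Pr => e e0; rewrite add0e.
have [i _ /(_ i (leqnn i)) ie] := near_infty_natSinv_lt (PosNum e0).
have [mWi _ Wi] := HW i; apply: le_trans (le_trans Wi _); last by rewrite lee_fin ltW.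
by apply: le_measure; rewrite ?inE// => y; apply.
Qed.

End regularity.

(** * Change of variables for maps with Jacobian of modulus 1 *)

Section change_of_variables.
Context {R : realType} {n : nat}.
Local Notation V := 'rV[R]_n.
Local Notation BV := (borelRn R n).
Local Notation mu := (@lebesgueRn R n).

(** One half of a measure preserving bijection between open sets; the other half is the same
    statement with maps and domains exchanged. The derivative is only asked to exist at each
    point. *)
Definition unimodular_on (D D' : set V) (q p : V -> V) : Prop :=
  open D /\ forall x, D x -> [/\ D' (q x), p (q x) = x &
    exists A : 'M[R]_n, approx q x A /\ `|\det A| = 1].

Lemma unimodular_continuous D D' q p : unimodular_on D D' q p ->
  forall x, D x -> {for x, continuous q}.
Proof. by move=> [_ H] x /H[_ _ [A [qA _]]]; exact: approx_continuous qA. Qed.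

(** The covering estimate for p takes a constant strictly above the determinant, here r^-1 with r <
    1, and then r tends to 1. *)
Lemma unimodular_open_le D D' q p (S : set V) :
  unimodular_on D D' q p -> unimodular_on D' D p q -> open S ->
  (mu (D `&` q @^-1` S) <= mu (D' `&` S))%E.
Proof.
move=> DD' D'D oS; have oDq : open (D `&` q @^-1` S).
  by apply: open_preimage (unimodular_continuous DD') oS; exact: DD'.1.
have oD'S : open (D' `&` S) by apply: openI oS; exact: D'D.1.
apply/(lee_mul01Pr _ (measure_ge0 _ _)) => r /andP[r0 r1].
have K1 : 1 < r^-1 by rewrite invf_gt1.
have [|||W [mW fW WK]] := @jacobian_cover R n p (D' `&` S) (D' `&` S) r^-1 oD'S.
- by [].
- by rewrite invr_ge0 ltW.
- move=> x [D'x _]; have [_ _ [A [pA dA]]] := D'D.2 _ D'x; exists A; split; rewrite ?dA//.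
  by rewrite unitmxE unitfE -normr_gt0 dA.
have h : (mu (D `&` q @^-1` S) <= r^-1%:E * mu (D' `&` S))%E.
  apply: le_trans WK; apply: le_measure; rewrite ?inE//; first exact: borel_open.
  move=> x [Dx Sqx]; apply: fW; have [D'q pq _] := DD'.2 _ Dx.
  by exists (q x).
apply: le_trans (lee_wpmul2l _ h) _; first by rewrite lee_fin ltW.
by rewrite muleA -EFinM mulfV ?gt_eqF// mul1e.
Qed.

Lemma unimodular_open D D' q p (S : set V) :
  unimodular_on D D' q p -> unimodular_on D' D p q -> open S ->
  mu (D `&` q @^-1` S) = mu (D' `&` S).
Proof.
move=> DD' D'D oS; apply/eqP; rewrite eq_le (unimodular_open_le DD' D'D)//=.
have oDq : open (D `&` q @^-1` S).
  by apply: open_preimage (unimodular_continuous DD') oS; exact: DD'.1.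
have := unimodular_open_le D'D DD' oDq; congr (mu _ <= mu _)%E.
  apply/seteqP; split => [x [D'x [_ /= +]]|x [D'x Sx]].
    by have [_ -> _] := D'D.2 _ D'x.
  by have [Dp qp _] := D'D.2 _ D'x; split => //; split => //=; rewrite qp.
by apply/seteqP; split => [x [_ //]|x [Dx Sx]].
Qed.

Section transfer.
Variables (D D' : set V) (q p : V -> V).
Hypotheses (DD' : unimodular_on D D' q p) (D'D : unimodular_on D' D p q).

Let mD : measurable (D : set BV). Proof. by apply: borel_open; exact: DD'.1. Qed.
Let mD' : measurable (D' : set BV). Proof. by apply: borel_open; exact: D'D.1. Qed.

Let mq : measurable_fun (D : set BV) (q : BV -> BV).
Proof. by apply: open_measurable_map (unimodular_continuous DD'); exact: DD'.1. Qed.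

(** q is extended off D by a default value so as to become a total measurable map; the restriction
    of mu to D does not see the extension. *)
Let qT : BV -> BV := (q : BV -> BV) \_ (D : set BV).

Let mqT : measurable_fun setT qT.
Proof. exact: ((measurable_restrictT _ mD).1 mq). Qed.

Let nu : {measure set BV -> \bar R}.
Proof.
unshelve refine (pushforward (mrestr mu mD) qT : {measure set BV -> \bar R}).
exact: mqT.
Defined.

Let nuE (S : set BV) : nu S = mu (D `&` q @^-1` S).
Proof.
rewrite /nu /= /pushforward /mrestr; congr (mu _).
apply/seteqP; split => x [] /=; rewrite /qT patchE.
  by move=> + Dx; rewrite mem_set.
by move=> Dx; rewrite mem_set.
Qed.

(** Both sides are measures in S that agree on open sets, a generating pi-system, and are finite on
    balls. *)
Lemma unimodular_measure (S : set BV) : measurable S ->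
  mu (D `&` q @^-1` S) = mu (D' `&` S).
Proof.
move=> mS; rewrite -nuE.
have -> : mu (D' `&` S) = mrestr mu mD' S by rewrite /mrestr setIC.
have eqo (U : set V) : open U -> nu U = mrestr mu mD' U.
  by move=> oU; rewrite nuE (unimodular_open DD' D'D)// /mrestr setIC.
apply: (@g_sigma_algebra_measure_unique _ _ BV (@open V) _ (fun k => ball (0 : V) k.+1%:R)
  _ _ nu (mrestr mu mD') _ eqo).
- by move=> U; exact: borel_open.
- by move=> k; exact: ball_open.
- rewrite -subTset => v _; exists (Num.truncn `|v : V|) => //=.
  by rewrite -ball_normE /= sub0r normrN; exact: truncnS_gt.
- by move=> A B; exact: openI.
- move=> k; rewrite eqo; last exact: ball_open.
  apply: le_lt_trans (lebesgueRn_ball n (ltr0Sn R k)).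
  rewrite /mrestr; apply: le_measure; rewrite ?inE; last exact: subIsetl.
    by apply: measurableI => //; apply: borel_open; exact: ball_open.
  by apply: borel_open; exact: ball_open.
- exact: mS.
Qed.

Lemma ge0_change_of_variables (f : BV -> \bar R) : measurable_fun (D' : set BV) f ->
  (forall y, (0 <= f y)%E) ->
  (\int[mu]_(y in D') f y = \int[mu]_(x in D) f (q x))%E.
Proof.
move=> mf f0; transitivity (\int[nu]_(y in D') f y)%E.
  apply: eq_measure_integral => A mA AD' /=; rewrite nuE unimodular_measure//.
  by congr (mu _); apply/esym/setIidr.
rewrite ge0_integral_pushforward//.
have mqD' : measurable (qT @^-1` D') by rewrite -[X in measurable X]setTI; exact: mqT.
rewrite (@ge0_negligible_integral _ _ _ _ _ (~` (D : set BV))).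
- have E : qT @^-1` D' `\` ~` D = D.
    apply/seteqP; split => [x [_ /contrapT]//|x Dx]; split => /=; last by apply.
    by rewrite /qT patchE mem_set//; have [] := DD'.2 _ Dx.
  rewrite E; transitivity (\int[mu]_(x in D) (f \o qT) x)%E.
    by apply: eq_measure_integral => A mA AD; rewrite /= /mrestr; congr (mu _); exact: setIidl.
  by apply: eq_integral => x xD; rewrite /= /qT patchE xD.
- exact: measurableC.
- exact: mqD'.
- apply: (measurable_comp mD' _ mf) => [_ [x + <-]//|].
  exact: measurable_funS mqT.
- by move=> x _; exact: f0.
- by rewrite /= /mrestr setICl measure0.
Qed.

Lemma change_of_variables (f : BV -> \bar R) : measurable_fun (D' : set BV) f ->
  (\int[mu]_(y in D') f y = \int[mu]_(x in D) f (q x))%E.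
Proof.
move=> mf; rewrite [LHS]integralE [RHS]integralE.
rewrite (funepos_comp f q) (funeneg_comp f q); congr (_ - _)%E.
  apply: (@ge0_change_of_variables (f^\+)%E) => [|y]; last exact: funepos_ge0.
  exact: measurable_funepos.
apply: (@ge0_change_of_variables (f^\-)%E) => [|y]; last exact: funeneg_ge0.
exact: measurable_funeneg.
Qed.

Lemma measurable_transfer (f : BV -> R) : measurable_fun (D' : set BV) f ->
  measurable_fun (D : set BV) (f \o q).
Proof.
move=> mf; apply: (measurable_comp mD' _ mf mq) => _ [x Dx <-].
by have [] := DD'.2 _ Dx.
Qed.

Lemma integrable_transfer (f : BV -> R) : mu.-integrable D' (EFin \o f) ->
  mu.-integrable D (EFin \o (f \o q)).
Proof.
move=> /integrableP[mf fD']; have mfR := (measurable_EFinP _ _).1 mf.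
apply/integrableP; split.
  by apply/measurable_EFinP; exact: measurable_transfer.
apply: le_lt_trans fD'; rewrite -(@ge0_change_of_variables (fun y => `|(EFin \o f) y|%E))//.
exact: measurableT_comp.
Qed.

Lemma Rintegral_transfer (f : BV -> R) : measurable_fun (D' : set BV) f ->
  Rintegral mu D (f \o q) = Rintegral mu D' f.
Proof.
by move=> mf; rewrite /Rintegral (change_of_variables (f := EFin \o f))//; exact/measurable_EFinP.
Qed.

End transfer.
End change_of_variables.

Section measurable_derivative.
Context {R : realType} {m k : nat}.
Local Notation BV := (borelRn R m).

(** An entry of the Jacobian is a limit of difference quotients with step 1 / (l + 1). The component
    of q is extended by a default value since the shifted point may leave D; D being open, this
    stops for large l. *)
Lemma measurable_jacobian (D : set 'rV[R]_m) (q : 'rV[R]_m -> 'rV[R]_k) i j : open D ->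
  (forall x, D x -> exists A, approx q x A) ->
  measurable_fun (D : set BV) (fun x => 'J q x i j).
Proof.
move=> oD qA; have mD : measurable (D : set BV) by exact: borel_open.
pose F : BV -> R := (fun x : BV => q x 0 j) \_ (D : set BV).
have mF : measurable_fun setT F.
  apply/(measurable_restrictT _ mD); apply: open_measurable_real oD _ => x Dx.
  have [A /approx_continuous cq] := qA x Dx.
  have := @continuous_comp _ _ _ q (fun y : 'rV[R]_k => y 0 j) x cq; apply.
  exact: (@coord_continuous _ _ _ 0 j (q x)).
pose e (l : nat) : 'rV[R]_m := l.+1%:R^-1 *: delta_mx 0 i.
pose h (l : nat) (x : BV) : R := l.+1%:R * (F ((x : 'rV[R]_m) + e l) - F x).
apply: (@measurable_fun_cvg _ _ _ _ h) => [l|x Dx].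
  apply: measurable_funTS; apply: measurable_funM; first exact: measurable_cst.
  apply: measurable_funB => //.
  have ms : measurable_fun setT ((fun x : 'rV[R]_m => x + e l) : BV -> BV).
    by have [_ cs _] := scales_shift (e l); exact: continuous_measurable_map cs.
  exact: (measurableT_comp mF ms).
have [A fA] := qA x Dx; rewrite (approx_jacobian fA).
have fl : Filter (\oo : set_system nat) by exact: eventually_filter.
apply/cvgrPdist_le => r r0.
have /nbhs_ballP[d /= d0 H] := fA r r0.
have /nbhs_ballP[d' /= d'0 H'] : nbhs (x : 'rV[R]_m) D by exact: open_nbhs_nbhs.
near=> l; pose z : 'rV[R]_m := (x : 'rV[R]_m) + e l.
have l0 : 0 < l.+1%:R :> R by rewrite ltr0n.
have zx : z - x = e l by rewrite /z addrC addKr.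
have el : `|e l| <= l.+1%:R^-1.
  rewrite /e normrZ gtr0_norm ?invr_gt0// ler_piMr ?invr_ge0//.
  by apply: ler_mxnorm => // a b; rewrite mxE; case: (_ && _); rewrite ?normr1 ?normr0.
have dl : l.+1%:R^-1 < Num.min d d'.
  near: l; have dd0 : 0 < Num.min d d' by rewrite lt_min d0.
  exact: (near_infty_natSinv_lt (PosNum dd0)).
have zb (s : R) : l.+1%:R^-1 < s -> ball (x : 'rV[R]_m) s z.
  move=> ld; rewrite -ball_normE /= distrC zx; exact: le_lt_trans el ld.
have Dz : D z by apply: H'; apply: zb; apply: lt_le_trans dl _; rewrite ge_min lexx orbT.
have zd : ball (x : 'rV[R]_m) d z by apply: zb; apply: lt_le_trans dl _; rewrite ge_min lexx.
have := H z zd.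
rewrite zx => Hz; rewrite /h /F !patchE !mem_set//.
have := le_trans (ler_entry_mxnorm _ 0 j) Hz.
have -> : (q z - q x - e l *m A) 0 j = (q z 0 j - q x 0 j) - l.+1%:R^-1 * A i j.
  by rewrite /e -scalemxAl -rowE !mxE.
rewrite distrC => Hj; rewrite -(ler_pM2l (_ : 0 < l.+1%:R^-1)) ?invr_gt0//.
rewrite -{1}(gtr0_norm (_ : 0 < l.+1%:R^-1)) ?invr_gt0// -normrM mulrBr mulKf ?gt_eqF//.
apply: le_trans Hj _; rewrite mulrC; apply: ler_wpM2r el; exact: ltW.
Unshelve. all: by end_near. Qed.

End measurable_derivative.

(** * Symplectomorphisms and embeddings *)

Section strict_composition.
Context {R : realType} {m n p : nat}.

Lemma strict_approx_comp (f : 'rV[R]_m -> 'rV[R]_n) (g : 'rV[R]_n -> 'rV[R]_p) x A B :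
  strict_approx f x A -> strict_approx g (f x) B -> strict_approx (g \o f) x (A *m B).
Proof.
move=> fA gB e e0; have [K K0 KA] := mulmx_bound A; have [L L0 LB] := mulmx_bound B.
(* Strict differentiability with error 1 gives f the Lipschitz constant K + 1 near x, and L bounds
   B; each of the two error terms then receives e / 2. *)
have a0 : 0 < e / (2 * (K + 1)) by rewrite divr_gt0// mulr_gt0// addr_gt0.
have b0 : 0 < e / (2 * L) by rewrite divr_gt0// mulr_gt0.
have [d d0 H] := gB _ a0; have [d1 d10 H1] := fA _ b0; have [d2 d20 H2] := fA _ (ltr01 : 0 < 1 :> R).
have cf : {for x, continuous f} := approx_continuous (strict_approxW fA).
have /nbhs_ballP[d3 /= d30 H3] : nbhs x (f @^-1` ball (f x) d) by apply: cf; exact: nbhsx_ballx.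
pose r := Num.min d1 (Num.min d2 d3).
have r1 : r <= d1 by rewrite ge_min lexx.
have r2 : r <= d2 by rewrite !ge_min lexx !orbT.
have r3 : r <= d3 by rewrite !ge_min lexx !orbT.
exists r; first by rewrite !lt_min d10 d20.
move=> y z xy xz.
have fyz : `|f z - f y| <= (K + 1) * `|z - y|.
  have := H2 y z (le_ball r2 xy) (le_ball r2 xz); rewrite mul1r => h.
  rewrite -[f z - f y](subrK ((z - y) *m A)) mulrDl mul1r addrC.
  by apply: le_trans (ler_normD _ _) _; apply: lerD => //; exact: KA.
have h1 := H (f y) (f z) (H3 _ (le_ball r3 xy)) (H3 _ (le_ball r3 xz)).
have h2 := H1 y z (le_ball r1 xy) (le_ball r1 xz).
have -> : (g \o f) z - (g \o f) y - (z - y) *m (A *m B) =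
    (g (f z) - g (f y) - (f z - f y) *m B) + (f z - f y - (z - y) *m A) *m B.
  by rewrite [X in _ = _ + X]mulmxBl mulmxA addrA subrK.
apply: le_trans (ler_normD _ _) _; rewrite [e in e * _]splitr mulrDl; apply: lerD.
  apply: le_trans h1 _; apply: le_trans (ler_wpM2l (ltW a0) fyz) _.
  rewrite mulrA [X in X * _](_ : _ = e / 2)//.
  by field; rewrite gt_eqF ?addr_gt0.
apply: le_trans (LB _) _; apply: le_trans (ler_wpM2l (ltW L0) h2) _.
rewrite mulrA [X in X * _](_ : _ = e / 2)//.
by field; rewrite gt_eqF.
Qed.

End strict_composition.

(** * The group of symplectomorphisms *)

Section symplectomorphism_group.
Context {R : realType} {n : nat} (M : symplectic_manifold R n).
Local Notation V := 'rV[R]_(n + n).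
Local Notation c := (@sm_chart R n M).
Local Notation w := (@sm_form R n M).

Lemma local_dom_open (g : M -> M) i j : continuous g -> open (local_dom (c i) (c j) g).
Proof.
move=> cg; have -> : local_dom (c i) (c j) g =
    chart_cod (c i) `&` chart_inv (c i) @^-1` (g @^-1` chart_dom (c j)) by [].
apply: open_preimage; first exact: chart_cod_open.
  exact: chart_inv_continuous.
by apply: open_comp => [x _|]; [exact: cg|exact: chart_dom_open].
Qed.

Lemma local_dom_chart (g : M -> M) i j z : chart_dom (c i) z -> chart_dom (c j) (g z) ->
  local_dom (c i) (c j) g (c i z).
Proof. by move=> iz jz; split; [exact: chart_homo|rewrite chart_funK]. Qed.

Lemma local_expr_chart (g : M -> M) i j z : chart_dom (c i) z ->
  local_expr (c i) (c j) g (c i z) = c j (g z).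
Proof. by move=> iz; rewrite /local_expr chart_funK. Qed.

Lemma local_expr_strict g i j x : smooth_self_map g -> preserves_form g ->
  local_dom (c i) (c j) g x ->
  let A := 'J (local_expr (c i) (c j) g) x in
  strict_approx (local_expr (c i) (c j) g) x A /\
  A *m w j (local_expr (c i) (c j) g x) *m A^T = w i x.
Proof.
move=> [cg sg] pg xd A; have od := @local_dom_open g i j cg.
have sA := smooth_map_strict od xd (sg i j).
have EA := approx_jacobian (strict_approxW sA); rewrite -EA in sA; split => //.
by have := pg i j x xd; rewrite /pullback_form /jacobi trmxK.
Qed.

Lemma smooth_self_map_id : smooth_self_map (id : M -> M).
Proof. by split; [move=> x; exact: cvg_id|exact: sm_smooth]. Qed.

Lemma preserves_form_id : preserves_form (id : M -> M).
Proof. by move=> i j x; exact: sm_form_compat. Qed.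

(** Smoothness is checked near each point z, where the composite factors through a chart around h
    z. *)
Lemma smooth_self_map_comp (g h : M -> M) :
  smooth_self_map g -> smooth_self_map h -> smooth_self_map (g \o h).
Proof.
move=> [cg sg] [ch sh].
have cgh : continuous (g \o h) by move=> x; apply: continuous_comp; [exact: ch|exact: cg].
split=> // i j l; apply: smooth_fun_cover => x xd.
pose z := chart_inv (c i) x; have [k kz] := sm_cover (h z).
pose W := local_dom (c i) (c j) (g \o h) `&` local_dom (c i) (c k) h.
have oW : open W by apply: openI; exact: local_dom_open.
have Wx : W x by split => //; split => //; exact: xd.1.
have WV y : W y -> local_dom (c k) (c j) g (local_expr (c i) (c k) h y).
  by move=> [[_ jy] [_ ky]]; exact: local_dom_chart.
exists W; split => //.
have sW : smooth_map W (local_expr (c i) (c k) h).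
  by move=> l'; apply: smooth_fun_sub (sh i k l') => y [].
have := smooth_map_comp oW (@local_dom_open g k j cg) WV sW (sg k j) => /(_ l).
apply: eq_smooth_fun => // y [_ [_ ky]].
by rewrite /= [local_expr (c i) (c k) h y]/local_expr local_expr_chart.
Qed.

Lemma preserves_form_comp (g h : M -> M) : smooth_self_map g -> smooth_self_map h ->
  preserves_form g -> preserves_form h -> preserves_form (g \o h).
Proof.
move=> sg sh pg ph i j x xd; have [cx jx] := xd.
pose z := chart_inv (c i) x; have [k kz] := sm_cover (h z).
have xk : local_dom (c i) (c k) h x by split.
have yj : local_dom (c k) (c j) g (c k (h z)) by exact: local_dom_chart.
have [hA Aw] := local_expr_strict sh ph xk; have [gB Bw] := local_expr_strict sg pg yj.
move: hA Aw gB Bw; set A := 'J _ x; set B := 'J _ _; move=> hA Aw gB Bw.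
have ap : approx (local_expr (c i) (c j) (g \o h)) x (A *m B).
  apply: approx_near (approx_comp (strict_approxW hA) (strict_approxW gB)).
  apply: (open_nearP (@local_dom_open h i k sh.1) xk) => y [_ ky].
  by rewrite /= [local_expr (c i) (c k) h y]/local_expr local_expr_chart.
rewrite /pullback_form /jacobi (approx_jacobian ap) trmxK trmx_mul !mulmxA.
by rewrite -Aw -Bw local_expr_chart// !mulmxA.
Qed.

(** Near x the local expressions of h and g compose to the identity, so their derivatives are
    inverse to each other and the relation for g can be solved for the one for h. *)
Lemma preserves_form_inverse (g h : M -> M) : cancel g h -> cancel h g ->
  smooth_self_map g -> smooth_self_map h -> preserves_form g -> preserves_form h.
Proof.
move=> gh hg sg sh pg i j x xd; have [cx jx] := xd.
pose z := h (chart_inv (c i) x).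
have yi : local_dom (c j) (c i) g (c j z).
  by apply: local_dom_chart => //; rewrite hg; exact: chart_inv_homo.
have [gB Bw] := local_expr_strict sg pg yi.
have sA := smooth_map_strict (@local_dom_open h i j sh.1) xd (sh.2 i j).
move: gB Bw; set B := 'J _ _; move=> gB Bw.
have E : local_expr (c j) (c i) g (c j z) = x by rewrite local_expr_chart// hg chart_invK.
rewrite E in Bw.
move: sA; set A := jac_mx _ _; move=> sA.
have ap : approx (id : V -> V) x (A *m B).
  apply: approx_near (approx_comp (strict_approxW sA) (strict_approxW gB)).
  apply: (open_nearP (@local_dom_open h i j sh.1) xd) => y [cy jy].
  by rewrite /= [local_expr (c i) (c j) h y]/local_expr local_expr_chart// hg chart_invK.
have AB : A *m B = 1%:M by rewrite -(approx_jacobian ap) (approx_jacobian (approx_id x)).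
rewrite /pullback_form /jacobi (approx_jacobian (strict_approxW sA)) trmxK.
rewrite -[local_expr _ _ _ _]/(c j z) -Bw !mulmxA AB mul1mx -mulmxA -trmx_mul AB.
by rewrite trmx1 mulmx1.
Qed.

Lemma Symp_id : Symp M id.
Proof.
split; last 1 first.
- have -> : [set x : M | id x <> x] = set0 by rewrite -subset0 => x /(_ erefl).
  by rewrite closure0; exact: compact0.
- by exists id; split => //; exact: smooth_self_map_id.
- exact: preserves_form_id.
Qed.

Lemma Symp_comp g1 g2 : Symp M g1 -> Symp M g2 -> Symp M (g1 \o g2).
Proof.
move=> [[h1 [gh1 hg1 sg1 sh1]] p1 k1] [[h2 [gh2 hg2 sg2 sh2]] p2 k2]; split.
- exists (h2 \o h1); split; [exact: can_comp|exact: can_comp| |]; exact: smooth_self_map_comp.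
- exact: preserves_form_comp.
apply: subclosed_compact (compactU k1 k2) _; first exact: closed_closure.
rewrite -closureU; apply: closure_subset => x /= H.
by have [E|E] := pselect (g2 x = x); [left; rewrite -{1}E|right].
Qed.

Lemma Symp_inverse g : Symp M g -> exists h, [/\ Symp M h, cancel g h & cancel h g].
Proof.
move=> [[h [gh hg sg sh]] pg kg]; exists h; split => //; split.
- by exists g; split.
- exact: (@preserves_form_inverse g h).
apply: subclosed_compact kg _; first exact: closed_closure.
by apply: closure_subset => x /= hx gx; apply: hx; rewrite -{1}gx gh.
Qed.

Lemma Symp_group : is_group (Symp M) (fun g1 g2 : M -> M => g1 \o g2).
Proof.
split=> //; first exact: Symp_comp.
exists id; split=> [|//|g /Symp_inverse[h [Sh gh hg]]]; first exact: Symp_id.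
by exists h; split=> //; apply/funext => x /=.
Qed.

End symplectomorphism_group.

(** * Embedded frames and changes of frame *)

Section embeddings.
Context {R : realType} {n : nat} (M : symplectic_manifold R n).
Local Notation V := 'rV[R]_(n + n).
Local Notation BV := (borelRn R (n + n)).
Local Notation mu := (@lebesgueRn R (n + n)).
Local Notation c := (@sm_chart R n M).
Local Notation w := (@sm_form R n M).
Local Notation Om := (@std_form R n).

Lemma strict_approx_near (f g : V -> V) (x : V) A (U : set V) : open U -> U x ->
  (forall y, U y -> f y = g y) -> strict_approx f x A -> strict_approx g x A.
Proof.
move=> oU Ux fg fA e /fA[d d0 H].
have /nbhs_ballP[r /= r0 rU] : nbhs x U by exact: open_nbhs_nbhs.
exists (Num.min d r); first by rewrite lt_min d0.
have rd : Num.min d r <= d by rewrite ge_min lexx.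
have rr : Num.min d r <= r by rewrite ge_min lexx orbT.
move=> y z xy xz; rewrite -!fg; [|exact/rU/(le_ball rr)|exact/rU/(le_ball rr)].
by apply: H; exact: le_ball rd _ _.
Qed.

Lemma std_form_unit : Om \in unitmx.
Proof.
have : Om *m (- Om) = 1%:M by rewrite mulmxN std_form_sqr opprK.
by move=> /mulmx1_unit[].
Qed.

Lemma congruent_unit (A W : 'M[R]_(n + n)) : A *m W *m A^T = Om -> A \in unitmx.
Proof.
move=> E; have := std_form_unit; rewrite -E unitmxE !det_mulmx !unitfE !mulf_eq0.
by rewrite !negb_or -andbA unitmxE unitfE => /andP[].
Qed.

Lemma symplectic_det (A : 'M[R]_(n + n)) : A *m Om *m A^T = Om -> `|\det A| = 1.
Proof.
move=> /(congr1 determinant); rewrite !det_mulmx det_tr => /eqP.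
rewrite mulrAC -subr_eq0 -[X in _ - X]mul1r -mulrBl mulf_eq0 => /orP[|].
  by rewrite -expr2 subr_eq0 sqrf_eq1 => /orP[] /eqP ->; rewrite ?normrN1 ?normr1.
by have := std_form_unit; rewrite unitmxE unitfE => /negPf ->.
Qed.

(** The atlas may be uncountable. A countable base is used instead: each basic open set contained in
    some chart domain contributes one negligible piece. *)
Lemma negligible_charts (E : set BV) (f : V -> M) :
  (forall i, mu.-negligible (E `&` f @^-1` chart_dom (c i))) -> mu.-negligible E.
Proof.
move=> H; have [B /countable_injP[nu nu_inj] [oB bB]] := sm_second_countable M.
pose F k : set BV := [set x | E x /\ exists b, [/\ B b, nu b = k, b (f x) &
  exists i, b `<=` chart_dom (c i)]].
have -> : E = \bigcup_k F k.
  apply/seteqP; split => [x Ex|x [k _ []]//].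
  have [i ix] := sm_cover (f x).
  have : nbhs (f x) (chart_dom (c i)) by apply: open_nbhs_nbhs; split => //; exact: chart_dom_open.
  move=> /(bB (f x))[b [Bb bx] bi]; exists (nu b) => //; split => //; exists b; split => //.
  by exists i.
apply: negligible_bigcup => k.
have [[b [Bb bk [i bi]]]|no] := pselect (exists b, [/\ B b, nu b = k & exists i, b `<=` chart_dom (c i)]).
  apply: negligibleS (H i) => x [Ex [b' [Bb' b'k b'x _]]]; split => //; apply: bi.
  by rewrite -(_ : b' = b)//; apply: nu_inj; rewrite ?inE// b'k.
have -> : F k = set0; last exact: negligible_set0.
by rewrite -subset0 => x [_ [b [Bb bk _ bi]]]; apply: no; exists b.
Qed.

Definition frame := (set V * (V -> M))%type.

Implicit Types F : frame.

(** A form of the embedding hypotheses that passes from iota to the composite of a symplectomorphism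
    with iota, so that symplectomorphisms can be absorbed into frames. The derivative A acts on
    rows, hence A w A^T. *)
Definition embeds (F : frame) : Prop :=
  [/\ open F.1, {in F.1 &, injective F.2}, (forall x, F.1 x -> {for x, continuous F.2}) &
    forall j x, F.1 x -> chart_dom (c j) (F.2 x) -> exists A,
      strict_approx (c j \o F.2) x A /\ A *m w j (c j (F.2 x)) *m A^T = Om].

Definition shift_dom (F F' : frame) : set V := F.1 `&` F.2 @^-1` (F'.2 @` F'.1).

(** The change of frame iota'^-1 iota. Applied to a first frame already composed with g, it becomes
    the transported map iota'^-1 g iota. *)
Definition shift (F F' : frame) : V -> V := 'pinv_(fun=> 0) F'.1 F'.2 \o F.2.

Lemma embeds_chart_open F (S : set M) : embeds F -> open S -> open (F.1 `&` F.2 @^-1` S).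
Proof. by move=> [oF _ cF _] oS; exact: open_preimage. Qed.

Lemma embeds_full Omega iota : full_embedding (M := M) Omega iota -> embeds (Omega, iota).
Proof.
move=> [oO [inj cont _ smooth _ form] _]; split => //= j x Ox jx.
have oW : open (Omega `&` iota @^-1` chart_dom (c j)).
  by apply: open_preimage => //; exact: chart_dom_open.
have sA := smooth_map_strict oW (conj Ox jx) (smooth j).
exists (jac_mx (c j \o iota) x); split => //.
have := form j x Ox jx; rewrite /pullback_form /jacobi.
by rewrite (approx_jacobian (strict_approxW sA)) trmxK.
Qed.

Lemma embeds_symp F g : embeds F -> Symp M g -> embeds (F.1, g \o F.2).
Proof.
move=> eF [[h [gh hg sg sh]] pg _]; have [oF inj cF HF] := eF; split => //=.
- by move=> x y Fx Fy /(can_inj gh); exact: inj.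
- by move=> x Fx; apply: continuous_comp; [exact: cF|exact: sg.1].
move=> j x Fx jx; have [i ix] := sm_cover (F.2 x).
have [A [fA Aw]] := HF i x Fx ix.
have [gB Bw] := local_expr_strict sg pg (local_dom_chart ix jx).
move: gB Bw; set B := 'J _ _; move=> gB Bw; exists (A *m B); split; last first.
  by rewrite trmx_mul !mulmxA -Aw -Bw local_expr_chart// !mulmxA.
apply: strict_approx_near (strict_approx_comp fA gB).
- exact: (embeds_chart_open eF (chart_dom_open (c i))).
- by split.
- by move=> y [Fy iy]; rewrite /= local_expr_chart.
Qed.

Lemma embeds_pinv F x : embeds F -> F.1 x -> 'pinv_(fun=> 0 : V) F.1 F.2 (F.2 x) = x.
Proof. by move=> [_ inj _ _] Fx; apply: pinvKV => //; rewrite inE. Qed.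

Lemma embeds_pinvK F y : (F.2 @` F.1) y ->
  F.1 ('pinv_(fun=> 0 : V) F.1 F.2 y) /\ F.2 ('pinv_(fun=> 0 : V) F.1 F.2 y) = y.
Proof.
move=> Fy; split; last by apply: pinvK; rewrite inE.
have Fs : set_surj F.1 (F.2 @` F.1) F.2 by exact: subset_refl.
by apply: (surjpinv_image_sub (dflt := fun=> 0 : V) Fs); exists y.
Qed.

Lemma embeds_inverse F j x : embeds F -> F.1 x -> chart_dom (c j) (F.2 x) -> exists A,
  approx ('pinv_(fun=> 0 : V) F.1 F.2 \o chart_inv (c j)) (c j (F.2 x)) (invmx A) /\
  A *m w j (c j (F.2 x)) *m A^T = Om.
Proof.
move=> eF Fx jx; have [_ _ _ /(_ j x Fx jx)[A [fA Aw]]] := eF; exists A; split => //.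
apply: (approx_inverse fA (congruent_unit Aw) (embeds_chart_open eF (chart_dom_open (c j)))).
  by split.
by move=> z [Fz jz] /=; rewrite chart_funK// embeds_pinv.
Qed.

(** In a chart the derivative is invertible because it carries the form to the standard one, so the
    image of a small ball is a neighbourhood. *)
Lemma embeds_image_open F : embeds F -> open (F.2 @` F.1).
Proof.
move=> eF; rewrite openE => _ [x Fx <-]; have [j jx] := sm_cover (F.2 x).
have [oF _ _ /(_ j x Fx jx)[A [fA Aw]]] := eF.
have /nbhs_ballP[r /= r0 rU] : nbhs x (F.1 `&` F.2 @^-1` chart_dom (c j)).
  apply: open_nbhs_nbhs; split; last by split.
  exact: (embeds_chart_open eF (chart_dom_open (c j))).
have H := strict_approx_open fA (congruent_unit Aw) r0.
have nb : nbhs (F.2 x) (chart_dom (c j) `&` c j @^-1` ((c j \o F.2) @` ball x r)).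
  apply: filterI; first by apply: open_nbhs_nbhs; split => //; exact: chart_dom_open.
  exact: (chart_continuous jx H).
apply: filterS nb => y [jy [z xz E]]; have [Fz jz] := rU z xz.
by exists z => //; rewrite -(chart_funK jz) -(chart_funK jy); congr (chart_inv _ _).
Qed.

Lemma shift_dom_open F F' : embeds F -> embeds F' -> open (shift_dom F F').
Proof. by move=> eF /embeds_image_open; exact: embeds_chart_open. Qed.

(** If A and B are the derivatives of the two frames in a chart at the common image point, both
    carry the form there to the standard one; it drops out of A B^-1. *)
Lemma shift_approx F F' m : embeds F -> embeds F' -> shift_dom F F' m ->
  exists A, approx (shift F F') m A /\ A *m Om *m A^T = Om.
Proof.
move=> eF eF' [Fm F'm]; have [F'y Ey] := embeds_pinvK F'm; set y := 'pinv_ _ _ _ _ in F'y Ey.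
have [j jm] := sm_cover (F.2 m); have jy : chart_dom (c j) (F'.2 y) by rewrite Ey.
have [_ _ _ /(_ j m Fm jm)[A [fA Aw]]] := eF.
have [B [gB Bw]] := embeds_inverse eF' F'y jy; rewrite Ey in gB Bw.
have UB := congruent_unit Bw; exists (A *m invmx B); split.
  apply: approx_near (approx_comp (strict_approxW fA) gB).
  apply: (open_nearP (embeds_chart_open eF (chart_dom_open (c j)))); first by split.
  by move=> z [Fz jz]; rewrite /= chart_funK.
rewrite trmx_mul -{1}Bw !mulmxA mulmxKV// -(mulmxA _ B^T) -trmx_mul mulVmx// trmx1 mulmx1.
exact: Aw.
Qed.

Lemma shift_unimodular F F' : embeds F -> embeds F' ->
  unimodular_on (shift_dom F F') (shift_dom F' F) (shift F F') (shift F' F).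
Proof.
move=> eF eF'; split=> [|m Fm]; first exact: shift_dom_open.
have [F'y Ey] := embeds_pinvK Fm.2; split.
- by split => //; rewrite /= Ey; exists m => //; exact: Fm.1.
- by rewrite /shift /= Ey embeds_pinv//; exact: Fm.1.
by have [A [fA As]] := shift_approx eF eF' Fm; exists A; split => //; exact: symplectic_det.
Qed.

(** The points missed map under F into the complement of the image of F', which is null in every
    chart. They are recovered from their charts by the inverse of F, whose derivative is invertible,
    so [null_image] applies. *)
Lemma shift_dom_null F F' : embeds F -> Defs.null_set (M := M) (~` (F'.2 @` F'.1)) ->
  mu.-negligible (F.1 `\` shift_dom F F').
Proof.
move=> eF nF'; apply: (negligible_charts (f := F.2)) => j.
pose Z := ~` (F'.2 @` F'.1) `&` chart_dom (c j).
pose N : set BV := c j @` (Z `&` F.2 @` F.1).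
have nN : mu.-negligible N.
  by apply: negligibleS (nF' j) => _ [y [Zy _] <-]; exists y.
pose H := 'pinv_(fun=> 0 : V) F.1 F.2 \o chart_inv (c j).
apply: negligibleS (null_image (f := H) nN _).
  move=> x [[Fx nx] jx]; exists (c j (F.2 x)).
    exists (F.2 x) => //; split; last by exists x.
    by split => // F'x; apply: nx; split.
  by rewrite /H /= chart_funK// embeds_pinv.
move=> _ [z [[_ jx] [x Fx E]] <-]; rewrite -E in jx *; have [A [hA Aw]] := embeds_inverse eF Fx jx.
by exists (invmx A); split => //; rewrite unitmx_inv; exact: congruent_unit Aw.
Qed.

End embeddings.

(** If P K failed, the sets S such that P holds for K minus S would form a proper filter containing
    K; a cluster point of it in K contradicts the local hypothesis there. *)
Lemma compact_local (T : topologicalType) (P : set T -> Prop) (K : set T) :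
  P set0 -> (forall A B, P A -> P B -> P (A `|` B)) ->
  (forall A B, A `<=` B -> P B -> P A) ->
  (forall x : T, exists U : set T, nbhs x U /\ P U) -> compact K -> P K.
Proof.
move=> P0 PU PS Ploc cK; pose F : set_system T := [set S | P (K `\` S)].
have FF : Filter F.
  split; first by rewrite /F /= setDT.
    by move=> A B FA FB; rewrite /F /= setDIr; exact: PU.
  by move=> A B AB; apply: PS => x [Kx Bx]; split => // /AB.
apply: contrapT => nPK.
have PF : ProperFilter F.
  by apply: Build_ProperFilter_ex => A FA; apply: contrapT => nA; apply: nPK; apply: PS FA => x Kx;
    split => // Ax; apply: nA; exists x.
have [x [Kx clx]] : K `&` cluster F !=set0 by apply: cK; rewrite /F /= setDv.
have [U [Ux PU']] := Ploc x.
have FU : F (~` U) by rewrite /F /= setDE setCK; apply: PS PU'; exact: subIsetr.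
by have [y [nUy Uy]] := clx _ _ FU Ux.
Qed.

Lemma det_bound (R : realType) m (A : 'M[R]_m) (C : R) : (forall i j, `|A i j| <= C) ->
  `|\det A| <= \sum_(s : 'S_m) \prod_(i < m) C.
Proof.
move=> AC; apply: le_trans (ler_norm_sum _ _ _) _; apply: ler_sum => s _.
rewrite normrM normrX normrN1 expr1n mul1r normr_prod; apply: ler_prod => i _.
by rewrite normr_ge0 AC.
Qed.

(** * Finite measure over compact sets *)

Section finiteness.
Context {R : realType} {n : nat} (M : symplectic_manifold R n).
Local Notation V := 'rV[R]_(n + n).
Local Notation BV := (borelRn R (n + n)).
Local Notation mu := (@lebesgueRn R (n + n)).
Local Notation c := (@sm_chart R n M).
Local Notation w := (@sm_form R n M).
Local Notation Om := (@std_form R n).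
Implicit Types F : frame M.

Lemma form_bounded j p : chart_cod (c j) p -> exists C : R,
  \forall z \near p, forall a b, `|w j z a b| <= C.
Proof.
move=> jp; exists (`|w j p| + 1).
have [sm _ _ _] := sm_symplectic (s := M) j.
apply: (@filter_forall _ _ (fun a z => forall b, `|w j z a b| <= _) (nbhs p)) => a.
apply: (@filter_forall _ _ (fun b z => `|w j z a b| <= _) (nbhs p)) => b.
have [cw _] := sm a b [::] p jp.
have /cvgrPdist_le/(_ 1 ltr01) := cw; apply: filterS => z /= h.
rewrite -[w j z a b](subrK (w j p a b)) addrC.
apply: le_trans (ler_normD _ _) _; apply: lerD; first exact: ler_entry_mxnorm.
by rewrite distrC.
Qed.

Lemma mu_ball_fin (p : V) r : (mu (ball p r : set BV) < +oo)%E.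
Proof.
have s0 : 0 < `|p| + `|r| + 1 by rewrite ltr_wpDl// addr_ge0.
apply: le_lt_trans (lebesgueRn_ball _ s0); apply: le_measure; rewrite ?inE.
- by apply: borel_open; exact: ball_open.
- by apply: borel_open; exact: ball_open.
move=> z; rewrite -!ball_normE /= sub0r normrN => pz.
rewrite -[z](subrK p) addrC; apply: le_lt_trans (ler_normD _ _) _.
rewrite -addrA ltrD2l distrC; apply: lt_le_trans pz _.
by apply: le_trans (ler_norm r) _; rewrite lerDl.
Qed.

(** By A w A^T = Om, the inverse of the frame in a chart has a Jacobian whose square is |det w| /
    |det Om|. Since w is continuous this is bounded near each point, and the preimage of a small
    chart ball has finite measure; compactness then applies. *)
Lemma embeds_compact_finite F (K : set M) : embeds F -> compact K ->
  exists W : set BV, [/\ measurable W, F.1 `&` F.2 @^-1` K `<=` W & (mu W < +oo)%E].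
Proof.
move=> eF; apply: (compact_local (P := fun S => exists W : set BV,
    [/\ measurable W, F.1 `&` F.2 @^-1` S `<=` W & (mu W < +oo)%E])).
- by exists set0; split=> [|x []|]; [exact: measurable0| |rewrite measure0 ltry].
- move=> A B [W [mW AW Wf]] [W' [mW' BW' Wf']]; exists (W `|` W'); split.
  + exact: measurableU.
  + by move=> x [Fx [Ax|Bx]]; [left; exact: AW|right; exact: BW'].
  + by apply: le_lt_trans (measureU2 _ mW mW') _; exact: lte_add_pinfty.
- by move=> A B AB [W [mW BW Wf]]; exists W; split => // x [Fx Ax]; apply: BW; split => //; exact: AB.
move=> y; have [j jy] := sm_cover y; have cp := chart_homo jy.
have [C wC] := form_bounded cp.
have nc : nbhs (c j y) (chart_cod (c j)) by apply: open_nbhs_nbhs; split => //; exact: chart_cod_open.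
have /nbhs_ballP[r /= r0 rU] : nbhs (c j y : V)
    (chart_cod (c j) `&` [set z | forall a b, `|w j z a b| <= C]) by exact: filterI.
pose T := \sum_(s : 'S_(n + n)) \prod_(i < n + n) C.
have d0 : 0 < `|\det Om| by rewrite normr_gt0 -unitfE -unitmxE; exact: std_form_unit.
have T0 : 0 <= T by apply: le_trans (det_bound (rU _ (ballxx _ r0)).2).
have Td : 0 <= T / `|\det Om| by rewrite divr_ge0// ltW.
pose P : set V := ball (c j y) r `&` (c j) @` (chart_dom (c j) `&` F.2 @` F.1).
pose H := 'pinv_(fun=> 0 : V) F.1 F.2 \o chart_inv (c j).
(* T bounds |det w| on the ball, so the square of the Jacobian is at most u = T / |det Om|; since u
   + 1 exceeds every x with x^2 <= u, it serves as the strict bound. *)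
have [||||W [mW HW WK]] := @jacobian_cover R (n + n) H P (ball (c j y) r) (T / `|\det Om| + 1).
- exact: ball_open.
- by move=> z [].
- by rewrite addr_ge0.
- move=> z' [bz [z [jz [x Fx xz]] zz']]; rewrite -zz' -xz in bz *; rewrite -xz in jz.
  have [A [hA Aw]] := embeds_inverse eF Fx jz.
  have UA := congruent_unit Aw.
  exists (invmx A); split => //; first by rewrite unitmx_inv.
  have [_ /det_bound wT] := rU _ bz.
  have := congr1 (fun B => `|\det B|) Aw; rewrite !det_mulmx det_tr !normrM det_inv normfV.
  have a0 : 0 < `|\det A| by rewrite normr_gt0 -unitfE -unitmxE.
  move: wT a0 Td d0; rewrite -/T; move: `|\det A| `|\det Om| `|\det (w j _)| => a d t tT a0 Td d0 E.
  have t0 : t != 0 by apply/eqP => t0; move: d0; rewrite -E t0 mulr0 mul0r ltxx.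
  have E2 : a^-1 * a^-1 = t / d by rewrite -E; field; rewrite t0 gt_eqF.
  have tT' : t / d <= T / d by rewrite ler_pM2r ?invr_gt0.
  rewrite ltNge; apply/negP => h.
  have ia0 : 0 < a^-1 by rewrite invr_gt0.
  move: E2 tT' Td h ia0; move: (T / d) (t / d) (a^-1) => u v b *; nra.
exists (chart_dom (c j) `&` c j @^-1` ball (c j y) r); split.
  apply: filterI; first by apply: open_nbhs_nbhs; split => //; exact: chart_dom_open.
  by apply: (chart_continuous jy); exact: nbhsx_ballx.
exists W; split => //.
  move=> x [Fx [jx bx]]; apply: HW; exists (c j (F.2 x)).
    by split => //; exists (F.2 x) => //; split => //; exists x.
  by rewrite /H /= chart_funK// embeds_pinv.
by apply: le_lt_trans WK _; rewrite lte_mul_pinfty ?lee_fin ?addr_ge0//; exact: mu_ball_fin.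
Qed.

End finiteness.

(** * The cocycle on the symplectomorphism group *)

Section integration.
Context {R : realType} {m : nat}.
Local Notation BV := (borelRn R m).
Local Notation mu := (@lebesgueRn R m).

Lemma Rintegral_conull (D D0 : set BV) (f : BV -> R) : measurable D -> measurable D0 ->
  D0 `<=` D -> mu.-negligible (D `\` D0) -> mu.-integrable D (EFin \o f) ->
  Rintegral mu D f = Rintegral mu D0 f.
Proof.
move=> mD mD0 D0D nD fD; have mN : measurable (D `\` D0) by exact: measurableD.
rewrite /Rintegral (negligible_integral mN mD fD (measure_negligible mN nD)).
by rewrite setDD setIidr.
Qed.

Lemma bounded_integrable (D W : set BV) (f : BV -> R) (b : R) : measurable D -> measurable W ->
  (mu W < +oo)%E -> measurable_fun D f -> (forall x, D x -> `|f x| <= b) ->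
  (forall x, D x -> ~ W x -> f x = 0) -> mu.-integrable D (EFin \o f).
Proof.
move=> mD mW Wf mf fb f0; have mDW : measurable (D `&` W) by exact: measurableI.
apply/(integrable_mkcond _ mD).
have -> : (EFin \o f) \_ D = (EFin \o f) \_ (D `&` W).
  apply/funext => x; rewrite !patchE in_setI.
  have [/set_mem Dx|//] := boolP (x \in D); rewrite /=.
  by have [//|/negP Wx] := boolP (x \in W); rewrite f0// => /mem_set.
apply: (integrable_mkcond _ mDW).1; apply: measurable_bounded_integrable => //.
- by apply: le_lt_trans Wf; apply: le_measure; rewrite ?inE//; exact: subIsetr.
- by apply: measurable_funS mf => //; exact: subIsetl.
exists b; split; first exact: num_real.
by move=> y yb x [Dx _]; apply: le_trans (fb _ Dx) _; exact: ltW.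
Qed.

Lemma unimodular_restrict (D D' S : set 'rV[R]_m) q p : unimodular_on D D' q p ->
  unimodular_on D' D p q -> open S ->
  unimodular_on (D `&` q @^-1` S) (D' `&` S) q p /\ unimodular_on (D' `&` S) (D `&` q @^-1` S) p q.
Proof.
move=> [oD HD] [oD' HD'] oS; split; split.
- apply: open_preimage => // x Dx; exact: (unimodular_continuous (conj oD HD) Dx).
- by move=> x [Dx Sx]; have [D'q pq A] := HD x Dx; split.
- exact: openI.
- by move=> x [Dx Sx]; have [Dp qp A] := HD' x Dx; split => //; split => //=; rewrite qp.
Qed.

End integration.

(** * Symplectomorphisms as arrows between frames *)

Section arrows.
Context {R : realType} {n : nat} (M : symplectic_manifold R n).
Local Notation V := 'rV[R]_(n + n).
Local Notation BV := (borelRn R (n + n)).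
Local Notation mu := (@lebesgueRn R (n + n)).
Local Notation Om := (@std_form R n).
Implicit Types (F : frame M) (g h : M -> M).

Definition full_frame F : Prop := embeds F /\ Defs.null_set (M := M) (~` (F.2 @` F.1)).

(** With F = F' this is a transported symplectomorphism, with g the identity a change of frame.
    Arrows compose like the maps they come from, off null sets, so one chain rule and one cocycle
    identity serve for both. *)
Definition arrow F F' g : V -> V := shift (F.1, g \o F.2) F'.

Definition arrow_dom F F' g : set V := shift_dom (F.1, g \o F.2) F'.

Definition jac F F' g (m : V) := jacobi (arrow F F' g) m.

Lemma arrow_dom_open F F' g : full_frame F -> full_frame F' -> Symp M g ->
  open (arrow_dom F F' g).
Proof. by move=> [eF _] [eF' _] Sg; apply: shift_dom_open => //; exact: embeds_symp. Qed.

Lemma arrow_dom_null F F' g : full_frame F -> full_frame F' -> Symp M g ->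
  mu.-negligible (F.1 `\` arrow_dom F F' g).
Proof.
by move=> [eF _] [_ nF'] Sg; apply: (@shift_dom_null _ _ _ (F.1, g \o F.2)) => //; exact: embeds_symp.
Qed.

Lemma arrowK F F' g m : arrow_dom F F' g m ->
  F'.1 (arrow F F' g m) /\ F'.2 (arrow F F' g m) = g (F.2 m).
Proof. by move=> [_ H]; exact: embeds_pinvK H. Qed.

Lemma arrow_dom_comp F F' F'' g h m : arrow_dom F F' g m ->
  arrow_dom F' F'' h (arrow F F' g m) <-> arrow_dom F F'' (h \o g) m.
Proof.
move=> gm; have [F'm E] := arrowK gm; have [Fm _] := gm.
by rewrite /arrow_dom /shift_dom /= E; split => -[_ H]; split.
Qed.

Lemma arrow_comp F F' F'' g h m : arrow_dom F F' g m ->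
  arrow F' F'' h (arrow F F' g m) = arrow F F'' (h \o g) m.
Proof. by move=> gm; have [_ E] := arrowK gm; rewrite /arrow /shift /= -[in RHS]E. Qed.

Lemma arrow_approx F F' g m : full_frame F -> full_frame F' -> Symp M g ->
  arrow_dom F F' g m ->
  approx (arrow F F' g) m (jac F F' g m)^T /\ symplectic (jac F F' g m).
Proof.
move=> [eF _] [eF' _] Sg gm; have [A [qA As]] := shift_approx (embeds_symp eF Sg) eF' gm.
by rewrite /jac /jacobi /symplectic (approx_jacobian qA) !trmxK.
Qed.

Lemma jac_comp F F' F'' g h m : full_frame F -> full_frame F' -> full_frame F'' ->
  Symp M g -> Symp M h -> arrow_dom F F' g m -> arrow_dom F F'' (h \o g) m ->
  jac F F'' (h \o g) m = jac F' F'' h (arrow F F' g m) *m jac F F' g m.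
Proof.
move=> fF fF' fF'' Sg Sh gm hgm; have hm := (arrow_dom_comp F'' h gm).2 hgm.
have [gA _] := arrow_approx fF fF' Sg gm; have [hA _] := arrow_approx fF' fF'' Sh hm.
have ap : approx (arrow F F'' (h \o g)) m
    ((jac F F' g m)^T *m (jac F' F'' h (arrow F F' g m))^T).
  apply: approx_near (approx_comp gA hA).
  by apply: (open_nearP (arrow_dom_open fF fF' Sg) gm) => z gz; exact: arrow_comp.
by rewrite [LHS]/jac /jacobi (approx_jacobian ap) -trmx_mul trmxK.
Qed.

(** Off the closure of the moved points g is the identity on an open set, which determines the
    derivative and not just the value. *)
Lemma jac_local_id F g m : full_frame F -> Symp M g -> F.1 m ->
  ~ closure [set x | g x <> x] (F.2 m) -> arrow_dom F F g m /\ jac F F g m = 1%:M.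
Proof.
move=> [eF nF] Sg Fm ncl; have [oF _ cF _] := eF.
pose U : set M := ~` closure [set x | g x <> x].
have oU : open U by rewrite openC; exact: closed_closure.
have gU x : U x -> g x = x by move=> Ux; apply: contrapT => gx; apply: Ux; exact: subset_closure.
have gm : g (F.2 m) = F.2 m by exact: gU.
split; first by split => //=; rewrite gm; exists m.
have ap : approx (arrow F F g) m 1%:M.
  apply: approx_near (approx_id m); apply: (open_nearP (embeds_chart_open eF oU)); first by split.
  by move=> z [Fz Uz]; rewrite /arrow /shift /= gU// embeds_pinv.
by rewrite /jac /jacobi (approx_jacobian ap) trmx1.
Qed.

(** The maps are listed in the order of application: the integrand of C(g1, g2) has g2 in front of
    g1. *)
Definition berezin_arrows F F' F'' g h (m : V) : R :=
  berezin (jac F' F'' h (arrow F F' g m)) (jac F F' g m).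

Lemma berezin_arrows_bound F F' F'' g h m : full_frame F -> full_frame F' -> full_frame F'' ->
  Symp M g -> Symp M h -> arrow_dom F F' g m -> arrow_dom F F'' (h \o g) m ->
  `|berezin_arrows F F' F'' g h m| <= n%:R * (pi / 2).
Proof.
move=> fF fF' fF'' Sg Sh gm hgm; have hm := (arrow_dom_comp F'' h gm).2 hgm.
apply: berezin_bound; first by have [] := arrow_approx fF' fF'' Sh hm.
by have [] := arrow_approx fF fF' Sg gm.
Qed.

Lemma measurable_jac F F' g i j : full_frame F -> full_frame F' -> Symp M g ->
  measurable_fun (arrow_dom F F' g : set BV) (fun m => jac F F' g m i j).
Proof.
move=> fF fF' Sg; have -> : (fun m => jac F F' g m i j) = (fun m => 'J (arrow F F' g) m j i).
  by apply/funext => m; rewrite /jac /jacobi mxE.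
apply: measurable_jacobian; first exact: arrow_dom_open.
by move=> m gm; have [gA _] := arrow_approx fF fF' Sg gm; eexists; exact: gA.
Qed.

Lemma measurable_berezin_arrows F F' F'' g h (D : set BV) :
  full_frame F -> full_frame F' -> full_frame F'' ->
  Symp M g -> Symp M h -> measurable D ->
  D `<=` arrow_dom F F' g `&` arrow_dom F F'' (h \o g) ->
  measurable_fun D (berezin_arrows F F' F'' g h).
Proof.
move=> fF fF' fF'' Sg Sh mD DS.
have hm x : D x -> arrow_dom F' F'' h (arrow F F' g x).
  by move=> /DS[gx hgx]; exact: (arrow_dom_comp F'' h gx).2.
apply: measurable_berezin => [x Dx|x Dx|i j|i j].
- by have [] := arrow_approx fF' fF'' Sh (hm x Dx).
- by have [] := arrow_approx fF fF' Sg (DS x Dx).1.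
- have mo : measurable (arrow_dom F' F'' h : set BV) by apply: borel_open; exact: arrow_dom_open.
  apply: (measurable_comp mo _ (measurable_jac i j fF' fF'' Sh)) => [_ [x Dx <-]|].
    exact: hm.
  have oD := arrow_dom_open fF fF' Sg.
  apply: (measurable_funS (borel_open oD)) (open_measurable_map oD _) => [x /DS[]//|x gx].
  by have [/approx_continuous] := arrow_approx fF fF' Sg gx.
- have oD := arrow_dom_open fF fF' Sg.
  by apply: measurable_funS (borel_open oD) _ (measurable_jac i j fF fF' Sg) => x /DS[].
Qed.

Lemma berezin_arrows_cocycle F F' F'' F3 g1 g2 g3 m : full_frame F -> full_frame F' ->
  full_frame F'' -> full_frame F3 -> Symp M g1 -> Symp M g2 -> Symp M g3 ->
  arrow_dom F F' g1 m -> arrow_dom F F'' (g2 \o g1) m -> arrow_dom F F3 (g3 \o (g2 \o g1)) m ->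
  berezin_arrows F' F'' F3 g2 g3 (arrow F F' g1 m) + berezin_arrows F F' F3 g1 (g3 \o g2) m =
  berezin_arrows F F'' F3 (g2 \o g1) g3 m + berezin_arrows F F' F'' g1 g2 m.
Proof.
move=> fF fF' fF'' fF3 S1 S2 S3 m1 m2 m3.
have p2 := (arrow_dom_comp F'' g2 m1).2 m2.
have p3 := (arrow_dom_comp F3 (g3 \o g2) m1).2 m3.
have r3 := (arrow_dom_comp F3 g3 m2).2 m3.
have [_ s1] := arrow_approx fF fF' S1 m1; have [_ s2] := arrow_approx fF' fF'' S2 p2.
have [_ s3] := arrow_approx fF'' fF3 S3 r3.
have := berezin_cocycle s3 s2 s1; rewrite /berezin_arrows (jac_comp fF fF' fF'' S1 S2 m1 m2).
by rewrite (jac_comp fF' fF'' fF3 S2 S3 p2 p3) (arrow_comp F'' g2 m1).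
Qed.

(** D0 is left free so that all terms of an identity can be integrated over one conull set. The
    points of S that the arrow misses form a null set, as the arrow of the inverse symplectomorphism
    shows. *)
Lemma arrow_transfer F F' g (S D0 : set V) (f : BV -> R) : full_frame F -> full_frame F' ->
  Symp M g -> open S -> S `<=` F'.1 -> mu.-negligible (F'.1 `\` S) ->
  mu.-integrable S (EFin \o f) -> open D0 -> D0 `<=` arrow_dom F F' g ->
  (forall m, D0 m -> S (arrow F F' g m)) -> mu.-negligible (F.1 `\` D0) ->
  mu.-integrable D0 (EFin \o (f \o arrow F F' g)) /\
  Rintegral mu D0 (f \o arrow F F' g) = Rintegral mu S f.
Proof.
move=> fF fF' Sg oS SF' nS fS oD0 D0D D0S nD0; have [h [Sh gh hg]] := Symp_inverse Sg.
have eg : embeds (F.1, g \o F.2) := embeds_symp fF.1 Sg.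
pose D' := shift_dom F' (F.1, g \o F.2).
have D'E : D' = arrow_dom F' F h.
  apply/seteqP; split=> m [F'm [x Fx E]]; split => //; exists x => //=.
    by rewrite -E /= gh.
  by rewrite /= E /= hg.
have nD' : mu.-negligible (F'.1 `\` D') by rewrite D'E; exact: arrow_dom_null.
have [U1 U2] := unimodular_restrict (shift_unimodular eg fF'.1) (shift_unimodular fF'.1 eg) oS.
set q := shift _ _ in U1 U2; set D1 := _ `&` q @^-1` S in U1 U2.
have mD1 : measurable (D1 : set BV) by apply: borel_open; exact: U1.1.
have mD2 : measurable (D' `&` S : set BV) by apply: borel_open; exact: U2.1.
have mD0 : measurable (D0 : set BV) by exact: borel_open.
have mS : measurable (S : set BV) by exact: borel_open.
have fD2 : mu.-integrable (D' `&` S) (EFin \o f) by apply: integrableS fS => //; exact: subIsetr.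
have fD1 := integrable_transfer U1 U2 fD2.
have D01 : D0 `<=` D1 by move=> x D0x; split; [exact: D0D|exact: D0S].
split; first exact: integrableS fD1.
rewrite -(@Rintegral_conull _ _ D1 D0 (f \o q))//; last first.
  by apply: negligibleS nD0 => x [[[Fx _] _] D0x].
have mf : measurable_fun (D' `&` S : set BV) f.
  by apply/measurable_EFinP; exact: measurable_int fD2.
rewrite (Rintegral_transfer U1 U2 mf) -(@Rintegral_conull _ _ S (D' `&` S) f)//.
apply: negligibleS nD' => x [Sx nx]; split; first exact: SF'.
by move=> D'x; apply: nx.
Qed.

Lemma support_integrable F g (D : set BV) (f : BV -> R) b : full_frame F -> Symp M g ->
  measurable D -> D `<=` F.1 -> measurable_fun D f -> (forall m, D m -> `|f m| <= b) ->
  (forall m, D m -> ~ closure [set x | g x <> x] (F.2 m) -> f m = 0) ->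
  mu.-integrable D (EFin \o f).
Proof.
move=> [eF _] [_ _ cg] mD DF mf fb f0.
have [W [mW FW Wf]] := embeds_compact_finite eF cg.
apply: (bounded_integrable mD mW Wf mf fb) => m Dm nW; apply: f0 => // cl.
by apply: nW; apply: FW; split => //; exact: DF.
Qed.

End arrows.

Lemma extension_group (T : Type) (G : set T) (op : T -> T -> T) (A : zmodType) (e : T)
    (c : T -> T -> A) : is_group G op -> G e ->
  (forall x, G x -> op e x = x /\ op x e = x) -> is_cocycle2 G op e c ->
  is_group (G `*` [set: A]) (extension_mul op c).
Proof.
move=> [opG opA [e' [Ge' e'1 inv]]] Ge e1 [c1 cc].
have ee' : e' = e by rewrite -(e1 e' Ge').1 (e'1 e Ge).2.
rewrite {}ee' in e'1 inv; clear Ge'.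
split=> [[x a] [y b] [/= Gx _] [/= Gy _]|[x a] [y b] [z d] [/= Gx _] [/= Gy _] [/= Gz _]|].
- by split => //=; exact: opG.
- rewrite /extension_mul /= opA//; congr pair.
  have := cc x y z Gx Gy Gz => E.
  rewrite -!addrA; congr (a + (b + _)).
  by rewrite [RHS]addrCA E [c y z + _]addrC.
exists (e, 0); split => [|[x a] [/= Gx _]|[x a] [/= Gx _]].
- by split.
- have [E1 E2] := e1 x Gx; have [c1x cx1] := c1 x Gx.
  by rewrite /extension_mul /= E1 E2 c1x cx1 add0r !addr0.
have [y [Gy xy yx]] := inv x Gx.
(* The cocycle identity at x, y, x makes these agree, so one element is inverse on both sides. *)
have cxy : c x y = c y x.
  have := cc x y x Gx Gy Gx; rewrite xy yx (c1 x Gx).1 (c1 x Gx).2 addr0 add0r.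
  by [].
exists (y, - a - c x y); split => //; rewrite /extension_mul /=.
  by rewrite xy addrA subrr add0r addNr.
by rewrite yx -cxy addrAC subrK addNr.
Qed.

(** * The cocycle of one embedding *)

Section cocycle.
Context {R : realType} {n : nat} (M : symplectic_manifold R n).
Local Notation V := 'rV[R]_(n + n).
Local Notation BV := (borelRn R (n + n)).
Local Notation mu := (@lebesgueRn R (n + n)).
Implicit Types (F : frame M) (g h : M -> M).

Lemma full_embedding_frame Omega iota : full_embedding (M := M) Omega iota ->
  full_frame (Omega, iota).
Proof. by move=> fe; split; [exact: embeds_full|case: fe]. Qed.

Lemma negligible_cap (O D1 D2 : set BV) : mu.-negligible (O `\` D1) ->
  mu.-negligible (O `\` D2) -> mu.-negligible (O `\` (D1 `&` D2)).
Proof. by move=> n1 n2; rewrite setDIr; exact: negligibleU. Qed.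

Section one_frame.
Variable F : frame M.
Hypothesis fF : full_frame F.
Let I2 g h := berezin_arrows F F F h g.
Let dom2 g h := symp_integrand_dom F.1 F.2 g h.

Lemma symp_integrand_domE g h :
  symp_integrand_dom F.1 F.2 g h = arrow_dom F F h `&` arrow_dom F F (g \o h).
Proof.
apply/seteqP; split => m [hm gm]; split => //.
  exact: (arrow_dom_comp F g hm).1.
exact: (arrow_dom_comp F g hm).2.
Qed.

Lemma symp_integrand_dom_open g h : Symp M g -> Symp M h -> open (dom2 g h).
Proof.
move=> Sg Sh; rewrite /dom2 symp_integrand_domE.
by apply: openI; apply: arrow_dom_open => //; exact: Symp_comp.
Qed.

Lemma symp_integrand_dom_null g h : Symp M g -> Symp M h ->
  mu.-negligible (F.1 `\` dom2 g h).
Proof.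
move=> Sg Sh; rewrite /dom2 symp_integrand_domE.
by apply: negligible_cap; apply: arrow_dom_null => //; exact: Symp_comp.
Qed.

Lemma symp_integrand_integrable g h : Symp M g -> Symp M h ->
  mu.-integrable (dom2 g h) (EFin \o symp_integrand F.1 F.2 g h).
Proof.
move=> Sg Sh; have od := symp_integrand_dom_open Sg Sh.
have E := symp_integrand_domE g h.
have bd := borel_open od.
apply: (support_integrable fF Sh bd (f := I2 g h) (b := n%:R * (pi / 2))).
- by move=> m [[]].
- by apply: measurable_berezin_arrows => //; rewrite -E.
- by move=> m; rewrite /dom2 E => -[hm ghm]; exact: berezin_arrows_bound.
move=> m; rewrite /dom2 E => -[hm ghm] ncl.
have [_ J1] := jac_local_id fF Sh hm.1 ncl.
rewrite /I2 /berezin_arrows J1 berezin1r//.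
by have [] := arrow_approx fF fF Sg ((arrow_dom_comp F g hm).2 ghm).
Qed.

Lemma symp_cocycle_cocycle :
  is_cocycle2 (Symp M) (fun g1 g2 : M -> M => g1 \o g2) id (symp_cocycle F.1 F.2).
Proof.
split=> [g Sg|g1 g2 g3 S1 S2 S3].
  have Sid := Symp_id M.
  have cl0 m : ~ closure [set x : M | id x <> x] (F.2 m).
    have -> : [set x : M | id x <> x] = set0 by rewrite -subset0 => x /(_ erefl).
    by rewrite closure0.
  have H1 m : dom2 id g m -> symp_integrand F.1 F.2 id g m = 0.
    rewrite /dom2 symp_integrand_domE => -[gm _]; have [F'm _] := arrowK gm.
    have [_ J1] := jac_local_id fF Sid F'm (@cl0 _).
    rewrite -[LHS]/(I2 id g m) /I2 /berezin_arrows J1 berezin1l//.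
    by have [] := arrow_approx fF fF Sg gm.
  have H2 m : dom2 g id m -> symp_integrand F.1 F.2 g id m = 0.
    rewrite /dom2 symp_integrand_domE => -[gm ggm].
    have [_ J1] := jac_local_id fF Sid gm.1 (@cl0 _).
    rewrite -[LHS]/(I2 g id m) /I2 /berezin_arrows J1 berezin1r//.
    by have [] := arrow_approx fF fF Sg ((arrow_dom_comp F g gm).2 ggm).
  have zero (D : set BV) (f : BV -> R) : measurable D -> (forall m, D m -> f m = 0) -> Rintegral mu D f = 0.
    move=> mD f0; rewrite (@eq_Rintegral _ _ _ mu D (cst 0) f); last by move=> m /set_mem/f0.
    by rewrite Rintegral_cst ?mul0r.
  by split; apply: zero => //; apply: borel_open; exact: symp_integrand_dom_open.
have S12 := Symp_comp S1 S2; have S23 := Symp_comp S2 S3; have S123 := Symp_comp S1 S23.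
(* A conull open set on which all four integrands of the identity make sense. *)
pose D0 := arrow_dom F F g3 `&` arrow_dom F F (g2 \o g3) `&` arrow_dom F F (g1 \o (g2 \o g3)).
have oD0 : open D0 by apply: openI; [apply: openI|]; exact: arrow_dom_open.
have mD0 : measurable (D0 : set BV) by exact: borel_open.
have nD0 : mu.-negligible (F.1 `\` D0).
  by apply: negligible_cap; [apply: negligible_cap|]; exact: arrow_dom_null.
have sub g h : Symp M g -> Symp M h -> D0 `<=` dom2 g h ->
    mu.-integrable D0 (EFin \o I2 g h) /\ symp_cocycle F.1 F.2 g h = Rintegral mu D0 (I2 g h).
  move=> Sg Sh D0d; have fd := symp_integrand_integrable Sg Sh.
  have md := borel_open (symp_integrand_dom_open Sg Sh).
  split; first exact: integrableS fd.
  apply: (@Rintegral_conull _ _ (dom2 g h) D0 (I2 g h)) => //.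
  by apply: negligibleS nD0 => x [[[Fx _] _] D0x].
have [|i12_3 ->] := sub _ _ S12 S3; first by rewrite /dom2 symp_integrand_domE => m [[]].
have [|i1_23 ->] := sub _ _ S1 S23; first by rewrite /dom2 symp_integrand_domE => m [[]].
have [|i23 ->] := sub _ _ S2 S3; first by rewrite /dom2 symp_integrand_domE => m [[]].
(* In the identity for c the term of g1 and g2 is taken at the point q3(m), so its integral is first
   pulled back along the arrow of g3. *)
have [|||i12 E12] := @arrow_transfer R n M F F g3 (dom2 g1 g2) D0 (I2 g1 g2) fF fF S3
  (symp_integrand_dom_open S1 S2) _ (symp_integrand_dom_null S1 S2)
  (symp_integrand_integrable S1 S2) oD0 _ _ nD0.
- by move=> m [[]].
- by move=> m [[]].
- move=> m [[m3 m23] m123]; rewrite /dom2 symp_integrand_domE; split.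
    exact: (arrow_dom_comp F g2 m3).2.
  exact: (arrow_dom_comp F (g1 \o g2) m3).2.
have -> : symp_cocycle F.1 F.2 g1 g2 = Rintegral mu D0 (I2 g1 g2 \o arrow F F g3).
  exact: (esym E12).
refine (etrans (esym (RintegralD mD0 i12 i12_3)) (etrans _ (RintegralD mD0 i1_23 i23))).
apply: eq_Rintegral => m /set_mem[[m3 m23] m123]. 
exact: (berezin_arrows_cocycle fF fF fF fF S3 S2 S1 m3 m23 m123).
Qed.

End one_frame.
End cocycle.

(** * Comparison of two embeddings *)

Section two_frames.
Context {R : realType} {n : nat} (M : symplectic_manifold R n).
Local Notation V := 'rV[R]_(n + n).
Local Notation BV := (borelRn R (n + n)).
Local Notation mu := (@lebesgueRn R (n + n)).
Variables F F' : frame M.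
Hypotheses (fF : full_frame F) (fF' : full_frame F').

(* With x, A, y the Jacobi matrices of the change of frame at q(m), of q at m
   and of the change of frame at m, and A' = x A y^-1 that of the transported
   q', this is c(x, A) - c(A', y), the central term comparing the lift of A'
   with the conjugate of the lift of A. *)
Definition comparison (g : M -> M) (m : V) : R :=
  berezin_arrows F F F' g id m - berezin_arrows F F' F' id g m.

Definition comparison_dom (g : M -> M) : set V :=
  arrow_dom F F g `&` arrow_dom F F' g `&` arrow_dom F F' id.

Lemma comparison_dom_open g : Symp M g -> open (comparison_dom g).
Proof.
move=> Sg; have Sid := Symp_id M.
by apply: openI; [apply: openI|]; exact: arrow_dom_open.
Qed.

Lemma comparison_dom_null g : Symp M g -> mu.-negligible (F.1 `\` comparison_dom g).
Proof.
move=> Sg; have Sid := Symp_id M.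
by apply: negligible_cap; [apply: negligible_cap|]; exact: arrow_dom_null.
Qed.

Lemma comparison_integrable g : Symp M g ->
  mu.-integrable (comparison_dom g) (EFin \o comparison g).
Proof.
move=> Sg; have Sid := Symp_id M; have od := comparison_dom_open Sg.
have md := borel_open od.
apply: (support_integrable fF Sg md (f := comparison g)
  (b := n%:R * (pi / 2) + n%:R * (pi / 2))).
- by move=> m [[[]]].
- by apply: measurable_funB; apply: measurable_berezin_arrows => //; move=> m [[]].
- move=> m [[gm g'm] im]; apply: le_trans (ler_normB _ _) _.
  by apply: lerD; exact: berezin_arrows_bound.
move=> m [[gm g'm] im] ncl; have [F'm E] := arrowK im.
have [_ J1] := jac_local_id fF Sg gm.1 ncl.
have ncl' : ~ closure [set x | g x <> x] (F'.2 (arrow F F' id m)) by rewrite E.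
have [_ J2] := jac_local_id fF' Sg F'm ncl'.
rewrite /comparison /berezin_arrows J1 J2 berezin1r ?berezin1l ?subrr//.
  by have [] := arrow_approx fF fF' Sid im.
by have [] := arrow_approx fF fF' Sid ((arrow_dom_comp F' id gm).2 g'm).
Qed.

(** The change of frame is inserted after, before and between g2 and g1, which gives the instances
    E1, E2 and E3 of the cocycle identity. In E1 + E2 - E3 the mixed terms cancel. *)
Lemma comparison_identity g1 g2 m : Symp M g1 -> Symp M g2 ->
  arrow_dom F F g2 m -> arrow_dom F F (g1 \o g2) m -> arrow_dom F F' id m ->
  arrow_dom F F' g2 m -> arrow_dom F F' (g1 \o g2) m ->
  comparison g1 (arrow F F g2 m) =
  (berezin_arrows F F F g2 g1 m + comparison (g1 \o g2) m) -
  (berezin_arrows F' F' F' g2 g1 (arrow F F' id m) + comparison g2 m).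
Proof.
move=> S1 S2 m2 m12 mi m2' m12'; have Sid := Symp_id M.
have E1 := berezin_arrows_cocycle fF fF fF fF' S2 S1 Sid m2 m12 m12'.
have E2 := berezin_arrows_cocycle fF fF' fF' fF' Sid S2 S1 mi m2' m12'.
have E3 := berezin_arrows_cocycle fF fF fF' fF' S2 Sid S1 m2 m2' m12'.
(* Restated up to conversion, so that composites with the identity disappear and equal terms become
   syntactically equal. *)
have {}E1 : berezin_arrows F F F' g1 id (arrow F F g2 m) + berezin_arrows F F F' g2 g1 m =
  berezin_arrows F F F' (g1 \o g2) id m + berezin_arrows F F F g2 g1 m := E1.
have {}E2 : berezin_arrows F' F' F' g2 g1 (arrow F F' id m) + berezin_arrows F F' F' id (g1 \o g2) m =
  berezin_arrows F F' F' g2 g1 m + berezin_arrows F F' F' id g2 m := E2.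
have {}E3 : berezin_arrows F F' F' id g1 (arrow F F g2 m) + berezin_arrows F F F' g2 g1 m =
  berezin_arrows F F' F' g2 g1 m + berezin_arrows F F F' g2 id m := E3.
rewrite /comparison; move: E1 E2 E3.
move: (berezin_arrows _ _ _ _ _ _) (berezin_arrows F F F' g2 g1 m) => a b.
move: (berezin_arrows _ _ _ _ _ _) (berezin_arrows F F F g2 g1 m) => c d.
move: (berezin_arrows F' F' F' g2 g1 _) (berezin_arrows F F' F' id (g1 \o g2) m) => e f.
move: (berezin_arrows F F' F' g2 g1 m) (berezin_arrows F F' F' id g2 m) => g h.
move: (berezin_arrows F F' F' id g1 _) (berezin_arrows F F F' g2 id m) => i j.
lra.
Qed.

Lemma symp_cocycle_frames :
  is_coboundary2 (Symp M) (fun g1 g2 : M -> M => g1 \o g2)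
    (fun g1 g2 => symp_cocycle F.1 F.2 g1 g2 - symp_cocycle F'.1 F'.2 g1 g2).
Proof.
exists (fun g => Rintegral mu (comparison_dom g) (comparison g)) => g1 g2 S1 S2.
have Sid := Symp_id M; have S12 := Symp_comp S1 S2.
(* Conull in the first frame; all terms of the comparison identity are defined on it, including
   those evaluated at the images of m under q2 and under the change of frame. *)
pose D0 := arrow_dom F F g2 `&` arrow_dom F F (g1 \o g2) `&` arrow_dom F F' id `&`
  arrow_dom F F' g2 `&` arrow_dom F F' (g1 \o g2).
have oD0 : open D0.
  by apply: openI; [apply: openI; [apply: openI; [apply: openI|]|]|]; exact: arrow_dom_open.
have mD0 : measurable (D0 : set BV) by exact: borel_open.
have nD0 : mu.-negligible (F.1 `\` D0).
  apply: negligible_cap; [apply: negligible_cap; [apply: negligible_cap;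
    [apply: negligible_cap|]|]|]; exact: arrow_dom_null.
have sub (D : set BV) f : measurable D -> D `<=` F.1 -> D0 `<=` D ->
    mu.-integrable D (EFin \o f) ->
    mu.-integrable D0 (EFin \o f) /\ Rintegral mu D f = Rintegral mu D0 f.
  move=> mD DF D0D fD; split; first exact: integrableS fD.
  apply: Rintegral_conull => //.
  by apply: negligibleS nD0 => x [/DF Fx D0x].
have sD g : comparison_dom g `<=` F.1 by move=> m [[[]]].
have [||iI eI] := sub _ _ (borel_open (symp_integrand_dom_open fF S1 S2)) _ _
  (symp_integrand_integrable fF S1 S2).
- by move=> m [[]].
- by rewrite symp_integrand_domE => m [[[[]]]].
have [|i2 e2] := sub _ _ (borel_open (comparison_dom_open S2)) (sD g2) _ (comparison_integrable S2).
  by move=> m [[[[]]]].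
have [|i12 e12] := sub _ _ (borel_open (comparison_dom_open S12)) (sD _) _ (comparison_integrable S12).
  by move=> m [[[[]]]].
(* [comparison g1] enters at the point q2(m): transfer along g2 inside the first frame. *)
have [||i1 e1] := arrow_transfer fF fF S2 (comparison_dom_open S1) (sD g1)
  (comparison_dom_null S1) (comparison_integrable S1) oD0 _ _ nD0.
- by move=> m [[[[]]]].
- move=> m [[[[m2 m12] mi] m2'] m12']; split; first split.
  + exact: (arrow_dom_comp F g1 m2).2.
  + exact: (arrow_dom_comp F' g1 m2).2.
  + exact: (arrow_dom_comp F' id m2).2.
(* The second cocycle is an integral over the second frame; it is pulled back to the first along the
   change of frame, the arrow of the identity. *)
have [|||iT eT] := arrow_transfer fF fF' Sid (symp_integrand_dom_open fF' S1 S2) _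
  (symp_integrand_dom_null fF' S1 S2) (symp_integrand_integrable fF' S1 S2) oD0 _ _ nD0.
- by move=> m [[]].
- by move=> m [[[[]]]].
- move=> m [[[[m2 m12] mi] m2'] m12']; rewrite symp_integrand_domE; split.
    exact: (arrow_dom_comp F' g2 mi).2.
  exact: (arrow_dom_comp F' (g1 \o g2) mi).2.
have iA := integrableD mD0 iI i12; have iB := integrableD mD0 iT i2.
have eA := RintegralD mD0 iI i12; have eB := RintegralD mD0 iT i2.
have eAB := RintegralB mD0 iA iB.
have key : Rintegral mu D0 (comparison g1 \o arrow F F g2) = _ := etrans
  (eq_Rintegral _ (fun m mD => let: conj (conj (conj (conj m2 m12) mi) m2') m12' := set_mem mD in
     comparison_identity S1 S2 m2 m12 mi m2' m12')) eAB.
have alg (C C' G1 G2 G12 I J k1 k2 k12 : R) : C = I -> J = C' -> k1 = G1 -> G2 = k2 ->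
    G12 = k12 -> k1 = (I + k12) - (J + k2) -> C - C' = G1 + G2 - G12.
  by move=> -> <- <- -> -> ->; ring.
exact: (alg _ _ _ _ _ _ _ _ _ _ eI eT e1 e2 e12
  (etrans key (congr2 (fun a b => a - b) eA eB))).
Qed.

End two_frames.

Unset Implicit Arguments.

Theorem theorem1p1 (R : realType) (n : nat) (M : symplectic_manifold R n) :
  (forall (Omega : set 'rV[R]_(n + n)) (iota : 'rV[R]_(n + n) -> M),
     full_embedding Omega iota ->
     [/\ is_group (Symp M) (fun g1 g2 : M -> M => g1 \o g2),
         (forall g, Symp M g ->
            (@lebesgueRn R (n + n)).-negligible
              (Omega `\` transported_dom Omega iota g)),
         (forall g1 g2, Symp M g1 -> Symp M g2 ->
            (@lebesgueRn R (n + n)).-negligible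
              (Omega `\` symp_integrand_dom Omega iota g1 g2) /\
            (@lebesgueRn R (n + n)).-integrable
              (symp_integrand_dom Omega iota g1 g2)
              (EFin \o symp_integrand Omega iota g1 g2)),
         is_cocycle2 (Symp M) (fun g1 g2 : M -> M => g1 \o g2) id
           (symp_cocycle Omega iota)
       & is_group (Symp M `*` [set: R])
           (extension_mul (fun g1 g2 : M -> M => g1 \o g2)
              (symp_cocycle Omega iota))]) /\
  (forall (Omega Omega' : set 'rV[R]_(n + n)) (iota iota' : 'rV[R]_(n + n) -> M),
     full_embedding Omega iota -> full_embedding Omega' iota' ->
     is_coboundary2 (Symp M) (fun g1 g2 : M -> M => g1 \o g2)
       (fun g1 g2 => symp_cocycle Omega iota g1 g2
                     - symp_cocycle Omega' iota' g1 g2)).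
Proof.
split=> [U i fe|U U' i i' fe fe']; last first.
  exact: (symp_cocycle_frames (full_embedding_frame fe) (full_embedding_frame fe')).
have fF := full_embedding_frame fe.
have cc := symp_cocycle_cocycle fF.
split=> [|g Sg|g1 g2 S1 S2||].
- exact: Symp_group.
- exact: (arrow_dom_null fF fF Sg).
- split; first exact: (symp_integrand_dom_null fF S1 S2).
  exact: (symp_integrand_integrable fF S1 S2).
- exact: cc.
exact: (extension_group (Symp_group M) (Symp_id M) _ cc).
Qed.
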